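(* Let $s\in(1,\frac32)$. Let $V:\mathbb{R}\to\mathbb{R}$ be a measurable function in $L^1(\mathbb{R})$ and let $\eta:[0,+\infty)\to(0,+\infty)$ be a smooth function with $\eta(1)=1$. For every $\varepsilon>0$ let $$h_\varepsilon^{(s/2)}:=(-\Delta)^{s/2}+V_\varepsilon,\qquad V_\varepsilon(x):=\frac{\eta(\varepsilon)}{\varepsilon}V\Big(\frac{x}{\varepsilon}\Big),$$ defined as a form sum; it is a self-adjoint operator on $L^2(\mathbb{R})$. Then $h_\varepsilon^{(s/2)}\to\mathsf{k}_\alpha^{(s/2)}$ as $\varepsilon\downarrow0$ in the norm-resolvent sense on $L^2(\mathbb{R})$, where $$\alpha:=-\Big(\eta(0)\int_{\mathbb{R}}V(x)\,\mathrm{d}x\Big)^{-1}$$ (with $\alpha=\infty$ if $\int_{\mathbb{R}}V\,\mathrm{d}x=0$).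
   Context: Notation: $(-\Delta)^{s/2}$ is the self-adjoint Fourier multiplier $|p|^s$ on $L^2(\mathbb{R})$ with domain $H^s(\mathbb{R})$; inner products are antilinear in the first entry; $|a\rangle\langle b|f:=\langle b,f\rangle a$. The operators $\mathsf{k}_\alpha^{(s/2)}$, $\alpha\in\mathbb{R}\cup\{\infty\}$: let $\mathsf{G}_{s,\lambda}:=\frac{1}{(2\pi)^{1/2}}\big(\frac{1}{|p|^s+\lambda}\big)^\vee$, where $^\vee$ is the inverse of $\widehat\varphi(p)=(2\pi)^{-1/2}\int e^{-\mathrm{i}px}\varphi(x)\mathrm{d}x$, and let $\Theta(s,\lambda):=\big(\lambda^{1-\frac1s}s\sin(\frac{\pi}{s})\big)^{-1}$. Set $\mathsf{k}_\infty^{(s/2)}:=(-\Delta)^{s/2}$. For $\alpha\in\mathbb{R}$, $\mathsf{k}_\alpha^{(s/2)}$ is the self-adjoint operator on $L^2(\mathbb{R})$ (a self-adjoint extension of $(-\Delta)^{s/2}|_{C_0^\infty(\mathbb{R}\setminus\{0\})}$) given, for any $\lambda>0$ with $\alpha\neq\Theta(s,\lambda)$ (the operator does not depend on $\lambda$), by $$\mathcal{D}(\mathsf{k}_\alpha^{(s/2)})=\Big\{g=F^\lambda+\frac{F^\lambda(0)}{\alpha-\Theta(s,\lambda)}\mathsf{G}_{s,\lambda}\,\Big|\,F^\lambda\in H^s(\mathbb{R})\Big\},\quad(\mathsf{k}_\alpha^{(s/2)}+\lambda)g=((-\Delta)^{s/2}+\lambda)F^\lambda;$$ equivalently $(\mathsf{k}_\alpha^{(s/2)}+\lambda\mathbb{1})^{-1}=((-\Delta)^{s/2}+\lambda\mathbb{1})^{-1}+(\alpha-\Theta(s,\lambda))^{-1}|\mathsf{G}_{s,\lambda}\rangle\langle\mathsf{G}_{s,\lambda}|$.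 *)

(* Defs.v *)
From HB Require Import structures.
From mathcomp Require Import all_boot all_order all_algebra.
From mathcomp Require Import all_classical all_reals all_analysis.
From mathcomp Require Import complex.

Set Implicit Arguments.
Unset Strict Implicit.
Unset Printing Implicit Defensive.

Import Order.TTheory GRing.Theory Num.Theory.
Import numFieldNormedType.Exports.

Local Open Scope classical_set_scope.
Local Open Scope ring_scope.
Local Open Scope complex_scope.

Section L2.
Context {R : realType}.
Local Notation mu := (@lebesgue_measure R).
Implicit Types (f g : R -> R[i]).

Definition cabs (z : R[i]) : R := complex.Re `|z|.

Definition cexpi (t : R) : R[i] := cos t +i* sin t.

Definition cintegral (D : set R) f : R[i] :=
  (\int[mu]_(x in D) complex.Re (f x)) +i* (\int[mu]_(x in D) complex.Im (f x)).

(* The elements of L^2(R;C) are represented by (Borel) functions; two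
   representatives of the same element are related by [eqL2]. *)
Definition L2 f : Prop :=
  ((fun x => complex.Re (f x)) : measurableTypeR R -> R) \in Lfun mu 2%:E /\
  ((fun x => complex.Im (f x)) : measurableTypeR R -> R) \in Lfun mu 2%:E.

Definition eqL2 f g : Prop := f = g %[ae mu].

(* Extended-real valued, so that it is +oo on measurable functions which are
   not square integrable. *)
Definition norm2 f : \bar R := ('N[mu]_(2%:E)[(fun x => (cabs (f x))%:E)])%E.

Definition inner f g : R[i] := cintegral setT (fun x => (f x)^* * g x).

(* Fourier-Plancherel transform, as the L^2-limit of
   (2 pi)^(-1/2) \int_[-n,n] e^(-ipx) f(x) dx. *)
Definition fourier_trunc f (n : nat) (p : R) : R[i] :=
  ((Num.sqrt (2 * pi))^-1)%:C *
  cintegral `[- n%:R, n%:R] (fun x => cexpi (- (p * x)) * f x).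

Definition is_fourier f g : Prop :=
  [/\ L2 f, L2 g &
      norm2 (fun p => fourier_trunc f n p - g p) @[n --> \oo] --> 0%E].

Definition fourier f : R -> R[i] := xget (cst 0) [set g | is_fourier f g].

Definition inv_fourier g : R -> R[i] := xget (cst 0) [set f | is_fourier f g].

End L2.

(* A possibly unbounded operator on L^2(R;C) is given by its graph:
   [A u v] means that u belongs to the domain of A and that A u = v. *)
Definition operator (R : realType) := (R -> R[i]) -> (R -> R[i]) -> Prop.

Section Operators.
Context {R : realType}.
Implicit Types (A : operator R) (T : (R -> R[i]) -> (R -> R[i])).

Definition densely_defined A : Prop :=
  forall f, L2 f -> forall d : R, 0 < d ->
  exists u v, A u v /\ (norm2 (fun x => (f x - u x)%R) < d%:E)%E.

(* [adjoint A u v]: u is in D(A^* ) and A^* u = v. *)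
Definition adjoint A : operator R := fun u v =>
  [/\ L2 u, L2 v & forall f g, A f g -> inner u g = inner v f].

Definition self_adjoint A : Prop :=
  densely_defined A /\ forall u v, A u v <-> adjoint A u v.

Definition opnorm T : \bar R :=
  ereal_sup [set norm2 (T f) | f in [set f | L2 f /\ (norm2 f <= 1)%E]].

(* T = (A - z)^-1, an everywhere defined bounded operator. *)
Definition is_resolvent A (z : R[i]) T : Prop :=
  [/\ forall f, L2 f -> L2 (T f) /\ A (T f) (fun x => f x + z * T f x),
      forall u v, A u v -> eqL2 (T (fun x => v x - z * u x)) u &
      (opnorm T < +oo)%E].

Definition norm_resolvent_cvg (A_ : R -> operator R) (F : set_system R)
    (A : operator R) : Prop :=
  [/\ \forall e \near F, self_adjoint (A_ e),
      self_adjoint A &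
      forall z : R[i], complex.Im z != 0 ->
      exists (T_ : R -> (R -> R[i]) -> (R -> R[i])) T,
        [/\ \forall e \near F, is_resolvent (A_ e) z (T_ e),
            is_resolvent A z T &
            opnorm (fun f x => T_ e f x - T f x) @[e --> F] --> 0%E]].

End Operators.

Section Model.
Context {R : realType}.
Local Notation mu := (@lebesgue_measure R).
Implicit Types (s lambda : R).

(* The Sobolev space H^s(R). *)
Definition sobolev s (f : R -> R[i]) : Prop :=
  L2 f /\ L2 (fun p => ((1 + p ^+ 2) `^ (s / 2))%:C * fourier f p).

(* The operator (-Delta)^(s/2), of symbol |p|^s and domain H^s(R). *)
Definition frac_lap s : operator R := fun u v =>
  [/\ sobolev s u, L2 v &
      eqL2 (fourier v) (fun p => (`|p| `^ s)%:C * fourier u p)].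

Definition green s lambda : R -> R[i] :=
  inv_fourier (fun p => ((Num.sqrt (2 * pi))^-1 * (`|p| `^ s + lambda)^-1)%:C).

Definition Theta s lambda : R :=
  (lambda `^ (1 - s^-1) * s * sin (pi / s))^-1.

(* The operator k_alpha^(s/2), described by means of the auxiliary parameter
   lambda (admissible when lambda > 0 and alpha <> Theta s lambda); [None]
   stands for alpha = oo. F is taken to be the continuous representative of
   its class in H^s(R), s > 1, so that F 0 is meaningful. *)
Definition k_op s lambda (alpha : option R) : operator R :=
  if alpha is Some a then
    fun g h => [/\ L2 g, L2 h &
      exists (F w : R -> R[i]),
        [/\ continuous (fun x => complex.Re (F x)),
            continuous (fun x => complex.Im (F x)),
            frac_lap s F w,
            eqL2 g (fun x =>
              F x + F 0 / (a - Theta s lambda)%:C * green s lambda x) &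
            eqL2 (fun x => h x + lambda%:C * g x)
                 (fun x => w x + lambda%:C * F x)]]
  else frac_lap s.

(* The form sum (-Delta)^(s/2) + V: the operator associated with the form
   q(v,u) = <|p|^(s/2) v^, |p|^(s/2) u^> + \int V conj(v) u on the intersection
   of the form domains of (-Delta)^(s/2) and V. *)
Definition form_domain s (V : R -> R) (u : R -> R[i]) : Prop :=
  sobolev (s / 2) u /\
  mu.-integrable setT (fun x => (V x * cabs (u x) ^+ 2)%:E).

Definition form s (V : R -> R) (v u : R -> R[i]) : R[i] :=
  inner (fun p => (`|p| `^ (s / 2))%:C * fourier v p)
        (fun p => (`|p| `^ (s / 2))%:C * fourier u p)
  + cintegral setT (fun x => (V x)%:C * ((v x)^* * u x)).

Definition form_sum s (V : R -> R) : operator R := fun u w =>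
  [/\ form_domain s V u, L2 w &
      forall v, form_domain s V v -> form s V v u = inner v w].

(* [eta] restricted to [0, +oo[ is smooth, with one-sided derivatives at 0; the
   values of [eta] on the negative reals are irrelevant. *)
Definition smooth_half_line (eta : R -> R) : Prop :=
  exists d : nat -> R -> R,
    (forall x, 0 <= x -> d 0%N x = eta x) /\
    forall n x, 0 <= x ->
      (d n y - d n x) / (y - x) @[y --> within [set y | 0 <= y] x^']
        --> d n.+1 x.

Definition scaled_potential (eta V : R -> R) (e : R) : R -> R :=
  fun x => eta e / e * V (x / e).

End Model.

(* Main.v *)
Require Import Defs.
From HB Require Import structures.
From mathcomp Require Import all_boot all_order all_algebra.
From mathcomp Require Import all_classical all_reals all_analysis.
From mathcomp Require Import measurable_realfun complex ring lra.

Set Implicit Arguments.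
Unset Strict Implicit.
Unset Printing Implicit Defensive.

Import Order.TTheory GRing.Theory Num.Theory.
Import numFieldNormedType.Exports.

Local Open Scope classical_set_scope.
Local Open Scope ring_scope.
Local Notation "x %:C" := (real_complex _ x) : ring_scope.

Local Notation Re := complex.Re.
Local Notation Im := complex.Im.

(** In momentum space [form_sum s V] is [f |-> |p|^s f + K f], with [K] the
convolution by the transform of [V] (divided by 2 pi); by scaling, the transform
of [scaled_potential eta V e] at [k] is [eta e * vhat V (e * k)], which tends
boundedly to the constant [eta 0 * I]. With this constant in place of the
transform of a potential, the same expression describes [k_op s lambda alpha]:
the singular part [c * green] of an element of the domain is what is needed for
[|p|^s f + K f] to be square integrable. Writing [f = w x] with the square
integrable weight [w = (|p|^s + l)^(-1/2)], the perturbation becomes the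
Hilbert-Schmidt operator [w K w], small for [l] large; hence the resolvent at a
nonreal point is [w N^-1 w], where [N] is a coercive bounded operator, and
dominated convergence gives the convergence of [w K w] in Hilbert-Schmidt norm.
Finally [Theta s lambda = (2 pi)^-1 int dp / (|p|^s + lambda)], which reduces by
geometric expansions on [0, 1] and [1, +oo[ to the partial fraction expansion
of [pi / sin (pi a)]. *)

(** * Complex-valued measurable and integrable functions *)

Section cabs.
Context {R : realType}.
Implicit Types (z w : R[i]) (x y t : R).

(** As [V] is only integrable, its transform is known to be bounded and nothing more. This is
    enough: for s > 1 the weight (|p|^s + l)^(-1) is integrable, so every bounded convolution kernel
    becomes Hilbert-Schmidt between two factors w, including the constant kernel of a delta
    interaction. The approximating operators and their limit thus lie in one family, for which
    self-adjointness, resolvents and stability are proved once. The inverse in alpha has the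
    following origin. An element g of the domain has a regular part F and a charge c = F(0) / (alpha
    - Theta). Since the Green function takes the value Theta at 0, g(0) = c alpha, so the charge is
    g(0) / alpha and the delta interaction has strength -1 / alpha = eta(0) I. The closed form of
    [Theta] has to be matched with the integral that gives this value at 0. Two spectral parameters
    must be kept apart: lambda is prescribed in [k_op], while l has to be large for w K w to be
    small. They do not conflict, because the momentum form of [k_op] no longer mentions lambda. *)

Lemma conjE z : z^* = conjc z. Proof. by []. Qed.

Lemma cabsE z : cabs z = Num.sqrt (Re z ^+ 2 + Im z ^+ 2).
Proof. by rewrite /cabs normc_def. Qed.

Lemma cabsC z : (cabs z)%:C = `|z|.
Proof. by rewrite /cabs normc_def. Qed.

Lemma cabs_ge0 z : 0 <= cabs z.
Proof. by rewrite cabsE sqrtr_ge0. Qed.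

Lemma sqr_cabs z : cabs z ^+ 2 = Re z ^+ 2 + Im z ^+ 2.
Proof. by rewrite cabsE sqr_sqrtr// addr_ge0// sqr_ge0. Qed.

Lemma cabs0 : cabs (0 : R[i]) = 0.
Proof. by rewrite cabsE /= expr0n /= addr0 sqrtr0. Qed.

Lemma cabs_eq0 z : cabs z = 0 -> z = 0.
Proof.
move=> z0; apply/eqP; rewrite -normr_eq0 -cabsC z0; exact/eqP.
Qed.

Lemma cabsM z w : cabs (z * w) = cabs z * cabs w.
Proof. by apply: complexI; rewrite rmorphM /= !cabsC normrM. Qed.

Lemma cabsD z w : cabs (z + w) <= cabs z + cabs w.
Proof. by rewrite -lecR rmorphD /= !cabsC ler_normD. Qed.

Lemma cabsN z : cabs (- z) = cabs z.
Proof. by apply: complexI; rewrite !cabsC normrN. Qed.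

Lemma cabsB z w : cabs (z - w) <= cabs z + cabs w.
Proof. by rewrite -(cabsN w) cabsD. Qed.

Lemma cabs_distC z w : cabs (z - w) = cabs (w - z).
Proof. by rewrite -cabsN opprB. Qed.

Lemma cabsJ z : cabs z^* = cabs z.
Proof. by rewrite !cabsE conjE; case: z => a b /=; rewrite sqrrN. Qed.

Lemma cabsR x : cabs x%:C = `|x|.
Proof. by rewrite cabsE /= expr0n /= addr0 sqrtr_sqr. Qed.

Lemma Re_le_cabs z : `|Re z| <= cabs z.
Proof.
rewrite cabsE -sqrtr_sqr ler_sqrt ?addr_ge0 ?sqr_ge0//.
by rewrite lerDl sqr_ge0.
Qed.

Lemma Im_le_cabs z : `|Im z| <= cabs z.
Proof.
rewrite cabsE -sqrtr_sqr ler_sqrt ?addr_ge0 ?sqr_ge0//.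
by rewrite lerDr sqr_ge0.
Qed.

Lemma cabs_le z : cabs z <= `|Re z| + `|Im z|.
Proof.
rewrite -[leRHS]ger0_norm ?addr_ge0// -sqrtr_sqr cabsE ler_sqrt ?sqr_ge0//.
rewrite sqrrD !real_normK ?num_real// addrAC lerDl mulrn_wge0//.

Qed.

Lemma cabs_cexpi t : cabs (cexpi t) = 1.
Proof. by rewrite cabsE /= cos2Dsin2 sqrtr1. Qed.

Lemma cexpiD x y : cexpi (x + y) = cexpi x * cexpi y :> R[i].
Proof.
rewrite /cexpi cosD sinD; apply/eqP; rewrite eq_complex /=.
by apply/andP; split; apply/eqP; ring.
Qed.

Lemma cexpi0 : cexpi 0 = 1 :> R[i].
Proof. by rewrite /cexpi cos0 sin0. Qed.

Lemma cexpiJ x : (cexpi x)^* = cexpi (- x).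
Proof. by rewrite conjE /cexpi cosN sinN. Qed.

Lemma cReD z w : Re (z + w) = Re z + Re w. Proof. by case: z; case: w. Qed.
Lemma cImD z w : Im (z + w) = Im z + Im w. Proof. by case: z; case: w. Qed.
Lemma cReN z : Re (- z) = - Re z. Proof. by case: z. Qed.
Lemma cImN z : Im (- z) = - Im z. Proof. by case: z. Qed.
Lemma cReB z w : Re (z - w) = Re z - Re w. Proof. by rewrite cReD cReN. Qed.
Lemma cImB z w : Im (z - w) = Im z - Im w. Proof. by rewrite cImD cImN. Qed.
Lemma cReM z w : Re (z * w) = Re z * Re w - Im z * Im w.
Proof. by case: z; case: w. Qed.
Lemma cImM z w : Im (z * w) = Re z * Im w + Im z * Re w.
Proof. by case: z => a b; case: w => c d /=. Qed.
Lemma cReJ z : Re z^* = Re z. Proof. by rewrite conjE; case: z. Qed.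
Lemma cImJ z : Im z^* = - Im z. Proof. by rewrite conjE; case: z. Qed.

Lemma complex_eqP z w : Re z = Re w -> Im z = Im w -> z = w.
Proof. by case: z => a b; case: w => c d /= -> ->. Qed.

Lemma cJD z w : (z + w)^* = z^* + w^*. Proof. exact: rmorphD. Qed.

Lemma cJB z w : (z - w)^* = z^* - w^*. Proof. exact: rmorphB. Qed.
Lemma cJM z w : (z * w)^* = z^* * w^*. Proof. exact: rmorphM. Qed.
Lemma cJK z : (z^*)^* = z. Proof. exact: conjCK. Qed.
Lemma cJR x : (x%:C)^* = x%:C :> R[i]. Proof. exact: conjc_real. Qed.

Lemma mulJc z : z^* * z = (cabs z ^+ 2)%:C.
Proof.
by apply: complex_eqP; rewrite ?cReM ?cImM cReJ cImJ /= ?sqr_cabs; ring.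
Qed.

Lemma cabs_exp2_eq0 z : cabs z ^+ 2 = 0 -> z = 0.
Proof. by move/eqP; rewrite sqrf_eq0 => /eqP/cabs_eq0. Qed.

End cabs.

Section cmeas.
Context d (T : measurableType d) {R : realType}.
Implicit Types (f g : T -> R[i]).

Definition cmeas f := measurable_fun setT (fun x => Re (f x)) /\
  measurable_fun setT (fun x => Im (f x)).

Lemma cmeas_cst c : cmeas (fun=> c).
Proof. by split; exact: measurable_cst. Qed.

Lemma cmeasD f g : cmeas f -> cmeas g -> cmeas (fun x => f x + g x).
Proof.
move=> [f1 f2] [g1 g2]; split.
  under eq_fun do rewrite cReD.
  exact: measurable_funD.
under eq_fun do rewrite cImD.
exact: measurable_funD.
Qed.

Lemma cmeasN f : cmeas f -> cmeas (fun x => - f x).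
Proof.
move=> [f1 f2]; split.
  under eq_fun do rewrite cReN.
  exact: measurable_funN.
under eq_fun do rewrite cImN.
exact: measurable_funN.
Qed.

Lemma cmeasB f g : cmeas f -> cmeas g -> cmeas (fun x => f x - g x).
Proof. by move=> mf mg; apply: cmeasD => //; exact: cmeasN. Qed.

Lemma cmeasM f g : cmeas f -> cmeas g -> cmeas (fun x => f x * g x).
Proof.
move=> [f1 f2] [g1 g2]; split.
  under eq_fun do rewrite cReM.
  by apply: measurable_funB; exact: measurable_funM.
under eq_fun do rewrite cImM.
by apply: measurable_funD; exact: measurable_funM.
Qed.

Lemma cmeasJ f : cmeas f -> cmeas (fun x => (f x)^*).
Proof.
move=> [f1 f2]; split.
  by under eq_fun do rewrite cReJ.
under eq_fun do rewrite cImJ.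
exact: measurable_funN.
Qed.

Lemma cmeasR (h : T -> R) : measurable_fun setT h -> cmeas (fun x => (h x)%:C).
Proof. by move=> mh; split => //=; exact: measurable_cst. Qed.

Lemma cmeas_cabs f : cmeas f -> measurable_fun setT (fun x => cabs (f x)).
Proof.
move=> [f1 f2]; under eq_fun do rewrite cabsE.
apply: (@measurableT_comp _ _ _ _ _ _ (@Num.sqrt R)).
  by apply: continuous_measurable_fun => x; exact: sqrt_continuous.
by apply: measurable_funD; exact: measurable_funX.
Qed.

Lemma cmeas_cexpi (h : T -> R) : measurable_fun setT h ->
  cmeas (fun x => cexpi (h x)).
Proof.
move=> mh; split => /=.
  apply: (@measurableT_comp _ _ _ _ _ _ (@cos R)) => //.
  exact: continuous_measurable_fun (@continuous_cos R).
apply: (@measurableT_comp _ _ _ _ _ _ (@sin R)) => //.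
exact: continuous_measurable_fun (@continuous_sin R).
Qed.

Lemma cmeas_indic (A : set T) f : measurable A -> cmeas f ->
  cmeas (fun x => f x * (\1_A x)%:C).
Proof. by move=> mA mf; apply: cmeasM => //; apply: cmeasR. Qed.

End cmeas.

Lemma cmeas_comp d d' (T : measurableType d) (T' : measurableType d')
    (R : realType) (f : T' -> R[i]) (h : T -> T') :
  cmeas f -> measurable_fun setT h -> cmeas (fun x => f (h x)).
Proof.
move=> [f1 f2] mh; split.
  exact: (@measurableT_comp _ _ _ _ _ _ (fun x => Re (f x))).
exact: (@measurableT_comp _ _ _ _ _ _ (fun x => Im (f x))).
Qed.

Lemma cvg0_squeeze (R : realType) (u v : nat -> R) : (forall n, 0 <= u n <= v n) ->
  v n @[n --> \oo] --> 0 -> u n @[n --> \oo] --> 0.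
Proof.
move=> uv v0; apply: (@squeeze_cvgr _ _ _ _ (fun=> 0) v) => //.
  exact: nearW.
exact: cvg_cst.
Qed.

Section real_integral.
Context {R : realType}.
Local Notation mu := (@lebesgue_measure R).
Implicit Types (f g : R -> R) (P Q S : R -> Prop).

(** A wrapper around the almost-everywhere filter: the lemmas that follow fix its filter instance
    once, so that later proofs need not name it. *)
Definition aeR P : Prop := {ae mu, forall x, P x}.

Lemma aeR_W P : (forall x, P x) -> aeR P.
Proof. exact: (aeW mu). Qed.

Lemma aeR_S P Q : aeR P -> (forall x, P x -> Q x) -> aeR Q.
Proof.
by move=> p pq; exact: (@filterS _ _ (ae_filter_ringOfSetsType mu) _ _ pq p).
Qed.

Lemma aeR_I P Q : aeR P -> aeR Q -> aeR (fun x => P x /\ Q x).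
Proof. exact: (@filterI _ _ (ae_filter_ringOfSetsType mu)). Qed.

Lemma aeR_S2 P Q S : aeR P -> aeR Q -> (forall x, P x -> Q x -> S x) -> aeR S.
Proof. by move=> p q pqs; apply: (aeR_S (aeR_I p q)) => x [] /pqs. Qed.

Lemma aeR_all (P_ : nat -> R -> Prop) : (forall n, aeR (P_ n)) ->
  aeR (fun x => forall n, P_ n x).
Proof. by move=> h; apply/ae_foralln. Qed.

Lemma aeR_eqP (T : Type) (f g : R -> T) : f = g %[ae mu] <-> aeR (fun x => f x = g x).
Proof.
by split => h; apply: (aeR_S h) => x; [exact|].
Qed.

Lemma mEFin f : measurable_fun setT f ->
  measurable_fun (setT : set (measurableTypeR R)) (fun x => (f x)%:E).
Proof. by move=> mf; apply: (measurableT_comp (@EFin_measurable R setT) mf). Qed.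

Lemma rmeas_norm f : measurable_fun setT f -> measurable_fun setT (fun x => `|f x|).
Proof. by move=> mf; apply: measurableT_comp. Qed.

Definition rint f : Prop := mu.-integrable setT (fun x => (f x)%:E).

Lemma rint_meas f : rint f -> measurable_fun setT f.
Proof. by move=> /measurable_int/measurable_EFinP. Qed.

Lemma rintP f : rint f <-> measurable_fun setT f /\
  (\int[mu]_x `|f x|%:E < +oo)%E.
Proof.
split=> [/integrableP[/measurable_EFinP mf lf]|[mf lf]].
  by split.
by apply/integrableP; split => //; exact/measurable_EFinP.
Qed.

Lemma rint0 : rint (fun=> 0).
Proof. exact: integrable0. Qed.

Lemma rintD f g : rint f -> rint g -> rint (fun x => f x + g x).
Proof. exact: integrableD. Qed.

Lemma rintB f g : rint f -> rint g -> rint (fun x => f x - g x).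
Proof. exact: integrableB. Qed.

Lemma rintZ c f : rint f -> rint (fun x => c * f x).
Proof. exact: integrableZl. Qed.

Lemma rint_norm f : rint f -> rint (fun x => `|f x|).
Proof. exact: integrable_norm. Qed.

Lemma rint_le f g : measurable_fun setT f -> rint g ->
  (forall x, `|f x| <= g x) -> rint f.
Proof.
move=> mf ig fg; apply: le_integrable ig => //; first exact/measurable_EFinP.
by move=> x _; rewrite lee_fin (le_trans (fg x))// ler_norm.
Qed.

Lemma EFin_int f : rint f -> (\int[mu]_x (f x)%:E)%E = (\int[mu]_x f x)%:E.
Proof. by move=> fi; rewrite /Rintegral fineK//; exact: integrable_fin_num. Qed.

Lemma rint_ge0P f : measurable_fun setT f -> (forall x, 0 <= f x) ->
  (\int[mu]_x (f x)%:E < +oo)%E -> rint f.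
Proof.
move=> mf f0 fy; apply/rintP; split => //.
by under eq_integral do rewrite ger0_norm//.
Qed.

Lemma intD f g : rint f -> rint g ->
  \int[mu]_x (f x + g x) = \int[mu]_x f x + \int[mu]_x g x.
Proof. exact: RintegralD. Qed.

Lemma intB f g : rint f -> rint g ->
  \int[mu]_x (f x - g x) = \int[mu]_x f x - \int[mu]_x g x.
Proof. exact: RintegralB. Qed.

Lemma intZ c f : rint f -> \int[mu]_x (c * f x) = c * \int[mu]_x f x.
Proof. exact: RintegralZl. Qed.

Lemma intN f : rint f -> \int[mu]_x (- f x) = - \int[mu]_x f x.
Proof.
move=> fi; rewrite -mulN1r -intZ//; congr Rintegral.
by apply/funext => x; rewrite mulN1r.
Qed.

Lemma int_le f g : rint f -> rint g -> (forall x, f x <= g x) ->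
  \int[mu]_x f x <= \int[mu]_x g x.
Proof. by move=> fi gi fg; apply: le_Rintegral => // x _; exact: fg. Qed.

Lemma int_ge0 f : (forall x, 0 <= f x) -> 0 <= \int[mu]_x f x.
Proof. by move=> f0; apply: Rintegral_ge0. Qed.

Lemma int_norm f : rint f -> `|\int[mu]_x f x| <= \int[mu]_x `|f x|.
Proof. exact: le_normr_Rintegral. Qed.

Lemma eq_int f g : f =1 g -> \int[mu]_x f x = \int[mu]_x g x.
Proof. by move=> fg; congr Rintegral; apply/funext. Qed.

Lemma int_ae f g : measurable_fun setT f -> measurable_fun setT g ->
  aeR (fun x => f x = g x) -> \int[mu]_x f x = \int[mu]_x g x.
Proof.
move=> mf mg fg; rewrite /Rintegral; congr fine.
apply: ae_eq_integral => //; try exact: mEFin.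
by apply: (aeR_S fg) => x ->.
Qed.

Lemma rint_ae f g : rint f -> measurable_fun setT g ->
  aeR (fun x => f x = g x) -> rint g.
Proof.
move=> /rintP[mf fy] mg fg; apply/rintP; split => //.
rewrite (_ : (\int[mu]_x _)%E = (\int[mu]_x `|f x|%:E)%E)//.
apply: ae_eq_integral => //; try exact: (mEFin (rmeas_norm _)).
by apply: (aeR_S fg) => x ->.
Qed.

Lemma int_eq0_ae f : rint f -> (forall x, 0 <= f x) -> \int[mu]_x f x = 0 ->
  aeR (fun x => f x = 0).
Proof.
move=> fi f0 f00.
have [+ _] := @ae_eq_integral_abs _ _ _ mu setT measurableT
  (fun x => (f x)%:E) (mEFin (rint_meas fi)).
have -> : (\int[mu]_x `|(f x)%:E| = 0)%E.
  under eq_integral do rewrite gee0_abs ?lee_fin ?f0//.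
  by rewrite EFin_int// f00.
by move=> /(_ erefl) h; apply: (aeR_S h) => x /(_ I)[].
Qed.

Lemma int_dct (f_ : nat -> R -> R) f g : (forall n, measurable_fun setT (f_ n)) ->
  measurable_fun setT f -> rint g ->
  aeR (fun x => f_ n x @[n --> \oo] --> f x) ->
  (forall n x, `|f_ n x| <= g x) ->
  rint f /\ \int[mu]_x f_ n x @[n --> \oo] --> \int[mu]_x f x.
Proof.
move=> mf_ mf gi cf fg.
have gi' : mu.-integrable setT (EFin \o g) by exact: gi.
have [||||fi _ cv] := @dominated_convergence _ _ _ mu setT measurableT
    (fun n x => (f_ n x)%:E) (fun x => (f x)%:E) (EFin \o g) _ _ _ gi' _.
- by move=> n; exact: mEFin.
- exact: mEFin.
- by apply: (aeR_S cf) => x {}cf _; apply/fine_cvgP; split; [exact: nearW|exact: cf].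
- by apply: aeR_W => x n _; rewrite lee_fin.
split => //.
move: cv; rewrite (EFin_int fi) => /fine_cvgP[_].
by apply: cvg_trans; apply: near_eq_cvg; exact: nearW.
Qed.

Lemma int_dctP (f_ : nat -> R -> R) f g : (forall n, measurable_fun setT (f_ n)) ->
  rint g -> (forall x, f_ n x @[n --> \oo] --> f x) ->
  (forall n x, `|f_ n x| <= g x) ->
  rint f /\ \int[mu]_x f_ n x @[n --> \oo] --> \int[mu]_x f x.
Proof.
move=> mf_ gi cf fg; apply: int_dct fg => //; last exact: aeR_W.
by apply: (measurable_fun_cvg mf_) => x _; exact: cf.
Qed.

End real_integral.

Section complex_integral.
Context {R : realType}.
Local Notation mu := (@lebesgue_measure R).
Implicit Types (f g : R -> R[i]) (c : R[i]).

Definition J f : R[i] := cintegral setT f.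
#[local] Arguments cintegral : simpl never.

Definition cint f : Prop := cmeas f /\ rint (fun x => cabs (f x)).

Lemma cint_Re f : cint f -> rint (fun x => Re (f x)).
Proof. by move=> [[mr mi] fi]; apply: rint_le fi _ => // x; exact: Re_le_cabs. Qed.

Lemma cint_Im f : cint f -> rint (fun x => Im (f x)).
Proof. by move=> [[mr mi] fi]; apply: rint_le fi _ => // x; exact: Im_le_cabs. Qed.

Lemma cintP f : rint (fun x => Re (f x)) -> rint (fun x => Im (f x)) -> cint f.
Proof.
move=> ri ii.
have mf : cmeas f by split; exact: rint_meas.
split => //; apply: rint_le (rintD (rint_norm ri) (rint_norm ii)) _.
  exact: cmeas_cabs.
by move=> x; rewrite ger0_norm ?cabs_ge0// cabs_le.
Qed.

Lemma cint_le f (g : R -> R) : cmeas f -> rint g -> (forall x, cabs (f x) <= g x) ->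
  cint f.
Proof.
move=> mf gi fg; split => //; apply: rint_le gi _; first exact: cmeas_cabs.
by move=> x; rewrite ger0_norm ?cabs_ge0.
Qed.

Lemma cintD f g : cint f -> cint g -> cint (fun x => f x + g x).
Proof.
move=> [mf fi] [mg gi]; apply: (cint_le (cmeasD mf mg) (rintD fi gi)) => x.
exact: cabsD.
Qed.

Lemma cintN f : cint f -> cint (fun x => - f x).
Proof.
by move=> [mf fi]; apply: (cint_le (cmeasN mf) fi) => x; rewrite cabsN.
Qed.

Lemma cintB f g : cint f -> cint g -> cint (fun x => f x - g x).
Proof. by move=> fi gi; apply: cintD => //; exact: cintN. Qed.

Lemma cintZ (c : R[i]) f : cint f -> cint (fun x => c * f x).
Proof.
move=> [mf fi].
have mcf : cmeas (fun x => c * f x) by apply: cmeasM => //; exact: cmeas_cst.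
by apply: (cint_le mcf (rintZ (cabs c) fi)) => x; rewrite cabsM.
Qed.

Lemma cintJ f : cint f -> cint (fun x => (f x)^*).
Proof.
by move=> [mf fi]; apply: (cint_le (cmeasJ mf) fi) => x; rewrite cabsJ.
Qed.

Lemma cintR (h : R -> R) : rint h -> cint (fun x => (h x)%:C).
Proof. by move=> hi; apply: cintP => //=; exact: rint0. Qed.

Lemma cint_bddM f g C : cint f -> cmeas g -> (forall x, cabs (g x) <= C) ->
  cint (fun x => g x * f x).
Proof.
move=> [mf fi] mg gC; apply: (cint_le (cmeasM mg mf) (rintZ C fi)) => x.
by rewrite cabsM ler_wpM2r ?cabs_ge0.
Qed.

Lemma Re_J f : Re (J f) = \int[mu]_x Re (f x). Proof. by []. Qed.
Lemma Im_J f : Im (J f) = \int[mu]_x Im (f x). Proof. by []. Qed.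

Lemma eq_J f g : f =1 g -> J f = J g.
Proof. by move=> fg; congr J; apply/funext. Qed.

Lemma J0 : J (fun=> 0) = 0.
Proof.
apply: complex_eqP; rewrite ?Re_J ?Im_J /=.
  by rewrite /Rintegral integral0.
by rewrite /Rintegral integral0.
Qed.

Lemma JD f g : cint f -> cint g -> J (fun x => f x + g x) = J f + J g.
Proof.
move=> fi gi; apply: complex_eqP; rewrite ?cReD ?cImD ?Re_J ?Im_J.
  under eq_int do rewrite cReD.
  by rewrite intD//; exact: cint_Re.
under eq_int do rewrite cImD.
by rewrite intD//; exact: cint_Im.
Qed.

Lemma JN f : cint f -> J (fun x => - f x) = - J f.
Proof.
move=> fi; apply: complex_eqP; rewrite ?cReN ?cImN ?Re_J ?Im_J.
  under eq_int do rewrite cReN.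
  by rewrite intN//; exact: cint_Re.
under eq_int do rewrite cImN.
by rewrite intN//; exact: cint_Im.
Qed.

Lemma JB f g : cint f -> cint g -> J (fun x => f x - g x) = J f - J g.
Proof. by move=> fi gi; rewrite JD//; [rewrite JN|exact: cintN]. Qed.

Lemma JZ (c : R[i]) f : cint f -> J (fun x => c * f x) = c * J f.
Proof.
move=> fi; have [ri ii] := (cint_Re fi, cint_Im fi).
apply: complex_eqP; rewrite ?cReM ?cImM ?Re_J ?Im_J.
  under eq_int do rewrite cReM.
  by rewrite intB ?intZ//; exact: rintZ.
under eq_int do rewrite cImM.
by rewrite intD ?intZ//; exact: rintZ.
Qed.

Lemma JJ f : cint f -> J (fun x => (f x)^*) = (J f)^*.
Proof.
move=> fi; apply: complex_eqP; rewrite ?cReJ ?cImJ ?Re_J ?Im_J.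
  by under eq_int do rewrite cReJ.
under eq_int do rewrite cImJ.
by rewrite intN//; exact: cint_Im.
Qed.

Lemma J_real (h : R -> R) : rint h -> J (fun x => (h x)%:C) = (\int[mu]_x h x)%:C.
Proof.
move=> hi; apply: complex_eqP; rewrite ?Re_J ?Im_J //=.
by rewrite /Rintegral integral0.
Qed.

Lemma J_ae f g : cmeas f -> cmeas g -> aeR (fun x => f x = g x) -> J f = J g.
Proof.
move=> [mf1 mf2] [mg1 mg2] fg; apply: complex_eqP; rewrite ?Re_J ?Im_J.
  by apply: int_ae => //; apply: (aeR_S fg) => x ->.
by apply: int_ae => //; apply: (aeR_S fg) => x ->.
Qed.

Lemma cint_ae f g : cint f -> cmeas g -> aeR (fun x => f x = g x) -> cint g.
Proof.
move=> [mf fi] mg fg; split => //; apply: rint_ae fi _ _; first exact: cmeas_cabs.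
by apply: (aeR_S fg) => x ->.
Qed.

(** Rotation by the unit phase [c] makes [c * J f] real and nonnegative; it is then the integral of
    the real part of c f, which is pointwise at most |f|. *)
Lemma cabs_J f : cint f -> cabs (J f) <= \int[mu]_x cabs (f x).
Proof.
move=> fi.
have [->|/eqP J0] := eqVneq (cabs (J f)) 0.
  by apply: int_ge0 => x; exact: cabs_ge0.
set c := (J f)^* / (cabs (J f))%:C.
have c1 : cabs c = 1.
  rewrite /c cabsM cabsJ -fmorphV /= cabsR ger0_norm ?invr_ge0 ?cabs_ge0//.
  by rewrite mulfV//; exact/eqP.
have cJ : c * J f = (cabs (J f))%:C.
  rewrite /c mulrAC mulJc -fmorphV -rmorphM /=; congr (_%:C).
  by rewrite expr2 mulfK//; exact/eqP.
have -> : cabs (J f) = Re (c * J f) by rewrite cJ.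
rewrite -JZ// Re_J; apply: int_le.
- by apply: cint_Re; exact: cintZ.
- by case: fi.
move=> x; rewrite (le_trans (ler_norm _))// (le_trans (Re_le_cabs _))//.
by rewrite cabsM c1 mul1r.
Qed.

Lemma J_dct (f_ : nat -> R -> R[i]) f (g : R -> R) :
  (forall n, cmeas (f_ n)) -> cmeas f -> rint g ->
  aeR (fun x => cabs (f_ n x - f x) @[n --> \oo] --> 0) ->
  (forall n x, cabs (f_ n x) <= g x) -> aeR (fun x => cabs (f x) <= g x) ->
  cabs (J (f_ n) - J f) @[n --> \oo] --> 0.
Proof.
move=> mf_ mf gi cf fg fgl.
have fi_ n : cint (f_ n) by apply: cint_le gi _.
have fi : cint f.
  split => //; apply/rintP; split; first exact: cmeas_cabs.
  have /rintP[mg] := gi; apply: le_lt_trans; apply: ae_ge0_le_integral => //.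
  - by apply: mEFin; apply: rmeas_norm; exact: cmeas_cabs.
  - by apply: mEFin; exact: rmeas_norm.
  - apply: (aeR_S fgl) => x fx _; rewrite lee_fin ger0_norm ?cabs_ge0//.
    by rewrite (le_trans fx)// ler_norm.
(* The cap at [2 * g x] provides a majorant valid at every point, as [int_dct] requires, although
   [f] is dominated by [g] only almost everywhere. *)
have [] := @int_dct R (fun n x => Num.min (cabs (f_ n x - f x)) (2 * g x)) (fun=> 0)
    (fun x => 2 * g x).
- move=> n; apply: measurable_minr; first by apply: cmeas_cabs; exact: cmeasB.
  by apply: measurable_funM => //; exact: rint_meas gi.
- exact: measurable_cst.
- exact: rintZ.
- apply: (aeR_S2 cf fgl) => x {}cf fgx.
  apply: (@squeeze_cvgr _ _ _ _ (fun=> 0) (fun n => cabs (f_ n x - f x))) => //.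
    apply: nearW => n; rewrite le_min cabs_ge0 ge_min lexx /= andbT mulr_ge0//.
    by rewrite (le_trans _ fgx)// cabs_ge0.
  exact: cvg_cst.
- move=> n x; rewrite ger0_norm ?ge_min ?lexx ?orbT//.
  by rewrite le_min cabs_ge0 /= mulr_ge0// (le_trans _ (fg 0%N x))// cabs_ge0.
move=> _; rewrite (_ : \int[mu]_x 0 = 0); last by rewrite /Rintegral integral0.
apply: cvg0_squeeze => n; rewrite cabs_ge0 /= -JB//.
apply: le_trans (cabs_J (cintB (fi_ n) fi)) _.
rewrite le_eqVlt; apply/orP; left; apply/eqP; apply: int_ae.
- by apply: cmeas_cabs; exact: cmeasB.
- apply: measurable_minr; first by apply: cmeas_cabs; exact: cmeasB.
  by apply: measurable_funM => //; exact: rint_meas gi.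
- apply: (aeR_S fgl) => x fgx; rewrite min_l// (le_trans (cabsB _ _))//.
  by rewrite mulr2n mulrDl mul1r lerD.
Qed.

End complex_integral.

#[local] Arguments inner : simpl never.
#[local] Arguments cintegral : simpl never.

(** * The space L^2(R; C) *)

Section L2_theory.
Context {R : realType}.
Local Notation mu := (@lebesgue_measure R).
Implicit Types (f g h : R -> R[i]) (c : R[i]).

Lemma Lfun2P (h : R -> R) :
  (h : measurableTypeR R -> R) \in Lfun mu 2%:E <->
  measurable_fun setT h /\ rint (fun x => h x ^+ 2).
Proof.
split=> [hL|[mh hi]].
  split; last exact: (Lfun2_integrable_sqr hL).
  by move: hL; rewrite inE => /andP[/[!inE]].
rewrite inE; apply/andP; split; rewrite inE //=.
rewrite /finite_norm unlock /Lnorm.body /=.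
rewrite (_ : (\int[mu]_x _)%E = (\int[mu]_x (h x ^+ 2))%:E).
  by rewrite poweR_EFin ltry.
rewrite -EFin_int//; apply: eq_integral => x _.
by rewrite powR_mulrn// real_normK ?num_real.
Qed.

Definition sq f : R := \int[mu]_x (cabs (f x) ^+ 2).
Definition nn f : R := Num.sqrt (sq f).

Lemma L2P f : L2 f <-> cmeas f /\ rint (fun x => cabs (f x) ^+ 2).
Proof.
split=> [[/Lfun2P[mr ri] /Lfun2P[mi ii]]|[[mr mi] fi]].
  split => //; under eq_fun do rewrite sqr_cabs.
  exact: rintD.
split; apply/Lfun2P; split => //; apply: (rint_le _ fi) => [|x].
- exact: measurable_funX.
- by rewrite ger0_norm ?sqr_ge0// sqr_cabs lerDl sqr_ge0.
- exact: measurable_funX.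
- by rewrite ger0_norm ?sqr_ge0// sqr_cabs lerDr sqr_ge0.
Qed.

Lemma L2_meas f : L2 f -> cmeas f. Proof. by case/L2P. Qed.
Lemma L2_sq f : L2 f -> rint (fun x => cabs (f x) ^+ 2). Proof. by case/L2P. Qed.

Lemma sq_ge0 f : 0 <= sq f.
Proof. by apply: int_ge0 => x; exact: sqr_ge0. Qed.

Lemma nn_ge0 f : 0 <= nn f. Proof. exact: sqrtr_ge0. Qed.

Lemma nn2 f : nn f ^+ 2 = sq f. Proof. by rewrite sqr_sqrtr// sq_ge0. Qed.

Lemma norm2E f : L2 f -> norm2 f = (nn f)%:E.
Proof.
move=> /L2P[mf fi]; rewrite /norm2 unlock /Lnorm.body /=.
rewrite (_ : (\int[mu]_x _)%E = (sq f)%:E); last first.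
  rewrite -EFin_int//; apply: eq_integral => x _.
  rewrite powR_mulrn// real_normK ?num_real//.
by rewrite poweR_EFin; congr (_%:E); rewrite powR12_sqrt// sq_ge0.
Qed.

Lemma L2_le f g C : cmeas f -> L2 g -> (forall x, cabs (f x) <= C * cabs (g x)) -> L2 f.
Proof.
move=> mf /L2P[mg gi] fg; apply/L2P; split => //.
apply: (rint_le _ (rintZ (C ^+ 2) gi)) => [|x].
  by apply: measurable_funX; exact: cmeas_cabs.
by rewrite ger0_norm ?sqr_ge0// -exprMn lerXn2r// nnegrE ?cabs_ge0// (le_trans _ (fg x))// cabs_ge0.
Qed.

Lemma L20 : L2 (fun=> 0 : R[i]).
Proof.
apply/L2P; split; first exact: cmeas_cst.
by under eq_fun do rewrite cabs0 expr0n /=; exact: rint0.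
Qed.

Lemma L2Z c f : L2 f -> L2 (fun x => c * f x).
Proof.
move=> Lf; apply: (L2_le (C := cabs c) _ Lf) => [|x]; last by rewrite cabsM.
by apply: cmeasM; [exact: cmeas_cst|exact: L2_meas].
Qed.

Lemma L2_bddM f g C : cmeas g -> (forall x, cabs (g x) <= C) -> L2 f ->
  L2 (fun x => g x * f x).
Proof.
move=> mg gC Lf; apply: (L2_le (C := C) _ Lf) => [|x].
  by apply: cmeasM => //; exact: L2_meas.
by rewrite cabsM ler_wpM2r ?cabs_ge0.
Qed.

Lemma L2N f : L2 f -> L2 (fun x => - f x).
Proof.
move=> Lf; apply: (L2_le (C := 1) _ Lf) => [|x]; last by rewrite cabsN mul1r.
by apply: cmeasN; exact: L2_meas.
Qed.

Lemma L2J f : L2 f -> L2 (fun x => (f x)^*).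
Proof.
move=> Lf; apply: (L2_le (C := 1) _ Lf) => [|x]; last by rewrite cabsJ mul1r.
by apply: cmeasJ; exact: L2_meas.
Qed.

Lemma L2D f g : L2 f -> L2 g -> L2 (fun x => f x + g x).
Proof.
move=> /L2P[mf fi] /L2P[mg gi]; apply/L2P; split; first exact: cmeasD.
apply: (rint_le _ (rintZ 2 (rintD fi gi))) => [|x].
  by apply: measurable_funX; apply: cmeas_cabs; exact: cmeasD.
rewrite ger0_norm ?sqr_ge0//.
have := cabsD (f x) (g x); have := cabs_ge0 (f x + g x).
move: (cabs (f x + g x)) (cabs (f x)) (cabs (g x)) => a b c a0 abc.
rewrite (@le_trans _ _ ((b + c) ^+ 2))//.
  by rewrite lerXn2r// nnegrE (le_trans a0).
rewrite -subr_ge0 (_ : _ - _ = (b - c) ^+ 2) ?sqr_ge0//; ring.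
Qed.

Lemma L2B f g : L2 f -> L2 g -> L2 (fun x => f x - g x).
Proof. by move=> Lf Lg; apply: L2D => //; exact: L2N. Qed.

Lemma L2_ae f g : L2 f -> cmeas g -> aeR (fun x => f x = g x) -> L2 g.
Proof.
move=> /L2P[mf fi] mg fg; apply/L2P; split => //.
apply: rint_ae fi _ _; first by apply: measurable_funX; exact: cmeas_cabs.
by apply: (aeR_S fg) => x ->.
Qed.

Lemma L2_mul f g : L2 f -> L2 g -> cint (fun x => f x * g x).
Proof.
move=> /L2P[mf fi] /L2P[mg gi]; apply: (cint_le _ (rintD fi gi)) => [|x].
  exact: cmeasM.
rewrite cabsM; move: (cabs (f x)) (cabs (g x)) => a b.
rewrite -subr_ge0 (_ : _ - _ = (a ^+ 2 + b ^+ 2 + (a - b) ^+ 2) / 2); last by field.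
by rewrite divr_ge0// !addr_ge0// sqr_ge0.
Qed.

Lemma L2_ip f g : L2 f -> L2 g -> cint (fun x => (f x)^* * g x).
Proof. by move=> Lf Lg; apply: L2_mul => //; exact: L2J. Qed.

Lemma innerE f g : inner f g = J (fun x => (f x)^* * g x). Proof. by []. Qed.

Lemma innerDr f g h : L2 f -> L2 g -> L2 h ->
  inner f (fun x => g x + h x) = inner f g + inner f h.
Proof.
move=> Lf Lg Lh; rewrite !innerE -JD; [|exact: L2_ip|exact: L2_ip].
by apply: eq_J => x; rewrite mulrDr.
Qed.

Lemma innerZr c f g : L2 f -> L2 g -> inner f (fun x => c * g x) = c * inner f g.
Proof.
move=> Lf Lg; rewrite !innerE -JZ; last exact: L2_ip.
by apply: eq_J => x; rewrite mulrCA.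
Qed.

Lemma innerNr f g : L2 f -> L2 g -> inner f (fun x => - g x) = - inner f g.
Proof.
move=> Lf Lg; rewrite !innerE -JN; last exact: L2_ip.
by apply: eq_J => x; rewrite mulrN.
Qed.

Lemma innerBr f g h : L2 f -> L2 g -> L2 h ->
  inner f (fun x => g x - h x) = inner f g - inner f h.
Proof. by move=> Lf Lg Lh; rewrite innerDr ?innerNr//; exact: L2N. Qed.

Lemma innerC f g : L2 f -> L2 g -> inner g f = (inner f g)^*.
Proof.
move=> Lf Lg; rewrite !innerE -JJ; last exact: L2_ip.
by apply: eq_J => x; rewrite cJM cJK mulrC.
Qed.

Lemma innerDl f g h : L2 f -> L2 g -> L2 h ->
  inner (fun x => g x + h x) f = inner g f + inner h f.
Proof.
move=> Lf Lg Lh; rewrite innerC//; last exact: L2D.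
by rewrite innerDr// cJD -!innerC.
Qed.

Lemma innerZl c f g : L2 f -> L2 g -> inner (fun x => c * g x) f = c^* * inner g f.
Proof.
move=> Lf Lg; rewrite innerC//; last exact: L2Z.
by rewrite innerZr// cJM -innerC.
Qed.

Lemma innerBl f g h : L2 f -> L2 g -> L2 h ->
  inner (fun x => g x - h x) f = inner g f - inner h f.
Proof.
move=> Lf Lg Lh; rewrite innerC//; last exact: L2B.
by rewrite innerBr// cJB -!innerC.
Qed.

Lemma innerff f : L2 f -> inner f f = (nn f ^+ 2)%:C.
Proof.
by move=> /L2P[mf fi]; rewrite nn2 -J_real//; apply: eq_J => x; rewrite mulJc.
Qed.

Lemma inner_ae f f' g g' : L2 f -> L2 f' -> L2 g -> L2 g' ->
  aeR (fun x => f x = f' x) -> aeR (fun x => g x = g' x) -> inner f g = inner f' g'.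
Proof.
move=> Lf Lf' Lg Lg' ff' gg'; apply: J_ae.
- by case: (L2_ip Lf Lg).
- by case: (L2_ip Lf' Lg').
- by apply: (aeR_S2 ff' gg') => x -> ->.
Qed.

Lemma nn_sqrD f g : L2 f -> L2 g ->
  nn (fun x => f x + g x) ^+ 2 = nn f ^+ 2 + 2 * Re (inner f g) + nn g ^+ 2.
Proof.
move=> Lf Lg; have Lfg := L2D Lf Lg.
apply: complexI; rewrite -innerff// innerDr// !innerDl// !innerff//.
rewrite (innerC Lf Lg); apply: complex_eqP; rewrite !(cReD, cImD) ?cReJ ?cImJ/=; ring.
Qed.

Lemma nnN f : nn (fun x => - f x) = nn f.
Proof. by rewrite /nn /sq; under eq_int do rewrite cabsN. Qed.

Lemma nnJ f : nn (fun x => (f x)^*) = nn f.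
Proof. by rewrite /nn /sq; under eq_int do rewrite cabsJ. Qed.

Lemma nn_distC f g : nn (fun x => f x - g x) = nn (fun x => g x - f x).
Proof. by rewrite /nn /sq; under eq_int do rewrite cabs_distC. Qed.

Lemma nnZ c f : L2 f -> nn (fun x => c * f x) = cabs c * nn f.
Proof.
move=> Lf; apply/eqP; rewrite -(@eqrXn2 _ 2)// ?nn_ge0 ?mulr_ge0 ?cabs_ge0 ?nn_ge0//.
rewrite exprMn !nn2 /sq -intZ; last exact: L2_sq.
by apply/eqP/eq_int => x; rewrite cabsM exprMn.
Qed.

Lemma nn_sqrB f g : L2 f -> L2 g ->
  nn (fun x => f x - g x) ^+ 2 = nn f ^+ 2 - 2 * Re (inner f g) + nn g ^+ 2.
Proof.
move=> Lf Lg; rewrite nn_sqrD//; last exact: L2N.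
by rewrite innerNr// cReN nnN mulrN.
Qed.

Lemma nn_eq0P f : L2 f -> nn f = 0 -> aeR (fun x => f x = 0).
Proof.
move=> Lf f0; have sf0 : sq f = 0 by rewrite -nn2 f0 expr0n.
apply: (aeR_S (int_eq0_ae (L2_sq Lf) _ sf0)) => x; first exact: sqr_ge0.
exact: cabs_exp2_eq0.
Qed.

Lemma nn_ae f g : cmeas f -> cmeas g -> aeR (fun x => f x = g x) -> nn f = nn g.
Proof.
move=> mf mg fg; congr Num.sqrt; apply: int_ae.
- by apply: measurable_funX; exact: cmeas_cabs.
- by apply: measurable_funX; exact: cmeas_cabs.
- by apply: (aeR_S fg) => x ->.
Qed.

Lemma nn_ae0 f : cmeas f -> aeR (fun x => f x = 0) -> nn f = 0.
Proof.
move=> mf f0; rewrite (nn_ae mf _ f0); last exact: cmeas_cst.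
rewrite /nn /sq; under eq_int do rewrite cabs0 expr0n /=.
by rewrite /Rintegral integral0 sqrtr0.
Qed.

Lemma nn_le f g : L2 f -> L2 g -> (forall x, cabs (f x) <= cabs (g x)) -> nn f <= nn g.
Proof.
move=> Lf Lg fg; rewrite ler_sqrt ?sq_ge0//; apply: int_le => [| |x]; try exact: L2_sq.
by rewrite lerXn2r// nnegrE ?cabs_ge0.
Qed.

Lemma cauchy_schwarz f g : L2 f -> L2 g -> cabs (inner f g) <= nn f * nn g.
Proof.
move=> Lf Lg.
have [g0|g0] := eqVneq (nn g) 0.
  rewrite (@inner_ae f f g (fun=> 0))//; [|exact: L20|exact: aeR_W|exact: nn_eq0P].
  rewrite innerE (_ : J _ = 0) ?cabs0 ?mulr_ge0 ?nn_ge0//.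
  by under eq_J do rewrite mulr0; exact: J0.
have gp : 0 < nn g by rewrite lt_neqAle eq_sym g0 nn_ge0.
(* [t * b^*] is the coefficient of the orthogonal projection of [f] onto [g]; the remainder has
   squared norm |f|^2 - t |b|^2. *)
set b := inner f g; set t : R := (nn g ^+ 2)^-1.
have : 0 <= nn (fun x => f x - t%:C * b^* * g x) ^+ 2 by exact: sqr_ge0.
rewrite nn_sqrB//; last exact: L2Z.
rewrite innerZr// nnZ// cabsM cabsJ cabsR -/b -mulrA mulJc -rmorphM /= exprMn.
rewrite exprMn real_normK ?num_real// => h.
have tg : t * nn g ^+ 2 = 1 by rewrite mulVf// expf_neq0.
rewrite -(@ler_pXn2r _ 2)// ?nnegrE ?cabs_ge0 ?mulr_ge0 ?nn_ge0// exprMn.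
have : 0 <= nn f ^+ 2 - t * cabs b ^+ 2.
  move: h; congr (0 <= _).
  rewrite (_ : t ^+ 2 * cabs b ^+ 2 * nn g ^+ 2 = t * cabs b ^+ 2 * (t * nn g ^+ 2)); last by ring.
  by rewrite tg; ring.
rewrite subr_ge0 => {}h; rewrite -[leLHS]mul1r -tg mulrAC ler_pM2r ?exprn_gt0//.
Qed.

Lemma nnD f g : L2 f -> L2 g -> nn (fun x => f x + g x) <= nn f + nn g.
Proof.
move=> Lf Lg; rewrite -(@ler_pXn2r _ 2)// ?nnegrE ?addr_ge0 ?nn_ge0//.
rewrite nn_sqrD// sqrrD lerD2r lerD2l -[leRHS]mulr_natl ler_pM2l//.
rewrite (le_trans (ler_norm _))// (le_trans (Re_le_cabs _))//; exact: cauchy_schwarz.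
Qed.

Lemma nnB f g : L2 f -> L2 g -> nn (fun x => f x - g x) <= nn f + nn g.
Proof. by move=> Lf Lg; rewrite -(nnN g) nnD//; exact: L2N. Qed.

Lemma nn_triangle f g h : L2 f -> L2 g -> L2 h ->
  nn (fun x => f x - h x) <= nn (fun x => f x - g x) + nn (fun x => g x - h x).
Proof.
move=> Lf Lg Lh; rewrite (_ : (fun x => f x - h x) =
  (fun x => (f x - g x) + (g x - h x))).
  by apply: nnD; exact: L2B.
by apply/funext => x; rewrite addrA subrK.
Qed.

Lemma nn_lerB f g : L2 f -> L2 g -> `|nn f - nn g| <= nn (fun x => f x - g x).
Proof.
move=> Lf Lg; rewrite ler_norml lerBlDr lerBrDr; apply/andP; split.
  have := nnD (L2B Lg Lf) Lf; rewrite (_ : (fun x => g x - f x + f x) = g).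
    by rewrite nn_distC => ?; lra.
  by apply/funext => x; rewrite subrK.
rewrite -{1}(_ : (fun x => f x - g x + g x) = f).
  by apply: nnD => //; exact: L2B.
by apply/funext => x; rewrite subrK.
Qed.

Lemma nn_bddM f g C : cmeas g -> (forall x, cabs (g x) <= C) -> L2 f ->
  nn (fun x => g x * f x) <= C * nn f.
Proof.
move=> mg gC Lf; have C0 : 0 <= C by apply: (le_trans _ (gC 0)); exact: cabs_ge0.
rewrite -[C in leRHS]ger0_norm// -cabsR -nnZ//; apply: nn_le.
- exact: L2_bddM gC Lf.
- exact: L2Z.
- by move=> x; rewrite !cabsM cabsR ger0_norm// ler_wpM2r// cabs_ge0.
Qed.

Lemma int_mul_le f g : L2 f -> L2 g ->
  \int[mu]_x (cabs (f x) * cabs (g x)) <= nn f * nn g.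
Proof.
move=> Lf Lg.
have L2abs h : L2 h -> L2 (fun x => (cabs (h x))%:C).
  move=> Lh; apply: (L2_le (C := 1) _ Lh) => [|x].
    by apply: cmeasR; apply: cmeas_cabs; exact: L2_meas.
  by rewrite cabsR ger0_norm ?cabs_ge0// mul1r.
have nnabs h : nn (fun x => (cabs (h x))%:C) = nn h.
  by rewrite /nn /sq; under eq_int do rewrite cabsR ger0_norm ?cabs_ge0//.
rewrite -(nnabs f) -(nnabs g); apply: le_trans (cauchy_schwarz (L2abs _ Lf) (L2abs _ Lg)).
rewrite innerE (_ : J _ = (\int[mu]_x (cabs (f x) * cabs (g x)))%:C).
  by rewrite cabsR ler_norm.
rewrite -J_real; first by apply: eq_J => x; rewrite cJR rmorphM.
have [_] := L2_mul Lf Lg.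
by congr rint; apply/funext => x; rewrite cabsM.
Qed.

End L2_theory.

(** * Completeness of L^2, the contraction principle and a Lax-Milgram lemma *)

Section completeness.
Context {R : realType}.
Local Notation mu := (@lebesgue_measure R).
Implicit Types (f g h : R -> R[i]) (c : R[i]).

Lemma cabs_cvg (w : nat -> R[i]) v : cabs (w n - v) @[n --> \oo] --> 0 ->
  cabs (w n) @[n --> \oo] --> cabs v.
Proof.
move=> wv; apply/subr_cvg0; apply/norm_cvg0P.
apply: cvg0_squeeze wv => n; rewrite normr_ge0 /= ler_norml.
have h1 := cabsD (w n - v) v; rewrite subrK in h1.
have h2 := cabsD (v - w n) (w n); rewrite subrK cabs_distC in h2.
by apply/andP; split; lra.
Qed.

(** Fatou's lemma for the squared moduli. Square integrability of the limit is part of the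
    conclusion, so that a limit known only almost everywhere enters L^2 together with its norm
    bound. *)
Lemma L2_fatou (w : nat -> R -> R[i]) v C : (forall n, L2 (w n)) -> cmeas v ->
  aeR (fun x => cabs (w n x - v x) @[n --> \oo] --> 0) ->
  (forall n, nn (w n) <= C) -> L2 v /\ nn v <= C.
Proof.
move=> Lw mv wv wC; have C0 : 0 <= C by rewrite (le_trans _ (wC 0%N))// nn_ge0.
have mw2 n : measurable_fun setT (fun x => cabs (w n x) ^+ 2).
  by apply: measurable_funX; apply: cmeas_cabs; exact: L2_meas.
have mv2 : measurable_fun setT (fun x => cabs (v x) ^+ 2).
  by apply: measurable_funX; exact: cmeas_cabs.
have key : (\int[mu]_x (cabs (v x) ^+ 2)%:E <= (C ^+ 2)%:E)%E.
  have F0 n (x : measurableTypeR R) : (@setT (measurableTypeR R)) x ->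
    (0%R <= (cabs (w n x) ^+ 2)%:E)%E by move=> _; rewrite lee_fin sqr_ge0.
  have := @fatou _ _ _ mu setT measurableT (fun n x => (cabs (w n x) ^+ 2)%:E)
    (fun n => mEFin (mw2 n)) F0.
  rewrite (_ : (\int[mu]_x _)%E = (\int[mu]_x (cabs (v x) ^+ 2)%:E)%E); last first.
    apply: ae_eq_integral => //.
    - apply: (measurableT_comp (@oppe_measurable R setT)).
      apply: (@measurable_fun_limn_esup _ (measurableTypeR R) _ setT
        (fun n x => (- (cabs (w n x) ^+ 2)%:E)%E)) => n.
      by apply: (measurableT_comp (@oppe_measurable R setT)); exact: mEFin.
    - exact: mEFin.
    - apply: (aeR_S wv) => x wvx _.
      have cv : (cabs (w n x) ^+ 2)%:E @[n --> \oo] --> (cabs (v x) ^+ 2)%:E.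
        apply/fine_cvgP; split; first exact: nearW.
        apply: (@continuous_cvg _ _ _ _ _ (fun n => cabs (w n x)) (fun y : R => y ^+ 2)).
          exact: exprn_continuous.
        exact: cabs_cvg.
      by rewrite (cvg_limn_einf_sup cv).1.
  move=> /le_trans; apply.
  rewrite limn_einf_lim; apply: lime_le; first exact: is_cvg_einfs.
  apply: nearW => n; apply: (@le_trans _ _ (\int[mu]_x (cabs (w n x) ^+ 2)%:E)%E).
    by apply: ereal_inf_lbound; exists n => /=.
  rewrite EFin_int; last exact: L2_sq.
  by rewrite lee_fin -[X in X <= _]nn2 lerXn2r// nnegrE nn_ge0.
have Lv : L2 v.
  apply/L2P; split => //; apply: rint_ge0P => //; first by move=> x; exact: sqr_ge0.
  by rewrite (le_lt_trans key)// ltry.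
split => //; rewrite -(@ler_pXn2r _ 2)// ?nnegrE ?nn_ge0// nn2 -lee_fin.
by rewrite -EFin_int//; exact: L2_sq.
Qed.

Lemma cvg_series_geo (a : nat -> R) K :
  (forall k, `|a k| <= K * (2^-1) ^+ k) -> cvgn (series a).
Proof.
move=> aK; apply: normed_cvg.
have K0 : 0 <= K by have := aK 0%N; rewrite expr0 mulr1; apply: le_trans.
apply: (@series_le_cvg _ _ (geometric K (2^-1))) => //.
- by move=> n /=.
- by move=> n; rewrite /geometric /= mulr_ge0// exprn_ge0// invr_ge0.
- by apply: is_cvg_geometric_series; rewrite ger0_norm ?invr_ge0// invf_lt1 ?ltr1n.
Qed.

Lemma cvg_summable_diff (v : nat -> R) K :
  (forall k, `|v k.+1 - v k| <= K * (2^-1) ^+ k) -> cvgn v.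
Proof.
move=> vK; have /cvg_ex[l cl] := cvg_series_geo vK.
apply/cvg_ex; exists (v 0%N + l).
apply: cvg_trans (cvgD (cvg_cst (v 0%N)) cl); apply: near_eq_cvg.
apply: nearW => n; rewrite [LHS](_ : _ = v 0%N + series (fun k => v k.+1 - v k) n)//.
by rewrite /series /= telescope_sumr// addrC subrK.
Qed.

(** With increments of norm 4^-k, the functions 4^k |v (k+1) - v k|^2 still have summable integrals.
    Wherever their series has a finite sum K, the pointwise increments are at most sqrt(K) 2^-k. *)
Lemma fast_cvg_ae (v : nat -> R -> R[i]) : (forall n, L2 (v n)) ->
  (forall k, nn (fun x => v k.+1 x - v k x) <= (4^-1) ^+ k) ->
  exists2 l, cmeas l & aeR (fun x => cabs (v n x - l x) @[n --> \oo] --> 0).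
Proof.
move=> Lv vk.
pose d k x := 4 ^+ k * cabs (v k.+1 x - v k x) ^+ 2.
have d0 k x : 0 <= d k x by rewrite /d mulr_ge0 ?sqr_ge0// exprn_ge0.
have dR k : rint (d k) by apply: rintZ; apply: L2_sq; exact: L2B.
have dk k : \int[mu]_x d k x <= (4^-1) ^+ k.
  rewrite intZ; last by apply: L2_sq; exact: L2B.
  rewrite -/(sq (fun x => v k.+1 x - v k x)) -nn2.
  rewrite (@le_trans _ _ (4 ^+ k * ((4^-1) ^+ k) ^+ 2))//.
    by rewrite ler_wpM2l ?exprn_ge0// lerXn2r// nnegrE ?nn_ge0 ?exprn_ge0// invr_ge0.
  by rewrite expr2 mulrA -exprMn divff ?expr1n ?mul1r.
have sumfin : aeR (fun x => (\sum_(0 <= k <oo) (d k x)%:E < +oo)%E).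
  have md n : measurable_fun (setT : set (measurableTypeR R)) (fun x => (d n x)%:E).
    by apply: mEFin; exact: rint_meas.
  have I1 : (\int[mu]_x (\sum_(0 <= k <oo) (d k x)%:E) < +oo)%E.
    rewrite integral_nneseries//; last by move=> n x _; rewrite lee_fin.
    apply: (@le_lt_trans _ _ (\sum_(0 <= k <oo) ((4^-1) ^+ k : R)%:E)%E).
      apply: lee_nneseries => [n _ _|n _].
        by apply: integral_ge0 => x _; rewrite lee_fin.
      by rewrite EFin_int// lee_fin.
    rewrite (_ : (\sum_(0 <= k <oo) _)%E = (limn (series (geometric 1 (4^-1 : R))))%:E) ?ltry//.
    rewrite -EFin_lim; last first.
      by apply: is_cvg_geometric_series; rewrite ger0_norm ?invr_ge0// invf_lt1 ?ltr1n.
    congr (limn _); apply/funext => n; rewrite /= /series /= -sumEFin.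
    by apply: eq_bigr => i _; rewrite mul1r.
  have : mu.-integrable setT (fun x => (\sum_(0 <= k <oo) (d k x)%:E)%E).
    apply/integrableP; split.
      by apply: ge0_emeasurable_sum => // n x _ _; rewrite lee_fin.
    have s0 x : (0 <= \sum_(0 <= k <oo) (d k x)%:E)%E.
      by apply: nneseries_ge0 => n _ _; rewrite lee_fin.
    rewrite (_ : (\int[mu]_x _)%E = (\int[mu]_x (\sum_(0 <= k <oo) (d k x)%:E))%E)//.
    by apply: eq_integral => x _; rewrite gee0_abs.
  move=> /(integrable_ae measurableT) h; apply: (aeR_S h) => x /(_ I).
  by move/fin_numPlt/andP => [].
have cvx x : (\sum_(0 <= k <oo) (d k x)%:E < +oo)%E ->
    cvgn (fun n => Re (v n x)) /\ cvgn (fun n => Im (v n x)).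
  move=> sx; set K := fine (\sum_(0 <= k <oo) (d k x)%:E)%E.
  have s0 : (0 <= \sum_(0 <= k <oo) (d k x)%:E)%E.
    by apply: nneseries_ge0 => n _ _; rewrite lee_fin.
  have dK k : cabs (v k.+1 x - v k x) <= Num.sqrt K * (2^-1) ^+ k.
    rewrite -(@ler_pXn2r _ 2)// ?nnegrE ?cabs_ge0 ?mulr_ge0 ?sqrtr_ge0 ?exprn_ge0// ?invr_ge0//.
    have : d k x <= K.
      rewrite -lee_fin /K fineK; last by rewrite ge0_fin_numE.
      have := @nneseries_lim_ge _ (fun k => (d k x)%:E) xpredT 0%N k.+1.
      rewrite big_nat_recr//= => h; apply: (le_trans _ (h _)).
        by rewrite leeDr// sume_ge0// => i _; rewrite lee_fin.
      by move=> i _ _; rewrite lee_fin.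
    rewrite exprMn sqr_sqrtr; last by rewrite fine_ge0.
    have -> : ((2^-1 : R) ^+ k) ^+ 2 = (4 ^+ k)^-1.
      by rewrite exprAC -exprVn; congr (_ ^+ k); field.
    by rewrite /d ler_pdivlMr ?exprn_gt0// mulrC.
  split; apply: (@cvg_summable_diff _ (Num.sqrt K)) => k; apply: le_trans (dK k).
    by rewrite -cReB Re_le_cabs.
  by rewrite -cImB Im_le_cabs.
have [N [mN N0 NP]] := sumfin.
(* Replacing the sequence by 0 on the null set [N] makes it converge everywhere, so that its limit
   is measurable. *)
pose v' n x := v n x * (\1_(~` N) x)%:C.
have mv' n : cmeas (v' n).
  by apply: cmeas_indic; [exact: measurableC|exact: L2_meas].
have cv' x : cvgn (fun n => Re (v' n x)) /\ cvgn (fun n => Im (v' n x)).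
  have [xN|xN] := pselect (N x).
    have v'x n : v' n x = 0 by rewrite /v' indicE memNset ?mulr0//; exact.
    by split; under eq_fun do rewrite v'x; exact: is_cvg_cst.
  have v'x n : v' n x = v n x by rewrite /v' indicE mem_set//= mulr1.
  have [cr ci] : cvgn (fun n => Re (v n x)) /\ cvgn (fun n => Im (v n x)).
    by apply: cvx; apply: contrapT => /NP.
  by split; under eq_fun do rewrite v'x.
exists (fun x => limn (fun n => Re (v' n x)) +i* limn (fun n => Im (v' n x)))%C.
  split => /=.
    apply: (@measurable_fun_cvg _ _ _ setT (fun n x => Re (v' n x))).
      by move=> n; case: (mv' n).
    by move=> x _; exact: (cv' x).1.
  apply: (@measurable_fun_cvg _ _ _ setT (fun n x => Im (v' n x))).
    by move=> n; case: (mv' n).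
  by move=> x _; exact: (cv' x).2.
exists N; split => // x /= h; apply: contrapT => xN; apply: h.
have v'x n : v' n x = v n x by rewrite /v' indicE mem_set//= mulr1.
rewrite (_ : (fun n => _) = (fun n => cabs (v' n x - (limn (fun n => Re (v' n x)) +i* limn (fun n => Im (v' n x)))%C))); last first.
  by apply/funext => n; rewrite v'x.
apply: (@cvg0_squeeze _ _ (fun n => `|Re (v' n x) - limn (fun n => Re (v' n x))| +
   `|Im (v' n x) - limn (fun n => Im (v' n x))|)).
  by move=> n; rewrite cabs_ge0 (le_trans (cabs_le _))// cReB cImB.
rewrite -[0]addr0; apply: cvgD; apply/norm_cvg0P/subr_cvg0.
  exact: (cv' x).1.
exact: (cv' x).2.
Qed.

Lemma L2_complete (u : nat -> R -> R[i]) : (forall n, L2 (u n)) ->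
  (forall e : R, 0 < e -> exists N, forall m n, (N <= m)%N -> (N <= n)%N ->
    nn (fun x => u m x - u n x) <= e) ->
  exists l, L2 l /\ nn (fun x => u n x - l x) @[n --> \oo] --> 0.
Proof.
move=> Lu cu.
have /choice[N HN] : forall k, exists N, forall m n, (N <= m)%N -> (N <= n)%N ->
    nn (fun x => u m x - u n x) <= (4^-1 : R) ^+ k.
  by move=> k; apply: cu; rewrite exprn_gt0// invr_gt0.
(* The sum of the thresholds lies beyond every [N j] with j <= k, so consecutive terms of the
   subsequence are within 4^-k of each other. *)
pose phi k := (\sum_(j < k.+1) N j)%N.
have Nphi j k : (j <= k)%N -> (N j <= phi k)%N.
  move=> jk; rewrite /phi (bigD1 (Ordinal (jk : (j < k.+1)%N)))//=.
  exact: leq_addr.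
have [l ml cl] := @fast_cvg_ae (fun k => u (phi k)) (fun k => Lu _)
  (fun k => HN k _ _ (Nphi _ _ (leqnSn k)) (Nphi _ _ (leqnn k))).
(* Fatou along the subsequence, with [n] fixed, turns the Cauchy estimate into a bound on the
   distance to the limit. *)
have key j n : (N j <= n)%N -> L2 (fun x => u n x - l x) /\
    nn (fun x => u n x - l x) <= (4^-1) ^+ j.
  move=> jn; apply: (@L2_fatou (fun k x => u n x - u (phi (k + j)%N) x)).
  - by move=> k; exact: L2B.
  - by apply: cmeasB => //; exact: L2_meas.
  - apply: (aeR_S cl) => x; rewrite -(cvg_shiftn j) => clx.
    apply: cvg0_squeeze clx => k; rewrite cabs_ge0 /=.
    rewrite (_ : _ - (u n x - l x) = - (u (phi (k + j)%N) x - l x)); last by ring.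
    by rewrite cabsN.
  - by move=> k; apply: HN => //; apply: Nphi; exact: leq_addl.
have Ll : L2 l.
  have [L1 _] := key 0%N (N 0%N) (leqnn _).
  apply: (L2_ae (L2B (Lu (N 0%N)) L1)) => //.
  by apply: aeR_W => x; rewrite opprB addrC subrK.
exists l; split => //; apply/cvgrPdist_lt => e e0.
have [j je] : exists j, (4^-1 : R) ^+ j < e.
  have : (4^-1 : R) ^+ n @[n --> \oo] --> 0.
    by apply: cvg_expr; rewrite ger0_norm ?invr_ge0// invf_lt1 ?ltr1n.
  move/cvgrPdist_lt => /(_ e e0)[j _ /(_ j (leqnn j))] /=.
  by rewrite sub0r normrN ger0_norm ?exprn_ge0 ?invr_ge0// => h; exists j.
exists (N j) => // n /= jn; rewrite sub0r normrN ger0_norm ?nn_ge0//.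
by rewrite (le_lt_trans _ je)//; exact: (key j n jn).2.
Qed.

(** Banach's iteration started at 0. The fixed point is expressed by a vanishing norm because
    elements of L^2 are represented by functions: [G f] and [f] agree only almost everywhere. *)
Lemma L2_contraction (G : (R -> R[i]) -> (R -> R[i])) (q : R) : 0 <= q -> q < 1 ->
  (forall f, L2 f -> L2 (G f)) ->
  (forall f g, L2 f -> L2 g ->
    nn (fun x => G f x - G g x) <= q * nn (fun x => f x - g x)) ->
  exists2 f, L2 f & nn (fun x => G f x - f x) = 0.
Proof.
move=> q0 q1 LG Gq.
pose u n := iter n G (fun=> 0).
have Lu n : L2 (u n) by elim: n => [|n IH]; [exact: L20|exact: LG].
set a := nn (fun x => u 1%N x - u 0%N x).
have step n : nn (fun x => u n.+1 x - u n x) <= a * q ^+ n.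
  elim: n => [|n IH]; first by rewrite expr0 mulr1.
  by rewrite (le_trans (Gq _ _ (Lu n.+1) (Lu n)))// exprS mulrCA ler_wpM2l.
have q10 : 0 < 1 - q by rewrite subr_gt0.
(* The factor [1 - q ^+ k] keeps the exact geometric sum, which makes the induction step an
   equality. *)
have far n k : nn (fun x => u (n + k)%N x - u n x) <= a * q ^+ n / (1 - q) * (1 - q ^+ k).
  elim: k => [|k IH].
    rewrite addn0 expr0 subrr mulr0 nn_ae0//.
      by apply: cmeasB; exact: L2_meas.
    by apply: aeR_W => x; rewrite subrr.
  rewrite addnS (le_trans (nn_triangle _ (Lu (n + k)%N) _))//; try exact: Lu.
  rewrite (le_trans (lerD (step _) IH))// le_eqVlt; apply/orP; left; apply/eqP.
  by rewrite exprD exprS; field; rewrite gt_eqF.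
have cauchy n k : nn (fun x => u (n + k)%N x - u n x) <= a / (1 - q) * q ^+ n.
  apply: le_trans (far n k) _.
  rewrite (_ : a / (1 - q) * q ^+ n = a * q ^+ n / (1 - q)); last by ring.
  rewrite ler_piMr ?gerBl ?exprn_ge0//.
  by rewrite divr_ge0 ?mulr_ge0 ?nn_ge0 ?exprn_ge0// ltW.
have [l [Ll cl]] : exists l, L2 l /\ nn (fun x => u n x - l x) @[n --> \oo] --> 0.
  apply: L2_complete => // e e0.
  have : a / (1 - q) * q ^+ n @[n --> \oo] --> 0.
    rewrite -[X in _ --> X](mulr0 (a / (1 - q))); apply: cvgM; first exact: cvg_cst.
    by apply: cvg_expr; rewrite ger0_norm.
  move/cvgrPdist_le => /(_ e e0)[N _ NP]; exists N => m n Nm Nn.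
  wlog nm : m n Nm Nn / (n <= m)%N.
    by move=> h; case: (leqP n m) => [|/ltnW] /h; [|rewrite nn_distC]; apply.
  rewrite -(subnKC nm) (le_trans (cauchy _ _))//.
  by have := NP n Nn; rewrite sub0r normrN => /(le_trans (ler_norm _)).
exists l => //; apply/eqP; rewrite eq_le nn_ge0 andbT.
have : q * nn (fun x => u n x - l x) + nn (fun x => u n.+1 x - l x) @[n --> \oo] --> q * 0 + 0.
  apply: cvgD; first by apply: cvgM => //; exact: cvg_cst.
  by rewrite (cvg_shiftS (fun n => nn (fun x => u n x - l x))).
rewrite mulr0 addr0 => /cvgr_to_ge; apply; apply: nearW => n.
apply: le_trans (nn_triangle (LG _ Ll) (Lu n.+1) Ll) _.
by rewrite lerD2r (le_trans (Gq _ _ Ll (Lu n)))// nn_distC.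
Qed.

(** A solution is a fixed point of x - tau k (N x - y), a contraction for small tau. The complex
    factor [k] is there because the operators to be inverted need not be coercive themselves; only a
    suitable multiple of their form is. *)
Lemma lax_milgram (N : (R -> R[i]) -> (R -> R[i])) (C c : R) (k : R[i]) :
  0 < c -> k != 0 -> (forall f, L2 f -> L2 (N f)) ->
  (forall f g, L2 f -> L2 g ->
    aeR (fun x => N (fun x => f x - g x) x = N f x - N g x)) ->
  (forall f, L2 f -> nn (N f) <= C * nn f) ->
  (forall f, L2 f -> c * nn f ^+ 2 <= Re (k * inner f (N f))) ->
  forall y, L2 y -> exists2 x, L2 x & aeR (fun t => N x t = y t).
Proof.
move=> c0 k0 LN Nlin NC Nc y Ly.
(* [M] dominates both |k| |C| and [c]; the latter keeps 1 - (c / M)^2 nonnegative. *)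
set M := cabs k * `|C| + c.
have M0 : 0 < M by rewrite ltr_wpDl// mulr_ge0// cabs_ge0.
have cM : c <= M by rewrite lerDr mulr_ge0// cabs_ge0.
(* This value minimises 1 - 2 tau c + tau^2 M^2, the bound on the squared Lipschitz constant, and
   turns it into 1 - (c / M)^2. *)
set tau := c / M ^+ 2.
pose G f := (fun x => f x - (tau%:C * k) * (N f x - y x)).
set q := Num.sqrt (1 - (c / M) ^+ 2).
have cM1 : (c / M) ^+ 2 <= 1.
  by apply: exprn_ile1; [rewrite divr_ge0 ?ltW|rewrite ler_pdivrMr ?mul1r].
have [f Lf Gf] : exists2 f, L2 f & nn (fun x => G f x - f x) = 0.
  apply: (@L2_contraction G q); first exact: sqrtr_ge0.
  - rewrite -sqrtr1 ltr_sqrt ?ltr01// ltrBlDr ltrDl exprn_gt0//.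
    by rewrite divr_gt0.
  - by move=> f Lf; apply: L2B => //; apply: L2Z; apply: L2B => //; exact: LN.
  move=> f g Lf Lg; set d := fun x => f x - g x.
  have Ld : L2 d by exact: L2B.
  have -> : nn (fun x => G f x - G g x) = nn (fun x => d x - (tau%:C * k) * N d x).
    apply: nn_ae.
    - by apply: cmeasB; apply: cmeasB; try exact: L2_meas; apply: L2_meas;
        apply: L2Z; apply: L2B => //; exact: LN.
    - by apply: L2_meas; apply: L2B => //; apply: L2Z; exact: LN.
    apply: (aeR_S (Nlin _ _ Lf Lg)) => x; rewrite -/d => ->; rewrite /G /d; ring.
  rewrite -(@ler_pXn2r _ 2)// ?nnegrE ?mulr_ge0 ?nn_ge0 ?sqrtr_ge0//.
  rewrite nn_sqrB//; last by apply: L2Z; exact: LN.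
  rewrite innerZr//; last exact: LN.
  rewrite -mulrA cReM /= mul0r subr0 nnZ; last exact: LN.
  rewrite exprMn cabsM cabsR ger0_norm; last by rewrite divr_ge0 ?exprn_ge0 ?ltW.
  rewrite [leRHS]exprMn [q ^+ 2]sqr_sqrtr ?subr_ge0//.
  have h1 := Nc _ Ld.
  have h2 : nn (N d) ^+ 2 <= `|C| ^+ 2 * nn d ^+ 2.
    rewrite -exprMn lerXn2r// ?nnegrE ?nn_ge0 ?mulr_ge0 ?nn_ge0//.
    by rewrite (le_trans (NC _ Ld))// ler_wpM2r ?nn_ge0// ler_norm.
  have t0 : 0 < tau by rewrite divr_gt0 ?exprn_gt0.
  have h3 : 2 * (tau * (c * nn d ^+ 2)) <= 2 * (tau * Re (k * inner d (N d))).
    by rewrite ler_pM2l// ler_pM2l.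
  have h4 : (tau ^+ 2 * cabs k ^+ 2) * nn (N d) ^+ 2 <= (tau ^+ 2 * M ^+ 2) * nn d ^+ 2.
    have kM : (cabs k * `|C|) ^+ 2 <= M ^+ 2.
      by rewrite lerXn2r// ?nnegrE ?(mulr_ge0 (cabs_ge0 _))// ?(ltW M0)// lerDl ltW.
    have tk0 : 0 <= tau ^+ 2 * cabs k ^+ 2 by rewrite mulr_ge0// sqr_ge0.
    apply: le_trans (ler_wpM2l tk0 h2) _.
    rewrite mulrA ler_wpM2r ?sqr_ge0// -mulrA -exprMn.
    by apply: ler_wpM2l; first exact: sqr_ge0.
  have e1 : tau ^+ 2 * M ^+ 2 = (c / M) ^+ 2.
    by rewrite /tau; field; rewrite gt_eqF.
  have e2 : tau * c = (c / M) ^+ 2 by rewrite /tau; field; rewrite gt_eqF.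
  rewrite e1 in h4; rewrite (mulrA tau c) e2 in h3.
  have h5 : (tau * cabs k) ^+ 2 * nn (N d) ^+ 2 = (tau ^+ 2 * cabs k ^+ 2) * nn (N d) ^+ 2.
    by rewrite exprMn.
  by rewrite h5; move: h3 h4; lra.
exists f => //.
have LGf : L2 (fun x => G f x - f x).
  by apply: L2B => //; apply: L2B => //; apply: L2Z; apply: L2B => //; exact: LN.
apply: (aeR_S (nn_eq0P LGf Gf)) => x; rewrite /G addrAC subrr add0r => /eqP.
rewrite oppr_eq0 !mulf_eq0 (negbTE k0) orbF.
have -> : (tau%:C == 0) = false.
  by apply/negbTE; rewrite eq_complex /= negb_and gt_eqF// divr_gt0 ?exprn_gt0.
by rewrite /= subr_eq0 => /eqP.
Qed.

End completeness.

(** * Fubini, affine changes of variables and some explicit integrals *)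

Section fubini.
Context {R : realType}.
Local Notation mu := (@lebesgue_measure R).
Local Notation mR := (measurableTypeR R).

(** The integral of a nonnegative function is a supremum over the simple functions below it, so
    pointwise order is enough; iterated integrals can then be bounded without discussing the
    measurability of the inner one. *)
Lemma ge0_le_integral_pt (f g : R -> \bar R) : (forall x, 0 <= f x)%E ->
  (forall x, f x <= g x)%E -> (\int[mu]_x f x <= \int[mu]_x g x)%E.
Proof.
move=> f0 fg; rewrite !ge0_integralTE//; last by move=> x; exact: le_trans (fg x).
apply: le_ereal_sup => _ [h hf <-]; exists h => // x.
exact: le_trans (hf x) (fg x).
Qed.

Lemma emeas_int_param (g : mR * mR -> \bar R) : measurable_fun setT g ->
  (forall z, 0 <= g z)%E ->
  measurable_fun (setT : set R) (fun x : R => \int[mu]_y g (x, y))%E.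
Proof.
by move=> mg g0; exact: (@measurable_fun_fubini_tonelli_F _ _ mR mR R mu g mg g0).
Qed.

(** Tonelli's measurability applies to the positive and negative parts. As [fine] is total, the
    conclusion holds for every measurable integrand, whether or not its sections are integrable. *)
Lemma rmeas_int_param (f : mR * mR -> R) : measurable_fun setT f ->
  measurable_fun setT (fun x : R => \int[mu]_y f (x, y)).
Proof.
move=> mf; rewrite /Rintegral.
have mEf : measurable_fun setT (fun z => (f z)%:E).
  exact: (measurableT_comp (@EFin_measurable R setT)).
apply: (@measurableT_comp _ _ _ _ _ _ (@fine R)) => //.
under eq_fun do rewrite integralE.
have mp : measurable_fun setT ((fun z => (f z)%:E)^\+)%E by exact: measurable_funepos.
have mn : measurable_fun setT ((fun z => (f z)%:E)^\-)%E by exact: measurable_funeneg.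
apply: emeasurable_funB.
  have h := emeas_int_param mp (fun z => funepos_ge0 _ z).
  rewrite [X in measurable_fun _ X](_ : _ = (fun x : R => \int[mu]_y ((fun z : mR * mR => (f z)%:E)^\+ (x, y)))%E)//.
  by apply/funext => x; apply: eq_integral => y _; rewrite !funeposE.
have h := emeas_int_param mn (fun z => funeneg_ge0 _ z).
rewrite [X in measurable_fun _ X](_ : _ = (fun x : R => \int[mu]_y ((fun z : mR * mR => (f z)%:E)^\- (x, y)))%E)//.
by apply/funext => x; apply: eq_integral => y _; rewrite !funenegE.
Qed.

Lemma int_iter (f : mR * mR -> R) : measurable_fun setT f ->
  (\int[mu]_x \int[mu]_y `|f (x, y)|%:E < +oo)%E ->
  rint (fun x => \int[mu]_y f (x, y)) /\
  \int[mu]_x (\int[mu]_y f (x, y)) = fine (\int[mu]_x \int[mu]_y (f (x, y))%:E)%E.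
Proof.
move=> mf fy.
have mEf : measurable_fun setT (fun z => (f z)%:E).
  exact: (measurableT_comp (@EFin_measurable R setT)).
have fi : (mu \x mu)%E.-integrable setT (fun z => (f z)%:E).
  by apply/(integrable12ltyP mu mu mEf).
have iF := integrable_fubini_F fi.
have h1 := integrable_ae measurableT iF.
have mI := mEFin (rmeas_int_param mf).
have eF : ae_eq mu setT (fun x => (\int[mu]_y f (x, y))%:E)
    (fun x => \int[mu]_y (f (x, y))%:E)%E.
  by apply: (aeR_S h1) => x /(_ I) hx _; rewrite /Rintegral fineK.
split.
  apply/integrableP; split => //.
  have /integrableP[_] := iF; apply: le_lt_trans.
  rewrite le_eqVlt; apply/orP; left; apply/eqP; apply: ae_eq_integral => //.
  - exact: (measurableT_comp (@abse_measurable R setT)).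
  - by apply: (measurableT_comp (@abse_measurable R setT)); exact: measurable_fubini_F fi.
  - by apply: (aeR_S eF) => x /(_ I) e _; congr (`|_|)%E; exact: e.
rewrite {1}/Rintegral; congr fine; apply: ae_eq_integral => //.
exact: measurable_fubini_F fi.
Qed.

Lemma measurable_swap_comp (f : mR * mR -> R) : measurable_fun setT f ->
  measurable_fun setT (fun z : mR * mR => f (z.2, z.1)).
Proof. by move=> mf; exact: (measurableT_comp mf (@measurable_swap _ _ _ _)). Qed.

Lemma int_fubini (f : mR * mR -> R) : measurable_fun setT f ->
  (\int[mu]_x \int[mu]_y `|f (x, y)|%:E < +oo)%E ->
  \int[mu]_x (\int[mu]_y f (x, y)) = \int[mu]_y (\int[mu]_x f (x, y)).
Proof.
move=> mf fy.
have mEf : measurable_fun setT (fun z => (f z)%:E).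
  exact: (measurableT_comp (@EFin_measurable R setT)).
have fi : (mu \x mu)%E.-integrable setT (fun z => (f z)%:E).
  by apply/(integrable12ltyP mu mu mEf).
have mfs := measurable_swap_comp mf.
rewrite (int_iter mf fy).2 (int_iter mfs _).2 /=; first by rewrite (Fubini fi).
apply: le_lt_trans fy; rewrite le_eqVlt; apply/orP; left; apply/eqP/esym.
apply: (@fubini_tonelli _ _ mR mR R mu mu (fun z => `|f z|%:E)) => //.
by apply: (measurableT_comp (@EFin_measurable R setT)); exact: measurableT_comp.
Qed.

Implicit Types (a b : R -> R[i]) (k : mR * mR -> R[i]).

Lemma cmeas_section k x : cmeas k -> cmeas (fun y : R => k (x, y)).
Proof.
by move=> mk; apply: (cmeas_comp (h := fun y : mR => (x, y) : mR * mR) mk); exact: measurable_pair1.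
Qed.

Lemma cmeas_J_param k : cmeas k -> cmeas (fun x : R => J (fun y => k (x, y))).
Proof.
move=> [m1 m2]; split; first exact: (@rmeas_int_param (fun z => Re (k z))).
exact: (@rmeas_int_param (fun z => Im (k z))).
Qed.

Lemma cmeas_fst b : cmeas b -> cmeas (fun z : mR * mR => b z.1).
Proof. by move=> mb; apply: (cmeas_comp (h := fst : mR * mR -> mR) mb). Qed.

Lemma cmeas_snd b : cmeas b -> cmeas (fun z : mR * mR => b z.2).
Proof. by move=> mb; apply: (cmeas_comp (h := snd : mR * mR -> mR) mb). Qed.

Lemma cmeas_J_kernel k b : cmeas k -> cmeas b ->
  cmeas (fun x : R => J (fun y => k (x, y) * b y)).
Proof.
move=> mk mb; apply: (@cmeas_J_param (fun z => k z * b z.2)).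
by apply: cmeasM => //; exact: cmeas_snd.
Qed.

(** The form in which Fubini's theorem is used afterwards: the bound on [k] makes a(x) k(x, y) b(y)
    integrable on the plane. It is applied to Fourier kernels and to convolution kernels m(x -
    y). *)
Lemma J_fubini_bdd a b k C : cint a -> cint b -> cmeas k ->
  (forall z, cabs (k z) <= C) ->
  J (fun x => a x * J (fun y => k (x, y) * b y)) =
  J (fun y => b y * J (fun x => k (x, y) * a x)).
Proof.
move=> ai bi mk kC.
have [[ma ai'] [mb bi']] := (ai, bi).
pose F (z : mR * mR) := a z.1 * (k z * b z.2).
have mF : cmeas F.
  by apply: cmeasM; [exact: cmeas_fst|apply: cmeasM => //; exact: cmeas_snd].
have inner1 x : a x * J (fun y => k (x, y) * b y) = J (fun y => F (x, y)).
  rewrite -JZ//; apply: (@cint_bddM _ _ _ C) => //; exact: cmeas_section.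
have inner2 y : b y * J (fun x => k (x, y) * a x) = J (fun x => F (x, y)).
  rewrite -JZ//; first by apply: eq_J => x; rewrite /F /=; ring.
  apply: (@cint_bddM _ _ _ C) => //.
  by apply: (cmeas_comp (h := fun x : mR => (x, y) : mR * mR) mk); exact: measurable_pair2.
rewrite (eq_J inner1) (eq_J inner2).
have bnd (G : R[i] -> R) : (forall z, `|G z| <= cabs z) ->
    (\int[mu]_x \int[mu]_y `|G (F (x, y))|%:E < +oo)%E.
  move=> Gle; apply: (@le_lt_trans _ _ (\int[mu]_x \int[mu]_y (C * cabs (a x) * cabs (b y))%:E)%E).
    apply: ge0_le_integral_pt => x.
      by apply: integral_ge0 => y _; rewrite lee_fin.
    apply: ge0_le_integral_pt => y; first by rewrite lee_fin.
    rewrite lee_fin (le_trans (Gle _))// /F /= !cabsM mulrCA !mulrA.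
    by rewrite !ler_wpM2r ?cabs_ge0.
  under eq_integral => x _.
    rewrite EFin_int; last exact: rintZ.
    rewrite intZ// mulrAC.
    over.
  rewrite EFin_int ?ltry//.
  exact: (rintZ (C * \int[mu]_y cabs (b y)) ai').
apply: complex_eqP.
  exact: (@int_fubini (fun z => Re (F z)) (proj1 mF) (bnd _ (@Re_le_cabs R))).
exact: (@int_fubini (fun z => Im (F z)) (proj2 mF) (bnd _ (@Im_le_cabs R))).
Qed.

End fubini.

Section change_of_variables.
Context {R : realType}.
Local Notation mu := (@lebesgue_measure R).
Local Notation mR := (measurableTypeR R).

Definition affine_map (a b x : R) : mR := a * x + b.

Lemma measurable_affine_map a b : measurable_fun (setT : set mR) (affine_map a b).
Proof.
apply: measurable_funD; last exact: measurable_cst.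
by apply: measurable_funM => //; exact: measurable_cst.
Qed.

(** The scaled pushforward also assigns to each half-open interval its length, and Lebesgue measure
    is the only measure that does. *)
Lemma lebesgue_measure_affine (a b : R) (a0 : 0 < a) (A : set R) : measurable A ->
  mu A = (a%:E * pushforward mu (affine_map a b : mR -> mR) A)%E.
Proof.
move=> mA.
have -> : a = (NngNum (ltW a0))%:num by [].
apply: (@lebesgue_measure_unique R (mscale (NngNum (ltW a0)) (pushforward mu (affine_map a b : mR -> mR)))) => //.
  exact: measurable_affine_map.
move=> ? _ [[c d] _ <-]; rewrite /= /mscale /= /pushforward.
rewrite (_ : _ @^-1` _ = `](c - b) / a, (d - b) / a]%classic); last first.
  apply/seteqP; split => x /=; rewrite !in_itv /= /affine_map.
    by move=> /andP[h1 h2]; rewrite ltr_pdivrMr// ler_pdivlMr// ltrBlDr lerBrDr mulrC h1.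
  by rewrite ltr_pdivrMr// ler_pdivlMr// ltrBlDr lerBrDr mulrC.
rewrite !lebesgue_measure_itv /= !lte_fin ltr_pM2r ?invr_gt0// ltrD2r.
case: ifPn => cd; last by rewrite mule0.
by rewrite -!EFinB -EFinM; congr (_%:E); field; rewrite gt_eqF.
Qed.

Lemma ge0_integral_affine (a b : R) (f : R -> \bar R) : 0 < a ->
  measurable_fun (setT : set mR) f -> (forall x, 0 <= f x)%E ->
  (\int[mu]_x f x = a%:E * \int[mu]_x f (a * x + b)%R)%E.
Proof.
move=> a0 mf f0.
rewrite (_ : (\int[mu]_x f (a * x + b)%R)%E =
    (\int[pushforward mu (affine_map a b : mR -> mR)]_x f x)%E); last first.
  by rewrite ge0_integral_pushforward//; exact: measurable_affine_map.
pose nu : {measure set mR -> \bar R} := mscale (NngNum (ltW a0)) (pushforward mu (affine_map a b : mR -> mR)).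
transitivity (\int[nu (measurable_affine_map a b)]_x f x)%E.
  apply: eq_measure_integral => A mA _; rewrite /nu /= /mscale /=.
  exact: (lebesgue_measure_affine b a0).
by rewrite ge0_integral_mscale.
Qed.

Lemma rmeas_affine (a b : R) (f : R -> R) : measurable_fun setT f ->
  measurable_fun setT (fun x : R => f (a * x + b)).
Proof. by move=> mf; exact: (measurableT_comp mf (measurable_affine_map a b)). Qed.

Lemma rint_affine (a b : R) (f : R -> R) : 0 < a -> rint f -> rint (fun x => f (a * x + b)).
Proof.
move=> a0 /rintP[mf fy]; apply/rintP; split; first exact: rmeas_affine.
have := @ge0_integral_affine a b (fun x => `|f x|%:E) a0 (mEFin (rmeas_norm mf)) _.
move=> /(_ (fun x => normr_ge0 _)) e; move: fy; rewrite e => h.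
by rewrite ltey; apply: contraTneq h => ->; rewrite gt0_muley.
Qed.

Lemma int_affine (a b : R) (f : R -> R) : 0 < a -> rint f ->
  \int[mu]_x f (a * x + b) = a^-1 * \int[mu]_x f x.
Proof.
move=> a0 fi.
have pn (g : R -> R) : rint g -> (forall x, 0 <= g x) ->
    \int[mu]_x g (a * x + b) = a^-1 * \int[mu]_x g x.
  move=> gi g0; apply: (@mulfI _ a); first by rewrite gt_eqF.
  rewrite mulVKf ?gt_eqF//; apply/EFin_inj; rewrite EFinM.
  rewrite -EFin_int; last exact: rint_affine.
  rewrite -EFin_int//; apply/esym; apply: ge0_integral_affine => //.
  by apply: mEFin; exact: rint_meas.
have mf := rint_meas fi.
have fp : rint (fun x => (`|f x| + f x) / 2).
  under eq_fun do rewrite mulrC.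
  by apply: rintZ; apply: rintD => //; exact: rint_norm.
have fn : rint (fun x => (`|f x| - f x) / 2).
  under eq_fun do rewrite mulrC.
  by apply: rintZ; apply: rintB => //; exact: rint_norm.
have fE x : f x = (`|f x| + f x) / 2 - (`|f x| - f x) / 2 by field.
rewrite (eq_int fE) (eq_int (fun x => fE (a * x + b))).
have fp' := rint_affine b a0 fp; have fn' := rint_affine b a0 fn.
rewrite (intB fp fn) (intB fp' fn') mulrBr; congr (_ - _).
  apply: (pn _ fp) => x; rewrite divr_ge0// -lerBlDr sub0r.
  by rewrite -normrN ler_norm.
apply: (pn _ fn) => x; rewrite divr_ge0// subr_ge0 ler_norm//.
Qed.

Lemma ge0_integral_opp (f : R -> \bar R) :
  measurable_fun (setT : set mR) f -> (forall x, 0 <= f x)%E ->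
  (\int[mu]_x f (- x)%R = \int[mu]_x f x)%E.
Proof.
move=> mf f0.
rewrite (_ : (\int[mu]_x f (- x)%R)%E =
    (\int[pushforward mu (-%R : _ -> measurableTypeR R)]_x f x)%E); last first.
  by rewrite ge0_integral_pushforward//.
by apply: eq_measure_integral => A mA _; exact: lebesgue_measureN.
Qed.

End change_of_variables.

Section derivatives.
Context {R : realType}.
Implicit Types (f g : R -> R) (a b c x : R).
Local Notation D f x a := (is_derive (x : R) (1 : R) (f : R -> R) a).

Lemma dId x : D (fun y => y) x 1. Proof. exact: is_derive_id. Qed.
Lemma dC c x : D (fun=> c) x 0. Proof. exact: is_derive_cst. Qed.
Lemma dD f g x a b : D f x a -> D g x b -> D (fun y => f y + g y) x (a + b).
Proof. exact: is_deriveD. Qed.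
Lemma dN f x a : D f x a -> D (fun y => - f y) x (- a).
Proof. exact: is_deriveN. Qed.
Lemma dM f g x a b : D f x a -> D g x b -> D (fun y => f y * g y) x (f x * b + g x * a).
Proof. exact: is_deriveM. Qed.
Lemma dZ c f x a : D f x a -> D (fun y => c * f y) x (c * a).
Proof. by move=> h; have := dM (dC c x) h; rewrite mulr0 addr0. Qed.
Lemma dComp f g x a b : D f (g x) a -> D g x b -> D (fun y => f (g y)) x (b * a).
Proof. by move=> h1 h2; rewrite mulrC; exact: (@is_derive1_comp _ f g x a b). Qed.
Lemma dexpR f x a : D f x a -> D (fun y => expR (f y)) x (a * expR (f x)).
Proof. by move=> h; apply: (@dComp expR f x _ a _ h); exact: is_derive_expR. Qed.
Lemma dsin f x a : D f x a -> D (fun y => sin (f y)) x (a * cos (f x)).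
Proof. by move=> h; apply: (@dComp sin f x _ a _ h); exact: is_derive_sin. Qed.
Lemma dcos f x a : D f x a -> D (fun y => cos (f y)) x (a * - sin (f x)).
Proof. by move=> h; apply: (@dComp cos f x _ a _ h); exact: is_derive_cos. Qed.
Lemma dEq f x a b : D f x a -> a = b -> D f x b. Proof. by move=> h <-. Qed.
End derivatives.

(** * Integrals from primitives; the factor exp (- e |p|) and the Cauchy density *)

Section scalar_integrals.
Context {R : realType}.
Local Notation mu := (@lebesgue_measure R).
Implicit Types (f g G : R -> R).

Lemma rint_opp f : rint f -> rint (fun x => f (- x)).
Proof.
move=> /rintP[mf fy]; apply/rintP; split.
  exact: (measurableT_comp mf (@oppr_measurable R setT)).
by rewrite (@ge0_integral_opp _ (fun x => `|f x|%:E))//; exact: mEFin (rmeas_norm mf).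
Qed.

Lemma int_opp f : rint f -> \int[mu]_x f (- x) = \int[mu]_x f x.
Proof.
move=> fi.
have pn (g : R -> R) : rint g -> (forall x, 0 <= g x) ->
    \int[mu]_x g (- x) = \int[mu]_x g x.
  move=> gi g0; apply/EFin_inj; rewrite -EFin_int; last exact: rint_opp.
  rewrite -EFin_int//; apply: (@ge0_integral_opp _ (fun x => (g x)%:E)) => //.
  by apply: mEFin; exact: rint_meas.
have fp : rint (fun x => (`|f x| + f x) / 2).
  under eq_fun do rewrite mulrC.
  by apply: rintZ; apply: rintD => //; exact: rint_norm.
have fn : rint (fun x => (`|f x| - f x) / 2).
  under eq_fun do rewrite mulrC.
  by apply: rintZ; apply: rintB => //; exact: rint_norm.
have fE x : f x = (`|f x| + f x) / 2 - (`|f x| - f x) / 2 by field.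
rewrite (eq_int fE) (eq_int (fun x => fE (- x))).
have fp' := rint_opp fp; have fn' := rint_opp fn.
rewrite (intB fp fn) (intB fp' fn'); congr (_ - _).
  apply: (pn _ fp) => x; rewrite divr_ge0// -lerBlDr sub0r.
  by rewrite -normrN ler_norm.
by apply: (pn _ fn) => x; rewrite divr_ge0// subr_ge0 ler_norm.
Qed.

Lemma int_indicE f (A : set R) : measurable A ->
  \int[mu]_(x in A) f x = \int[mu]_x (f x * \1_A x).
Proof.
move=> mA; rewrite Rintegral_mkcond; congr Rintegral; apply/funext => x.
by rewrite patchE indicE; case: (x \in A); rewrite ?mulr1 ?mulr0.
Qed.

Lemma rint_indic f (A : set R) : measurable A -> rint f ->
  rint (fun x => f x * \1_A x).
Proof.
move=> mA fi; apply: (rint_le _ (rint_norm fi)) => [|x].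
  by apply: measurable_funM; [exact: rint_meas|].
by rewrite normrM indicE; case: (x \in A); rewrite ?normr1 ?mulr1 ?normr0 ?mulr0.
Qed.

Lemma rint_cont_indic f (a b : R) : continuous f -> rint (fun x => f x * \1_(`[a, b]) x).
Proof.
move=> cf; have : mu.-integrable `[a, b] (EFin \o f).
  by apply: continuous_compact_integrable; [exact: segment_compact|exact: continuous_subspaceT].
rewrite integrable_mkcond// => h; apply: eq_integrable h => // x _.
by rewrite patchE indicE; case: (x \in _); rewrite /= ?mulr1 ?mulr0.
Qed.

Lemma int_FTC f G (a b : R) : a <= b -> continuous f ->
  (forall x : R, is_derive x (1 : R) G (f x)) ->
  \int[mu]_x (f x * \1_(`[a, b]) x) = G b - G a.
Proof.
move=> ab cf dG; rewrite -int_indicE//.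
have [->|ba] := eqVneq a b.
  by rewrite set_itv1 Rintegral_set1 subrr.
have {ba}ab : a < b by rewrite lt_neqAle ba.
have cG : continuous G.
  by move=> x; apply: differentiable_continuous; apply/derivable1_diffP; case: (dG x).
rewrite /Rintegral (@continuous_FTC2 _ f G a b ab)//.
- exact: continuous_subspaceT.
- split.
  + by move=> x _; case: (dG x).
  + exact/cvg_at_right_filter/cG.
  + exact/cvg_at_left_filter/cG.
- by move=> x _; rewrite derive1E; case: (dG x).
Qed.

Lemma indic_lim (x : R) : (\1_(`[0%R, n%:R]) x : R) @[n --> \oo] --> (\1_(`[0%R, +oo[) x : R).
Proof.
apply: cvg_near_cst; near=> n.
rewrite !indicE !mem_setE !in_itv /= andbT.
case: (leP 0 x) => //= x0.
suff -> : x <= n%:R by [].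
by near: n; exact: nbhs_infty_ger.
Unshelve. all: by end_near. Qed.

Lemma int_half f G (l : R) : continuous f -> (forall x : R, is_derive x (1 : R) G (f x)) ->
  rint (fun x => f x * \1_(`[0%R, +oo[) x) -> G n%:R @[n --> \oo] --> l ->
  \int[mu]_x (f x * \1_(`[0%R, +oo[) x) = l - G 0.
Proof.
move=> cf dG fi Gl.
have [|||||_] := @int_dct R (fun n x => f x * \1_(`[0%R, n%:R]) x)
   (fun x => f x * \1_(`[0%R, +oo[) x) (fun x => `|f x * \1_(`[0%R, +oo[) x|).
- by move=> n; exact: rint_meas (rint_cont_indic _ _ cf).
- exact: rint_meas fi.
- exact: rint_norm.
- by apply: aeR_W => x; apply: cvgM; [exact: cvg_cst|exact: indic_lim].
- move=> n x; rewrite !normrM ler_wpM2l// !indicE !mem_setE !in_itv /= andbT.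
  by case: (0 <= x); case: (x <= n%:R); rewrite /= ?normr0 ?normr1.
under eq_fun do rewrite (int_FTC (ler0n R _) cf dG).
move=> h; apply/(cvg_unique _ h) => //.
by apply: cvgB => //; exact: cvg_cst.
Qed.

Lemma rint_half f G (l : R) : continuous f -> (forall x : R, is_derive x (1 : R) G (f x)) ->
  (forall x, 0 <= x -> 0 <= f x) -> G x @[x --> +oo] --> l ->
  rint (fun x => f x * \1_(`[0%R, +oo[) x).
Proof.
move=> cf dG f0 Gl.
have cG : continuous G.
  by move=> x; apply: differentiable_continuous; apply/derivable1_diffP; case: (dG x).
have mf := continuous_measurable_fun cf.
apply: rint_ge0P.
- by apply: measurable_funM.
- move=> x; rewrite indicE mem_setE in_itv /= andbT.
  by case: (leP 0 x) => x0; rewrite ?mulr1 ?mulr0// f0.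
have := @ge0_continuous_FTC2y _ f G 0 l f0 _ Gl _ _ _.
rewrite integral_mkcond (_ : _ \_ _ = (fun x => (f x * \1_(`[0%R, +oo[) x)%:E)); last first.
  apply/funext => x; rewrite patchE indicE; case: (x \in _); rewrite ?mulr1 ?mulr0//.
move=> ->; first exact: ltry.
- exact: continuous_subspaceT.
- by move=> x _; case: (dG x).
- exact/cvg_at_right_filter/cG.
- by move=> x _; rewrite derive1E; case: (dG x).
Qed.

Lemma even_split f : measurable_fun setT f -> (forall x, f (- x) = f x) ->
  rint (fun x => f x * \1_(`[0%R, +oo[) x) ->
  rint f /\ \int[mu]_x f x = 2 * \int[mu]_x (f x * \1_(`[0%R, +oo[) x).
Proof.
move=> mf fe fi; set g := fun x => _ in fi *.
have gi' := rint_opp fi.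
(* The two closed half-lines overlap at 0, where [f] is counted twice; hence only an equality almost
   everywhere. *)
have E : aeR (fun x => g x + g (- x) = f x).
  exists [set 0]; split => //; first by rewrite lebesgue_measure_set1.
  move=> x /= h; apply: contrapT => x0; apply: h; rewrite /g fe !indicE !mem_setE !in_itv /= !andbT.
  rewrite oppr_ge0; case: (ltgtP 0 x) => [x1|x1|x1] /=; rewrite ?mulr1 ?mulr0 ?addr0 ?add0r//.
  by case: x0; rewrite -x1.
split; first exact: rint_ae (rintD fi gi') mf E.
rewrite -(int_ae (rint_meas (rintD fi gi')) mf E) intD// int_opp//.
by rewrite mulr2n mulrDl mul1r.
Qed.

Lemma int_odd f : rint f -> (forall x, f (- x) = - f x) -> \int[mu]_x f x = 0.
Proof.
move=> fi fo; have := int_opp fi; under eq_int do rewrite fo.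
by rewrite intN// => h; lra.
Qed.

(** Abel's convergence factor. Its product with a cosine has an elementary primitive on the
    half-line, which yields the Poisson kernel by direct computation. *)
Definition PE (e p : R) : R := expR (- (e * `|p|)).

Lemma PE_ge0 e p : 0 <= PE e p. Proof. exact: expR_ge0. Qed.
Lemma PE_le1 e p : 0 <= e -> PE e p <= 1.
Proof. by move=> e0; rewrite /PE expR_le1 oppr_le0 mulr_ge0. Qed.

Lemma rmeas_PE e : measurable_fun setT (PE e).
Proof.
apply: (measurableT_comp (@measurable_expR R)); apply: measurable_funN.
by apply: measurable_funM; [exact: measurable_cst|exact: normr_measurable].
Qed.

Lemma cvgy_expRN (e : R) : 0 < e -> expR (- (e * x)) @[x --> +oo] --> 0.
Proof.
move=> e0; apply: (cvg_comp (fun x => e * x) (fun y => expR (- y))); last exact: cvgr_expR.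
exact: gt0_cvgMry.
Qed.

Lemma cont_is_derive f (f' : R -> R) : (forall x : R, is_derive x (1 : R) f (f' x)) -> continuous f.
Proof.
by move=> df x; apply: differentiable_continuous; apply/derivable1_diffP; case: (df x).
Qed.

Lemma is_derive_expRN (e x : R) :
  is_derive x (1 : R) (fun x => expR (- (e * x))) (- e * expR (- (e * x))).
Proof. by apply: (dEq (dexpR (dN (dZ e (dId x))))); ring. Qed.

Lemma rint_PE e : 0 < e -> rint (PE e).
Proof.
move=> e0; apply: (even_split (rmeas_PE e) _ _).1; first by move=> x; rewrite /PE normrN.
have := @rint_half (fun x => expR (- (e * x))) (fun x => - e^-1 * expR (- (e * x))) 0.
rewrite (_ : (fun x : R => PE e x * _) = (fun x => expR (- (e * x)) * \1_(`[0%R, +oo[) x)); last first.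
  apply/funext => x; rewrite indicE mem_setE in_itv /= andbT /PE.
  by case: (leP 0 x) => x0; rewrite ?mulr0// ger0_norm.
apply.
- exact: cont_is_derive (is_derive_expRN e).
- by move=> x; apply: (dEq (dZ _ (is_derive_expRN e x))); field; rewrite gt_eqF.
- by move=> x _; exact: expR_ge0.
- rewrite -(mulr0 (- e^-1)); apply: cvgM; [exact: cvg_cst|exact: cvgy_expRN].
Qed.

Lemma is_derive_expRN_cos (e t x : R) :
  is_derive x (1 : R) (fun x => expR (- (e * x)) * cos (t * x))
    (- e * expR (- (e * x)) * cos (t * x) - t * expR (- (e * x)) * sin (t * x)).
Proof.
by apply: (dEq (dM (is_derive_expRN e x) (dcos (dZ t (dId x))))); ring.
Qed.

Lemma int_PE_cos e t : 0 < e ->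
  \int[mu]_p (PE e p * cos (t * p)) = 2 * (e / (e ^+ 2 + t ^+ 2)).
Proof.
move=> e0.
have D0 : 0 < e ^+ 2 + t ^+ 2 by rewrite ltr_wpDr ?sqr_ge0// exprn_gt0.
have mf : measurable_fun setT (fun p => PE e p * cos (t * p)).
  apply: measurable_funM; first exact: rmeas_PE.
  apply: (measurableT_comp (continuous_measurable_fun (@continuous_cos R))).
  by apply: measurable_funM; [exact: measurable_cst|].
have cE : (fun p => PE e p * cos (t * p) * \1_(`[0%R, +oo[) p) =
    (fun p => (expR (- (e * p)) * cos (t * p)) * \1_(`[0%R, +oo[) p).
  apply/funext => x; rewrite indicE mem_setE in_itv /= andbT /PE.
  by case: (leP 0 x) => x0; rewrite ?mulr0// ger0_norm.
have fi : rint (fun p => PE e p * cos (t * p)).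
  apply: (rint_le mf (rint_PE e0)) => p.
  rewrite normrM ger0_norm ?PE_ge0// ler_piMr ?PE_ge0// ler_norml cos_geN1 cos_le1//.
have hi := rint_indic (measurable_itv `[0%R, +oo[) fi.
have [|_ ->] := even_split mf _ hi; first by move=> x; rewrite /PE normrN mulrN cosN.
  rewrite cE in hi *; congr (2 * _).
  pose G p := expR (- (e * p)) * (t * sin (t * p) - e * cos (t * p)) / (e ^+ 2 + t ^+ 2).
  have dG (x : R) : is_derive x (1 : R) G (expR (- (e * x)) * cos (t * x)).
    have dl := fun c => dZ c (dId x).
    apply: (dEq (dM (dM (is_derive_expRN e x) (dD (dZ t (dsin (dl t))) (dN (dZ e (dcos (dl t)))))) (dC (e ^+ 2 + t ^+ 2)^-1 x))).
    by field; rewrite gt_eqF.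
  have lG : G n%:R @[n --> \oo] --> (0 : R).
    apply/norm_cvg0P.
    have h0 : expR (- (e * n%:R)) * ((`|t| + e) / (e ^+ 2 + t ^+ 2)) @[n --> \oo] --> (0:R).
      rewrite -(mul0r ((`|t| + e) / (e ^+ 2 + t ^+ 2))); apply: cvgM; last exact: cvg_cst.
      by apply: (@cvg_comp _ _ _ (fun n : nat => n%:R : R) (fun x => expR (- (e * x)))); [exact: cvgr_idn|exact: cvgy_expRN].
    apply: cvg0_squeeze h0 => n; rewrite normr_ge0 /= /G -mulrA normrM ger0_norm ?expR_ge0//.
    rewrite ler_wpM2l ?expR_ge0// normrM.
    rewrite [`|(e ^+ 2 + _)^-1|]ger0_norm; last by rewrite invr_ge0 ltW.
    rewrite ler_wpM2r ?invr_ge0 ?(ltW D0)//.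
    rewrite (le_trans (ler_normB _ _))// !normrM (ger0_norm (ltW e0)).
    by rewrite lerD// ler_piMr ?normr_ge0 ?(ltW e0)// ler_norml ?sin_geN1 ?sin_le1// cos_geN1 cos_le1.
  have cf := cont_is_derive (is_derive_expRN_cos e t).
  have -> := int_half cf dG hi lG.
  by rewrite /G !mulr0 oppr0 expR0 sin0 cos0; field; rewrite gt_eqF.
Qed.

Lemma cint_PE_cexpi e t : 0 < e -> cint (fun p => cexpi (t * p) * (PE e p)%:C).
Proof.
move=> e0; apply: (@cint_bddM _ _ _ 1); first exact: cintR (rint_PE e0).
  by apply: cmeas_cexpi; apply: measurable_funM; [exact: measurable_cst|].
by move=> x; rewrite cabs_cexpi.
Qed.

Lemma J_PE e t : 0 < e ->
  J (fun p => cexpi (t * p) * (PE e p)%:C) = (2 * (e / (e ^+ 2 + t ^+ 2)))%:C.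
Proof.
move=> e0; have hc := cint_PE_cexpi t e0.
apply: complex_eqP; rewrite ?Re_J ?Im_J /=.
  rewrite -int_PE_cos//; apply: eq_int => p.
  by rewrite mulr0 subr0 mulrC.
have := @int_odd (fun p => Im (cexpi (t * p) * (PE e p)%:C)) (cint_Im hc); apply.
by move=> p; rewrite !cImM /= !mulr0 !add0r mulrN sinN mulNr /PE normrN.
Qed.

Lemma int_oneDsqr :
  rint (fun x : R => (1 + x ^+ 2)^-1) /\ \int[mu]_x (1 + x ^+ 2 : R)^-1 = pi.
Proof.
have D0 (x : R) : 0 < 1 + x ^+ 2 by rewrite ltr_wpDr ?sqr_ge0.
have da (x : R) : is_derive x (1 : R) (@atan R) ((1 + x ^+ 2)^-1) by exact: is_derive1_atan.
have cf : continuous (fun x : R => (1 + x ^+ 2)^-1).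
  move=> x; apply: cvgV; first by rewrite gt_eqF.
  by apply: cvgD; [exact: cvg_cst|exact: exprn_continuous].
have hi := @rint_half (fun x : R => (1 + x ^+ 2)^-1) (@atan R) (pi / 2) cf da
   (fun x _ => ltW (eqbRL (invr_gt0 _) (D0 x))) (@cvgy_atan R).
have [|h1 h2] := even_split (continuous_measurable_fun cf) _ hi.
  by move=> x; rewrite sqrrN.
split => //; rewrite h2.
have lG : (@atan R) n%:R @[n --> \oo] --> (pi / 2 : R).
  by apply: (cvg_comp (fun n => n%:R)); [exact: cvgr_idn|exact: cvgy_atan].
have -> := int_half cf da hi lG.
by rewrite atan0 subr0; field.
Qed.

End scalar_integrals.

(** * The Fourier-Plancherel transform *)

Section fourier_L1.
Context {R : realType}.
Local Notation mu := (@lebesgue_measure R).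
Local Notation mR := (measurableTypeR R).
Implicit Types (f g h : R -> R[i]).

Definition c0 : R := (Num.sqrt (2 * pi))^-1.

Lemma c0_gt0 : 0 < c0.
Proof. by rewrite invr_gt0 sqrtr_gt0 mulr_gt0// pi_gt0. Qed.

Lemma sqr_c0 : c0 ^+ 2 = (2 * pi)^-1.
Proof. by rewrite exprVn sqr_sqrtr// mulr_ge0// pi_ge0. Qed.

Lemma cabs_c0 : cabs c0%:C = c0.
Proof. by rewrite cabsR ger0_norm// ltW// c0_gt0. Qed.

Definition F1 f (p : R) : R[i] := c0%:C * J (fun x => cexpi (- (p * x)) * f x).

Lemma cmeas_cexpiM (t : R) : cmeas (fun x : R => cexpi (t * x)).
Proof. by apply: cmeas_cexpi; apply: measurable_funM; [exact: measurable_cst|]. Qed.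

Lemma cmeas_cexpiNM (t : R) : cmeas (fun x : R => cexpi (- (t * x))).
Proof.
by apply: cmeas_cexpi; apply: measurable_funN; apply: measurable_funM; [exact: measurable_cst|].
Qed.

Lemma cint_cexpi (t : R) f : cint f -> cint (fun x => cexpi (t * x) * f x).
Proof.
move=> fi; apply: (@cint_bddM _ _ _ 1) => //; first exact: cmeas_cexpiM.
by move=> x; rewrite cabs_cexpi.
Qed.

Lemma cint_cexpiN (t : R) f : cint f -> cint (fun x => cexpi (- (t * x)) * f x).
Proof.
move=> fi; apply: (@cint_bddM _ _ _ 1) => //; first exact: cmeas_cexpiNM.
by move=> x; rewrite cabs_cexpi.
Qed.

Lemma cmeas_kexp : cmeas (fun z : mR * mR => cexpi (- (z.1 * z.2))).
Proof.
apply: cmeas_cexpi; apply: measurable_funN; apply: measurable_funM.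
  exact: measurable_fst.
exact: measurable_snd.
Qed.

Lemma cmeas_F1 f : cmeas f -> cmeas (F1 f).
Proof.
move=> mf; apply: cmeasM; first exact: cmeas_cst.
exact: (cmeas_J_kernel cmeas_kexp mf).
Qed.

Lemma F1_bdd f p : cint f -> cabs (F1 f p) <= c0 * \int[mu]_x cabs (f x).
Proof.
move=> fi; rewrite /F1 cabsM cabs_c0 ler_wpM2l ?(ltW c0_gt0)//.
apply: le_trans (cabs_J (cint_cexpiN p fi)) _.
by under eq_int do rewrite cabsM cabs_cexpi mul1r.
Qed.

Lemma F1B f g p : cint f -> cint g -> F1 (fun x => f x - g x) p = F1 f p - F1 g p.
Proof.
move=> fi gi; rewrite /F1 -mulrBr -JB; [|exact: cint_cexpiN..].
by congr (_ * _); apply: eq_J => x; rewrite mulrBr.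
Qed.

Lemma F1_ae f g : cmeas f -> cmeas g -> aeR (fun x => f x = g x) -> F1 f = F1 g.
Proof.
move=> mf mg fg; apply/funext => p; rewrite /F1; congr (_ * _); apply: J_ae.
- by apply: cmeasM => //; exact: cmeas_cexpiNM.
- by apply: cmeasM => //; exact: cmeas_cexpiNM.
- by apply: (aeR_S fg) => x ->.
Qed.

Lemma cabs_kexp (z : mR * mR) : cabs (cexpi (- (z.1 * z.2))) <= 1 :> R.
Proof. by rewrite cabs_cexpi. Qed.

(** Both sides are the same double integral, the kernel exp(-i p x) being symmetric in its two
    variables. *)
Lemma F1_mult f h : cint f -> cint h ->
  J (fun p => F1 f p * h p) = J (fun x => f x * F1 h x).
Proof.
move=> fi hi.
transitivity (c0%:C * J (fun p => h p * J (fun x => cexpi (- (p * x)) * f x))).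
  rewrite -JZ; first by apply: eq_J => p; rewrite /F1; ring.
  have [mf _] := fi.
  under eq_fun do rewrite mulrC.
  apply: (@cint_bddM _ _ _ (\int[mu]_x cabs (f x))) => //.
    exact: (cmeas_J_kernel cmeas_kexp mf).
  move=> p; apply: le_trans (cabs_J (cint_cexpiN p fi)) _.
  by under eq_int do rewrite cabsM cabs_cexpi mul1r.
rewrite (J_fubini_bdd hi fi cmeas_kexp cabs_kexp).
rewrite -JZ.
  apply: eq_J => x; rewrite /F1 /= mulrCA; congr (_ * (_ * _)).
  by apply: eq_J => y; rewrite [y * x]mulrC.
under eq_fun do rewrite mulrC.
have [mh _] := hi.
apply: (@cint_bddM _ _ _ (\int[mu]_x cabs (h x))) => //.
  have := cmeas_J_kernel cmeas_kexp mh; rewrite /=.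
  by congr (cmeas _); apply/funext => x; apply: eq_J => y; rewrite [x * y]mulrC.
move=> x; rewrite /=; under eq_J do rewrite [_ * x]mulrC.
apply: le_trans (cabs_J (cint_cexpiN x hi)) _.
by under eq_int do rewrite cabsM cabs_cexpi mul1r.
Qed.

Lemma J_affine (a b : R) f : 0 < a -> cint f ->
  cint (fun x => f (a * x + b)) /\ J (fun x => f (a * x + b)) = (a^-1)%:C * J f.
Proof.
move=> a0 fi; split.
  by apply: cintP; [exact: (rint_affine b a0 (cint_Re fi))|exact: (rint_affine b a0 (cint_Im fi))].
apply: complex_eqP; rewrite ?cReM ?cImM !(Re_J, Im_J) /=.
  by rewrite (int_affine b a0 (cint_Re fi)) mul0r subr0.
by rewrite (int_affine b a0 (cint_Im fi)) mul0r addr0.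
Qed.

(** The Cauchy density, which is the Poisson kernel at e = 1: nonnegative and of integral 1, it
    gives an approximate identity by dilation. *)
Definition qker (t : R) : R := pi^-1 * (1 + t ^+ 2)^-1.

Lemma rint_qker : rint qker.
Proof. exact: rintZ (int_oneDsqr.1). Qed.

Lemma qker_ge0 t : 0 <= qker t.
Proof. by rewrite mulr_ge0// invr_ge0 ?pi_ge0// addr_ge0// sqr_ge0. Qed.

Lemma int_qker : \int[mu]_t qker t = 1.
Proof. by rewrite intZ ?int_oneDsqr.2 ?mulVf ?gt_eqF ?pi_gt0//; exact: int_oneDsqr.1. Qed.

(* The Poisson kernel [e / (pi (e^2 + t^2))] is the transform of [exp (- e |p|)],
   here after the substitution [x = e t + y]. *)
Lemma F1_poisson e f y : 0 < e -> cint f ->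
  F1 (fun p => (PE e p)%:C * (F1 f p)^*) y =
  (J (fun t => f (e * t + y) * (qker t)%:C))^*.
Proof.
move=> e0 fi.
have bF p : cabs (F1 f p)^* <= c0 * \int[mu]_x cabs (f x).
  by rewrite cabsJ; exact: F1_bdd.
have PEi := cintR (rint_PE e0).
have [mf _] := fi.
have ci : cint (fun p => F1 f p * (cexpi (y * p) * (PE e p)%:C)).
  apply: cint_bddM (cint_PE_cexpi y e0) (cmeas_F1 mf) _ => p.
  exact: F1_bdd.
(* Conjugation changes exp(-i y p) into exp(i y p): the left side is the conjugate of the Abel mean
   of the inverse transform, and no separate inverse transform is introduced. *)
transitivity ((c0%:C * J (fun p => F1 f p * (cexpi (y * p) * (PE e p)%:C)))^*).
  rewrite {1}/F1 cJM cJR -JJ//.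
  by congr (_ * _); apply: eq_J => p; rewrite !cJM cexpiJ !cJR; ring.
congr (_^*).
rewrite F1_mult//; last exact: cint_PE_cexpi.
have kE x : F1 (fun p => cexpi (y * p) * (PE e p)%:C) x =
    (c0 * (2 * (e / (e ^+ 2 + (y - x) ^+ 2))))%:C.
  rewrite /F1 rmorphM /= -(J_PE (y - x) e0); congr (_ * _).
  apply: eq_J => p; rewrite mulrA -cexpiD; congr (cexpi _ * _); ring.
under eq_J do rewrite kE.
have D0 (x : R) : 0 < e ^+ 2 + x ^+ 2 by rewrite ltr_wpDr ?sqr_ge0// exprn_gt0.
pose g x := f x * ((e * pi)^-1 * (1 + ((x - y) / e) ^+ 2)^-1)%:C.
have gE x : c0%:C * (f x * (c0 * (2 * (e / (e ^+ 2 + (y - x) ^+ 2))))%:C) = g x.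
  rewrite /g mulrCA -rmorphM /=; congr (_ * _%:C).
  rewrite (mulrA c0 c0) -expr2 sqr_c0; move: (pi_gt0 R); move: (pi : R) => P P0.
  have h1 : e ^+ 2 + (y - x) ^+ 2 != 0 by rewrite gt_eqF.
  have h2 : e ^+ 2 + (x - y) ^+ 2 != 0 by rewrite gt_eqF.
  have -> : (y - x) ^+ 2 = (x - y) ^+ 2 by ring.
  move: h2; move: (x - y) => d h2; field.
  by rewrite h2 !gt_eqF.
have gi : cint g.
  rewrite /g; under eq_fun do rewrite mulrC.
  apply: (@cint_bddM _ _ _ (e * pi)^-1) => //.
    apply: cmeasR; apply: measurable_funM; first exact: measurable_cst.
    apply: (@continuous_measurable_fun R (fun x => (1 + ((x - y) / e) ^+ 2)^-1)).
    move=> x; apply: cvgV; first by rewrite gt_eqF// ltr_wpDr ?sqr_ge0.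
    apply: cvgD; first exact: cvg_cst.
    apply: (@continuous_comp _ _ _ (fun x => (x - y) / e) (fun x => x ^+ 2)); last exact: exprn_continuous.
    by apply: cvgM; [apply: cvgB; [exact: cvg_id|exact: cvg_cst]|exact: cvg_cst].
  move=> x; rewrite cabsR ger0_norm; last first.
    by rewrite mulr_ge0 ?invr_ge0 ?mulr_ge0 ?(ltW e0) ?pi_ge0// addr_ge0 ?sqr_ge0.
  rewrite ler_piMr ?invr_ge0 ?mulr_ge0 ?(ltW e0) ?pi_ge0//.
  by rewrite invf_le1 ?ltr_wpDr ?sqr_ge0// lerDl sqr_ge0.
rewrite -JZ; last first.
  apply: cint_ae (cintZ (c0^-1)%:C gi) _ _.
    apply: cmeasM => //; apply: cmeasR.
    apply: (@continuous_measurable_fun R (fun x => (c0 * (2 * (e / (e ^+ 2 + (y - x) ^+ 2)))))).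
    move=> x; apply: cvgM; first exact: cvg_cst.
    apply: cvgM; first exact: cvg_cst.
    apply: cvgM; first exact: cvg_cst.
    apply: cvgV; first by rewrite gt_eqF.
    apply: cvgD; first exact: cvg_cst.
    apply: (@continuous_comp _ _ _ (fun x => (y - x)) (fun x => x ^+ 2)); last exact: exprn_continuous.
    by apply: cvgB; [exact: cvg_cst|exact: cvg_id].
  apply: aeR_W => x; rewrite -gE mulrA -rmorphM /= mulVf ?gt_eqF ?c0_gt0//.
  by rewrite mul1r.
under eq_J do rewrite gE.
have [_ e1] := J_affine y e0 gi.
rewrite (_ : J g = e%:C * ((e^-1)%:C * J g)); last first.
  by rewrite mulrA -rmorphM /= mulfV ?gt_eqF// mul1r.
rewrite -e1 -JZ; last exact: (J_affine y e0 gi).1.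
apply: eq_J => t; rewrite /g addrK mulrCA -rmorphM /=; congr (_ * _%:C).
rewrite /qker [e * t]mulrC mulfK ?gt_eqF//.
move: (pi_gt0 R); move: (pi : R) => P P0.
have h : 1 + t ^+ 2 != 0 by rewrite gt_eqF// ltr_wpDr ?sqr_ge0.
by field; rewrite h !gt_eqF.
Qed.

End fourier_L1.

(** * Plancherel's identity for bounded functions, continuous almost everywhere, and its closure *)

Section plancherel_compact.
Context {R : realType}.
Local Notation mu := (@lebesgue_measure R).
Implicit Types (f g h : R -> R[i]).

Lemma L2_bdd_cint f M : cint f -> (forall x, cabs (f x) <= M) -> L2 f.
Proof.
move=> [mf fi] fM; apply/L2P; split => //.
apply: (rint_le _ (rintZ M fi)) => [|x]; first by apply: measurable_funX; exact: cmeas_cabs.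
by rewrite ger0_norm ?sqr_ge0// expr2 ler_wpM2r ?cabs_ge0.
Qed.

Lemma cvg_PE (e : nat -> R) p : e n @[n --> \oo] --> 0 -> PE (e n) p @[n --> \oo] --> (1 : R).
Proof.
move=> e0; rewrite -(@expR0 R); apply: continuous_cvg; first exact: continuous_expR.
rewrite -oppr0; apply: cvgN; rewrite -(mul0r `|p|); apply: cvgM => //; exact: cvg_cst.
Qed.

Lemma PE_half (e p : R) : PE (e / 2) p ^+ 2 = PE e p.
Proof. by rewrite /PE expr2 -expRD; congr expR; field. Qed.

(** By the multiplication formula, the integral [I n] of |F1 f|^2 with Abel's factor is the pairing
    of [f] with its Poisson means [A n]. These stay bounded by [M] and tend to [f] at points of
    continuity, so [I n] tends to [sq f]; when the factor is removed it tends to [sq (F1 f)]. *)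
Lemma plancherel_reg f M : cint f -> (forall x, cabs (f x) <= M) ->
  aeR (fun y => forall u : nat -> R, u n @[n --> \oo] --> 0 ->
    cabs (f (u n + y) - f y) @[n --> \oo] --> 0) ->
  L2 (F1 f) /\ nn (F1 f) = nn f.
Proof.
move=> fi fM fc; have [mf fi'] := fi.
have Lf := L2_bdd_cint fi fM.
have M0 : 0 <= M by rewrite (le_trans _ (fM 0))// cabs_ge0.
pose e n : R := (n.+1%:R)^-1.
have e0 n : 0 < e n by rewrite invr_gt0.
have e1 : e n @[n --> \oo] --> 0.
  exact: (@cvg_harmonic R).
have mF := cmeas_F1 mf.
pose A n y := J (fun t => f (e n * t + y) * (qker t)%:C).
have mfa n y : cmeas (fun t : R => f (e n * t + y)).
  exact: (cmeas_comp mf (measurable_affine_map (e n) y)).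
have AE n : A n = fun y => (F1 (fun p => (PE (e n) p)%:C * (F1 f p)^*) y)^*.
  by apply/funext => y; rewrite F1_poisson// cJK.
have mh n : cmeas (fun p => (PE (e n) p)%:C * (F1 f p)^*).
  by apply: cmeasM; [apply: cmeasR; exact: rmeas_PE|exact: cmeasJ].
have hi n : cint (fun p => (PE (e n) p)%:C * (F1 f p)^*).
  under eq_fun do rewrite mulrC.
  apply: (cint_bddM (cintR (rint_PE (e0 n))) (cmeasJ mF)) => p.
  rewrite cabsJ; exact: F1_bdd.
have mA n : cmeas (A n) by rewrite AE; apply: cmeasJ; exact: cmeas_F1.
have qi := cintR (@rint_qker R).
have Ai n y : cint (fun t => f (e n * t + y) * (qker t)%:C).
  by apply: (cint_bddM qi (mfa n y)) => t; exact: fM.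
have AM n y : cabs (A n y) <= M.
  apply: le_trans (cabs_J (Ai n y)) _.
  have -> : M = \int[mu]_t (M * qker t) by rewrite intZ ?int_qker ?mulr1//; exact: rint_qker.
  apply: int_le; [by case: (Ai n y)|by apply: rintZ; exact: rint_qker|].
  by move=> t; rewrite cabsM cabsR ger0_norm ?qker_ge0// ler_wpM2r ?qker_ge0.
have Ac : aeR (fun y => cabs (A n y - f y) @[n --> \oo] --> 0).
  apply: (aeR_S fc) => y fcy.
  have -> : f y = J (fun t => f y * (qker t)%:C).
    by rewrite JZ// J_real ?int_qker ?mulr1//; exact: rint_qker.
  apply: (@J_dct _ _ _ (fun t => M * qker t)).
  - by move=> n; case: (Ai n y).
  - by apply: cmeasM; [exact: cmeas_cst|case: qi].
  - by apply: rintZ; exact: rint_qker.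
  - apply: aeR_W => t; have : cabs (f (e n * t + y) - f y) @[n --> \oo] --> 0.
      by apply: fcy; rewrite -(mul0r t); apply: cvgM => //; exact: cvg_cst.
    move=> h; have : cabs (f (e n * t + y) - f y) * qker t @[n --> \oo] --> 0 * qker t.
      by apply: cvgM => //; exact: cvg_cst.
    rewrite mul0r; apply: cvg_trans; apply: near_eq_cvg; apply: nearW => n.
    by rewrite -mulrBl cabsM cabsR ger0_norm ?qker_ge0.
  - by move=> n t; rewrite cabsM cabsR ger0_norm ?qker_ge0// ler_wpM2r ?qker_ge0.
  - apply: aeR_W => t; rewrite cabsM cabsR ger0_norm ?qker_ge0//.
    by rewrite ler_wpM2r ?qker_ge0.
pose I n := \int[mu]_p (PE (e n) p * cabs (F1 f p) ^+ 2).
have Ii n : rint (fun p => PE (e n) p * cabs (F1 f p) ^+ 2).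
  have := (cint_bddM (hi n) mF (fun p => F1_bdd p fi)).2.
  congr (rint _); apply/funext => p; move: (F1 f p) => a.
  by rewrite !cabsM cabsR cabsJ ger0_norm ?PE_ge0//; ring.
have IE n : (I n)%:C = J (fun x => f x * (A n x)^*).
  rewrite -J_real// AE.
  transitivity (J (fun p => F1 f p * ((PE (e n) p)%:C * (F1 f p)^*))).
    apply: eq_J => p; move: (F1 f p) => a; rewrite [RHS]mulrCA (mulrC a) mulJc; exact: rmorphM.
  by rewrite F1_mult//; apply: eq_J => x; rewrite cJK.
have Il : I n @[n --> \oo] --> sq f.
  have := @J_dct R (fun n x => f x * (A n x)^*) (fun x => f x * (f x)^*) (fun x => M * cabs (f x)).
  have -> : J (fun x => f x * (f x)^*) = (sq f)%:C.
    by rewrite -nn2 -innerff//; apply: eq_J => x; rewrite mulrC.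
  move=> h; apply/subr_cvg0/norm_cvg0P.
  rewrite (_ : (fun n => `|_|) = (fun n => cabs (J (fun x => f x * (A n x)^*) - (sq f)%:C))); last first.
    by apply/funext => n; rewrite -IE -rmorphB /= cabsR.
  apply: h.
  - by move=> n; apply: cmeasM => //; exact: cmeasJ.
  - by apply: cmeasM => //; exact: cmeasJ.
  - exact: rintZ.
  - apply: (aeR_S Ac) => x Acx.
    have : cabs (f x) * cabs (A n x - f x) @[n --> \oo] --> cabs (f x) * 0.
      by apply: cvgM => //; exact: cvg_cst.
    rewrite mulr0; apply: cvg_trans; apply: near_eq_cvg; apply: nearW => n.
    by rewrite -mulrBr cabsM -cJB cabsJ.
  - by move=> n x; rewrite cabsM cabsJ mulrC ler_wpM2r ?cabs_ge0.
  - by apply: aeR_W => x; rewrite cabsM cabsJ ler_wpM2r ?cabs_ge0.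
have [C IC] : exists C, forall n, I n <= C.
  have /cvg_seq_bounded : cvgn I by apply/cvg_ex; exists (sq f).
  move=> [C [_ hC]]; exists (C + 1) => n.
  by rewrite (le_trans (ler_norm _))//; apply: (hC (C + 1)) => //; rewrite ltrDl.
(* With the halved parameter |w n|^2 is the integrand of [I n]. Fatou puts [F1 f] in L^2, and only
   then is |F1 f|^2 available as a majorant for dominated convergence. *)
pose w n p := (PE (e n / 2) p)%:C * F1 f p.
have mw n : cmeas (w n).
  by apply: cmeasM => //; apply: cmeasR; exact: rmeas_PE.
have wE n p : cabs (w n p) ^+ 2 = PE (e n) p * cabs (F1 f p) ^+ 2.
  by rewrite /w cabsM cabsR exprMn real_normK ?num_real// PE_half.
have Lw n : L2 (w n).
  by apply/L2P; split => //; under eq_fun do rewrite wE.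
have eh0 : e n / 2 @[n --> \oo] --> 0.
  by rewrite -(mul0r 2^-1); apply: cvgM => //; exact: cvg_cst.
have [LF _] : L2 (F1 f) /\ nn (F1 f) <= Num.sqrt C.
  apply: (L2_fatou Lw mF).
    apply: aeR_W => p.
    have : `|PE (e n / 2) p - 1| * cabs (F1 f p) @[n --> \oo] --> 0 * cabs (F1 f p).
      apply: cvgM; last exact: cvg_cst.
      by apply/norm_cvg0P/subr_cvg0; exact: cvg_PE.
    rewrite mul0r; apply: cvg_trans; apply: near_eq_cvg; apply: nearW => n.
    rewrite /w; move: (F1 f p) => a; rewrite -{3}[a]mul1r -mulrBl cabsM; congr (_ * _).
    by rewrite -cabsR; congr cabs; rewrite rmorphB.
  move=> n; apply: ler_wsqrtr; rewrite /sq; under eq_int do rewrite wE; exact: IC.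
split => //; rewrite /nn; congr Num.sqrt.
suff Il2 : I n @[n --> \oo] --> sq (F1 f) by exact: (cvg_unique _ Il2 Il).
have [||||_] := @int_dctP R (fun n p => PE (e n) p * cabs (F1 f p) ^+ 2)
   (fun p => cabs (F1 f p) ^+ 2) (fun p => cabs (F1 f p) ^+ 2).
- by move=> n; exact: rint_meas.
- exact: L2_sq.
- move=> p; rewrite -[X in _ --> X]mul1r; apply: cvgM; last exact: cvg_cst.
  exact: cvg_PE.
- move=> n p; move: (cabs (F1 f p) ^+ 2) (sqr_ge0 (cabs (F1 f p))) => a a0.
  by rewrite normrM (ger0_norm (PE_ge0 _ _)) (ger0_norm a0) ler_piMl// PE_le1// ltW.
by apply.
Qed.

Lemma le_of_le_eps (a b : R) : (forall d, 0 < d -> a <= b + d) -> a <= b.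
Proof. by move=> h; apply/ler_addgt0Pr. Qed.

(** Convergence in L^1 makes the transforms converge pointwise, which identifies their limit as
    [F1 f]. The isometry on differences, together with Fatou, makes this convergence hold in L^2 as
    well. *)
Lemma plancherel_closure (f_ : nat -> R -> R[i]) f :
  (forall k, cint (f_ k)) -> (forall k, L2 (f_ k)) -> (forall k, L2 (F1 (f_ k))) ->
  (forall k l, nn (fun p => F1 (f_ k) p - F1 (f_ l) p) = nn (fun x => f_ k x - f_ l x)) ->
  (forall k, nn (F1 (f_ k)) = nn (f_ k)) ->
  cint f -> L2 f ->
  \int[mu]_x cabs (f_ k x - f x) @[k --> \oo] --> 0 ->
  nn (fun x => f_ k x - f x) @[k --> \oo] --> 0 ->
  L2 (F1 f) /\ nn (F1 f) = nn f.
Proof.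
move=> fi_ Lf_ LF_ iso iso0 fi Lf c1 c2; have [mf _] := fi.
have mF := cmeas_F1 mf.
have pt p : cabs (F1 (f_ k) p - F1 f p) @[k --> \oo] --> 0.
  rewrite -(mulr0 c0).
  have h : c0 * \int[mu]_x cabs (f_ k x - f x) @[k --> \oo] --> c0 * 0.
    by apply: cvgM => //; exact: cvg_cst.
  rewrite mulr0 in h *; apply: cvg0_squeeze h => k; rewrite cabs_ge0 /= -F1B//.
  by apply: F1_bdd; exact: cintB.
(* The margin [d] absorbs the distance from a far approximant to [f]; it is sent to 0 in [key']. *)
have key k d : 0 < d -> L2 (fun p => F1 (f_ k) p - F1 f p) /\
    nn (fun p => F1 (f_ k) p - F1 f p) <= nn (fun x => f_ k x - f x) + d.
  move=> d0; move/cvgrPdist_le : (c2) => /(_ d d0)[L _ hL].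
  apply: (@L2_fatou _ (fun l p => F1 (f_ k) p - F1 (f_ (l + L)%N) p)).
  - by move=> l; exact: L2B.
  - by apply: cmeasB => //; exact: L2_meas.
  - apply: aeR_W => p; have := pt p; rewrite -(cvg_shiftn L); apply: cvg0_squeeze => l.
    rewrite cabs_ge0 /=.
    rewrite (_ : _ - (F1 (f_ k) p - _) = - (F1 (f_ (l + L)%N) p - F1 f p)) ?cabsN//.
    by move: (F1 (f_ k) p) (F1 (f_ (l + L)%N) p) (F1 f p) => a b c; ring.
  - move=> l; rewrite iso; apply: le_trans (nn_triangle (Lf_ k) Lf (Lf_ _)) _.
    rewrite lerD2l nn_distC.
    by have := hL (l + L)%N (leq_addl _ _); rewrite sub0r normrN => /(le_trans (ler_norm _)).
have LF : L2 (F1 f).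
  have [L1 _] := key 0%N 1 ltr01.
  apply: (L2_ae (L2B (LF_ 0%N) L1)) => //; apply: aeR_W => p.
  by move: (F1 f p) (F1 (f_ 0%N) p) => a b; ring.
split => //.
have key' k : nn (fun p => F1 (f_ k) p - F1 f p) <= nn (fun x => f_ k x - f x).
  by apply: le_of_le_eps => d d0; exact: (key k d d0).2.
have c3 : nn (F1 (f_ k)) @[k --> \oo] --> nn (F1 f).
  apply/subr_cvg0/norm_cvg0P; apply: cvg0_squeeze c2 => k.
  by rewrite normr_ge0 (le_trans (nn_lerB (LF_ k) LF)).
have c4 : nn (f_ k) @[k --> \oo] --> nn f.
  apply/subr_cvg0/norm_cvg0P; apply: cvg0_squeeze c2 => k.
  by rewrite normr_ge0 nn_lerB.
have c5 : nn (F1 (f_ k)) @[k --> \oo] --> nn f by under eq_fun do rewrite iso0.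
exact: (cvg_unique _ c3 c5).
Qed.

(** The cut-off is a factor instead of a domain of integration, so that truncated functions live on
    the whole line and [F1] applies to them. *)
Definition box (N : nat) (x : R) : R := \1_(`[- N%:R, N%:R]) x.

Lemma box01 N x : box N x = 0 \/ box N x = 1.
Proof. by rewrite /box indicE; case: (x \in _); [right|left]. Qed.

Lemma rmeas_box N : measurable_fun setT (box N).
Proof. exact: measurable_indic. Qed.

Lemma rint_box N : rint (box N).
Proof.
have cc : continuous (fun _ : R => 1 : R) by move=> x; exact: cvg_cst.
have := rint_cont_indic (- N%:R) N%:R cc.
by congr (rint _); apply/funext => x; rewrite mul1r.
Qed.

Lemma box_ge0 N x : 0 <= box N x.
Proof. by case: (box01 N x) => ->. Qed.

Lemma cint_box N f M : cmeas f -> (forall x, cabs (f x) <= M) ->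
  cint (fun x => f x * (box N x)%:C).
Proof. by move=> mf fM; exact: (cint_bddM (cintR (rint_box N)) mf fM). Qed.

Lemma box_int N x : box N x = 1 -> - N%:R <= x <= N%:R.
Proof.
rewrite /box indicE mem_setE in_itv /=; case: (_ <= x <= _) => // /eqP.
by rewrite eq_sym oner_eq0.
Qed.

Lemma box_out N (x : R) : x \notin `[- N%:R, N%:R] -> box N x = 0.
Proof. by rewrite /box indicE mem_setE => /negbTE ->. Qed.

Lemma cvg0_squeeze_near (u v : nat -> R) : (\forall n \near \oo, 0 <= u n <= v n) ->
  v n @[n --> \oo] --> 0 -> u n @[n --> \oo] --> 0.
Proof.
move=> uv v0; apply: (@squeeze_cvgr _ _ _ _ (fun=> 0) v) => //; exact: cvg_cst.
Qed.

Lemma cvg_addz (u : nat -> R) (y : R) : u n @[n --> \oo] --> 0 -> u n + y @[n --> \oo] --> y.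
Proof. by move=> u0; rewrite -[X in _ --> X]add0r; apply: cvgD => //; exact: cvg_cst. Qed.

Lemma box_cont N (y : R) : y != N%:R -> y != - N%:R -> forall u : nat -> R,
  u n @[n --> \oo] --> 0 -> \forall n \near \oo, box N (u n + y) = box N y.
Proof.
move=> y1 y2 u u0; have uy := @cvg_addz u y u0.
have [y3|y3] := boolP (y \in `]- N%:R, N%:R[).
  have : \forall n \near \oo, u n + y \in `]- N%:R, N%:R[.
    by have := uy _ (near_in_itvoo y3).
  apply: filterS => n hn.
  by rewrite /box !indicE !mem_setE (subset_itv_oo_cc hn) (subset_itv_oo_cc y3).
have [y4|y4] := ltP N%:R y.
  have : \forall n \near \oo, N%:R < u n + y by apply: (cvgr_gt y uy).
  apply: filterS => n hn; rewrite !box_out// in_itv /= negb_and -!ltNge ?hn ?y4 ?orbT//.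
have y5 : y < - N%:R.
  rewrite ltNge; apply: contra y3 => y3; rewrite in_itv /= !lt_neqAle y4 y1 y3.
  by rewrite eq_sym y2.
have : \forall n \near \oo, u n + y < - N%:R by apply: (cvgr_lt y uy).
by apply: filterS => n hn; rewrite !box_out// in_itv /= negb_and -!ltNge ?hn ?y5.
Qed.

Lemma ae_neq (a : R) : aeR (fun x => x != a).
Proof.
exists [set a]; split => //; first by rewrite lebesgue_measure_set1.
by move=> x /= /negP; rewrite negbK => /eqP.
Qed.

(** A continuous function cut off to an interval can be discontinuous only at the two endpoints, so
    [plancherel_reg] applies. *)
Lemma plancherel_cont_box N (a b : R -> R) M : continuous a -> continuous b ->
  (forall x, `|a x| <= M) -> (forall x, `|b x| <= M) ->
  let f := fun x => (a x +i* b x)%C * (box N x)%:C in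
  L2 (F1 f) /\ nn (F1 f) = nn f.
Proof.
move=> ca cb aM bM f.
have mab : cmeas (fun x => (a x +i* b x)%C).
  by split; exact: continuous_measurable_fun.
have abM x : cabs (a x +i* b x)%C <= M + M.
  by rewrite (le_trans (cabs_le _))//= lerD.
apply: (@plancherel_reg f (M + M)); first exact: cint_box abM.
  move=> x; rewrite cabsM cabsR; case: (box01 N x) => ->.
    by rewrite normr0 mulr0 (le_trans _ (abM x))// cabs_ge0.
  by rewrite normr1 mulr1.
apply: (aeR_S2 (ae_neq N%:R) (ae_neq (- N%:R))) => y y1 y2 u u0.
have nb := box_cont y1 y2 u0.
have ha : `|a (u n + y) - a y| + `|b (u n + y) - b y| @[n --> \oo] --> 0 + 0.
  apply: cvgD; apply/norm_cvg0P/subr_cvg0.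
    by apply: (@continuous_cvg _ _ _ _ _ (fun n => u n + y) a); [exact: ca|exact: cvg_addz].
  by apply: (@continuous_cvg _ _ _ _ _ (fun n => u n + y) b); [exact: cb|exact: cvg_addz].
rewrite addr0 in ha.
apply: cvg0_squeeze_near ha.
apply: filterS nb => n e; rewrite cabs_ge0 /= /f e -mulrBl cabsM cabsR.
rewrite (le_trans (ler_piMr (cabs_ge0 _) _))//.
  by case: (box01 N y) => ->; rewrite ?normr0 ?normr1.
by rewrite (le_trans (cabs_le _))// cReB cImB.
Qed.

End plancherel_compact.

(** * Plancherel's identity for square integrable functions of bounded support *)

Section plancherel_box.
Context {R : realType}.
Local Notation mu := (@lebesgue_measure R).
Local Notation mR := (measurableTypeR R).
Implicit Types (f g h : R -> R[i]).

Lemma rint_bdd_box (a : R -> R) M N : measurable_fun setT a -> (forall x, `|a x| <= M) ->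
  rint (fun x => a x * box N x).
Proof.
move=> ma aM; apply: (rint_le _ (rintZ M (rint_box N))) => [|x].
  by apply: measurable_funM => //; exact: rmeas_box.
by rewrite normrM (ger0_norm (box_ge0 _ _)) ler_wpM2r ?box_ge0.
Qed.

Lemma approx_box N (a : R -> R) M : measurable_fun setT a -> (forall x, `|a x| <= M) ->
  exists g : nat -> R -> R, [/\ forall n, continuous (g n), forall n x, `|g n x| <= M &
    \int[mu]_x (`|a x - g n x| * box N x) @[n --> \oo] --> 0].
Proof.
move=> ma aM; have M0 : 0 <= M by rewrite (le_trans _ (aM 0)).
have Ey : (mu (`[(- N%:R)%R, N%:R%R]%classic : set R) < +oo)%E.
  by rewrite lebesgue_measure_itv /=; case: ifPn => _; rewrite ?ltry.
have ai : mu.-integrable `[- N%:R, N%:R] (EFin \o a).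
  have := rint_bdd_box N ma aM; rewrite integrable_mkcond//.
  by congr (_.-integrable _ _); apply/funext => x; rewrite patchE /box indicE;
    case: (x \in _); rewrite /= ?mulr1 ?mulr0.
have [g [cg gi gl]] := approximation_continuous_integrable (measurable_itv _) Ey ai.
(* Clipping to [-M, M] moves the approximants no farther from the values of [a], which lie in that
   interval. The resulting uniform bound is what later turns L^1 into L^2 convergence. *)
pose clip x := Num.max (- M) (Num.min M x).
have clipM x : `|clip x| <= M.
  rewrite ler_norml /clip le_max lexx /= ge_max ge_min lexx /= andbT.
  by rewrite (le_trans _ M0)// oppr_le0.
have clipD x y : `|x| <= M -> `|x - clip y| <= `|x - y|.
  rewrite ler_norml => /andP[h1 h2].
  have a1 := ler_norm (x - y); have := ler_norm (y - x); rewrite distrC => a2.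
  have [h3|h3] := leP M y; rewrite /clip ?(min_idPl h3) ?(min_idPr (ltW h3)).
    by rewrite (max_idPr _) ?ler_norml; [apply/andP; split|]; lra.
  have [h4|h4] := leP (- M) y; rewrite ?(max_idPr h4) ?(max_idPl (ltW h4))//.
  by rewrite ler_norml; apply/andP; split; lra.
have cclip n : continuous (fun x => clip (g n x)).
  move=> x; apply: (@continuous_max R R (fun=> - M) (fun x => Num.min M (g n x))).
    exact: cvg_cst.
  by apply: (@continuous_min R R (fun=> M) (g n)); [exact: cvg_cst|exact: cg].
have mg n := continuous_measurable_fun (cg n).
have mcg n := continuous_measurable_fun (cclip n).
exists (fun n x => clip (g n x)); split => //.
have mag n : measurable_fun setT (fun x => `|a x - g n x| * box N x).
  apply: measurable_funM; last exact: rmeas_box.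
  by apply: rmeas_norm; exact: measurable_funB.
have Ie n : (\int[mu]_(z in `[(- N%:R)%R, N%:R%R]) `|(a z - g n z)%:E|)%E =
   (\int[mu]_x (`|a x - g n x| * box N x)%:E)%E.
  rewrite integral_mkcond; apply: eq_integral => x _; rewrite patchE /box indicE.
  by case: (x \in _); rewrite ?mulr1 ?mulr0.
have agi n : rint (fun x => `|a x - g n x| * box N x).
  have mI : measurable (`[(- N%:R)%R, N%:R%R]%classic : set mR) by exact: measurable_itv.
  have /integrable_norm := integrableB mI ai (gi n).
  rewrite integrable_mkcond// => h; apply: eq_integrable h => // x _.
  by rewrite patchE /box indicE; case: (x \in _); rewrite /= ?mulr1 ?mulr0.
have gl' : \int[mu]_x (`|a x - g n x| * box N x) @[n --> \oo] --> 0.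
  move: gl => /fine_cvgP[_]; apply: cvg_trans; apply: near_eq_cvg; apply: nearW => n.
  by rewrite /= Ie.
apply: cvg0_squeeze gl' => n; apply/andP; split.
  by apply: int_ge0 => x; rewrite mulr_ge0 ?box_ge0.
apply: int_le => //; last first.
  by move=> x; rewrite ler_wpM2r ?box_ge0// clipD.
apply: (rint_le _ (agi n)) => [|x].
  apply: measurable_funM; last exact: rmeas_box.
  by apply: rmeas_norm; exact: measurable_funB.
by rewrite ger0_norm ?mulr_ge0 ?box_ge0// ler_wpM2r ?box_ge0// clipD.
Qed.

Lemma cvg_nn0 (u : nat -> R -> R[i]) : sq (u n) @[n --> \oo] --> 0 ->
  nn (u n) @[n --> \oo] --> 0.
Proof.
move=> h; rewrite -(sqrtr0 R); apply: (@continuous_cvg _ _ _ _ _ (fun n => sq (u n)) Num.sqrt) => //.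
exact: sqrt_continuous.
Qed.

Lemma cabs_box f N x : cabs (f x * (box N x)%:C) = cabs (f x) * box N x.
Proof. by rewrite cabsM cabsR ger0_norm ?box_ge0. Qed.

Lemma plancherel_bdd_box N f M : cmeas f -> (forall x, cabs (f x) <= M) ->
  let g := fun x => f x * (box N x)%:C in L2 (F1 g) /\ nn (F1 g) = nn g.
Proof.
move=> mf fM g; have M0 : 0 <= M by rewrite (le_trans _ (fM 0))// cabs_ge0.
have [mr mi] := mf.
have rM x : `|Re (f x)| <= M by rewrite (le_trans (Re_le_cabs _)).
have iM x : `|Im (f x)| <= M by rewrite (le_trans (Im_le_cabs _)).
have [ga [cga gaM gal]] := approx_box N mr rM.
have [gb [cgb gbM gbl]] := approx_box N mi iM.
pose f_ k x := (ga k x +i* gb k x)%C * (box N x)%:C.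
have mab k : cmeas (fun x => (ga k x +i* gb k x)%C).
  by split; [exact: continuous_measurable_fun (cga k)|exact: continuous_measurable_fun (cgb k)].
have abM k x : cabs (ga k x +i* gb k x)%C <= M + M.
  by rewrite (le_trans (cabs_le _))//= lerD.
have fi_ k : cint (f_ k) by exact: cint_box (abM k).
have gi : cint g by exact: cint_box fM.
have f_M k x : cabs (f_ k x) <= M + M.
  rewrite (@cabs_box (fun x => (ga k x +i* gb k x)%C)) (le_trans _ (abM k x))// ler_piMr ?cabs_ge0//.
  by case: (box01 N x) => ->.
have gM x : cabs (g x) <= M.
  rewrite cabs_box (le_trans _ (fM x))// ler_piMr ?cabs_ge0//.
  by case: (box01 N x) => ->.
have Lf_ k := L2_bdd_cint (fi_ k) (f_M k).
have Lg := L2_bdd_cint gi gM.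
have c1 : \int[mu]_x cabs (f_ k x - g x) @[k --> \oo] --> 0.
  have hab : (\int[mu]_x (`|Re (f x) - ga k x| * box N x) +
      \int[mu]_x (`|Im (f x) - gb k x| * box N x)) @[k --> \oo] --> 0.
    by rewrite -[0]addr0; exact: cvgD.
  apply: (cvg0_squeeze _ hab) => k.
  apply/andP; split; first by apply: int_ge0 => x; exact: cabs_ge0.
  have h1 := rint_bdd_box N (rmeas_norm (measurable_funB mr (continuous_measurable_fun (cga k)))).
  have h2 := rint_bdd_box N (rmeas_norm (measurable_funB mi (continuous_measurable_fun (cgb k)))).
  have {}h1 : rint (fun x => `|Re (f x) - ga k x| * box N x).
    apply: (h1 (M + M)) => x; rewrite normr_id (le_trans (ler_normB _ _))// lerD//.
  have {}h2 : rint (fun x => `|Im (f x) - gb k x| * box N x).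
    apply: (h2 (M + M)) => x; rewrite normr_id (le_trans (ler_normB _ _))// lerD//.
  rewrite -intD//; apply: int_le; [exact: (cintB (fi_ k) gi).2|exact: rintD|] => x.
  rewrite /f_ /g -mulrBl (@cabs_box (fun x => (ga k x +i* gb k x)%C - f x)) -mulrDl.
  rewrite ler_wpM2r ?box_ge0// (le_trans (cabs_le _))// cReB cImB /=.
  by rewrite distrC (distrC (gb k x)).
apply: (plancherel_closure fi_ Lf_ _ _ _ gi Lg c1).
- by move=> k; case: (plancherel_cont_box N (cga k) (cgb k) (gaM k) (gbM k)).
- move=> k l.
  have ca : continuous (fun x => ga k x - ga l x).
    by move=> x; apply: cvgB; [exact: cga|exact: cga].
  have cb : continuous (fun x => gb k x - gb l x).
    by move=> x; apply: cvgB; [exact: cgb|exact: cgb].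
  have ba x : `|ga k x - ga l x| <= M + M by rewrite (le_trans (ler_normB _ _))// lerD.
  have bb x : `|gb k x - gb l x| <= M + M by rewrite (le_trans (ler_normB _ _))// lerD.
  have [_ e] := plancherel_cont_box N ca cb ba bb.
  transitivity (nn (F1 (fun x => f_ k x - f_ l x))).
    by congr nn; apply/funext => p; rewrite F1B.
  rewrite (_ : (fun x => f_ k x - f_ l x) = (fun x => ((ga k x - ga l x) +i* (gb k x - gb l x))%C * (box N x)%:C))//.
  apply/funext => x; rewrite /f_ -mulrBl; congr (_ * _); exact: complex_eqP.
- by move=> k; case: (plancherel_cont_box N (cga k) (cgb k) (gaM k) (gbM k)).
(* Since |f_ k| <= 2 M and |g| <= M, the square |f_ k - g|^2 is at most 3 M |f_ k - g|. *)
apply: cvg_nn0; have h : (M + M + M) * \int[mu]_x cabs (f_ k x - g x) @[k --> \oo] --> (M + M + M) * 0.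
  by apply: cvgM => //; exact: cvg_cst.
rewrite mulr0 in h; apply: cvg0_squeeze h => k; rewrite sq_ge0 /=.
rewrite -intZ; last exact: (cintB (fi_ k) gi).2.
apply: int_le; [exact: (L2_sq (L2B (Lf_ k) Lg))|apply: rintZ; exact: (cintB (fi_ k) gi).2|].
move=> x; rewrite expr2 ler_wpM2r ?cabs_ge0// (le_trans (cabsB _ _))// lerD//.
Qed.

Lemma L2_box N f : L2 f -> L2 (fun x => f x * (box N x)%:C).
Proof.
move=> Lf; apply: (L2_le (C := 1) _ Lf) => [|x].
  by apply: cmeasM; [exact: L2_meas|apply: cmeasR; exact: rmeas_box].
rewrite cabs_box mul1r ler_piMr ?cabs_ge0//; by case: (box01 N x) => ->.
Qed.

Lemma cint_L2_box N f : L2 f -> cint (fun x => f x * (box N x)%:C).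
Proof.
move=> Lf; have L1 : L2 (fun x : R => (box N x)%:C).
  apply: (@L2_bdd_cint _ _ 1); first exact: cintR (rint_box N).
  by move=> x; rewrite cabsR; case: (box01 N x) => ->; rewrite ?normr0 ?normr1.
exact: (L2_mul Lf L1).
Qed.

Lemma plancherel_box N f : L2 f ->
  let g := fun x => f x * (box N x)%:C in L2 (F1 g) /\ nn (F1 g) = nn g.
Proof.
move=> Lf g; have mf := L2_meas Lf.
have mc := cmeas_cabs mf.
(* Cutting off the large values leads back to [plancherel_bdd_box]; on the box the cut-offs converge
   in L^1 and in L^2 by domination. *)
pose S k := [set x | cabs (f x) <= k%:R].
have mS k : measurable (S k).
  have := mc measurableT _ (measurable_itv `]-oo, k%:R]); rewrite setTI.
  by congr measurable; apply/seteqP; split => x /=; rewrite in_itv.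
pose h k x := f x * (\1_(S k) x)%:C.
have mh k : cmeas (h k) by exact: cmeas_indic.
have hle k x : cabs (h k x) <= cabs (f x).
  rewrite cabsM cabsR indicE ler_piMr ?cabs_ge0//; by case: (x \in _); rewrite ?normr0 ?normr1.
have hk k x : cabs (h k x) <= k%:R.
  rewrite /h indicE; case: (boolP (x \in S k)) => [/set_mem xS|_]; rewrite ?mulr1// mulr0 cabs0//.
have Lh k : L2 (h k) by apply: (L2_le (C := 1) (mh k) Lf) => x; rewrite mul1r.
pose f_ k x := h k x * (box N x)%:C.
have fi_ k : cint (f_ k) by exact: cint_L2_box.
have gi : cint g by exact: cint_L2_box.
have Lf_ k : L2 (f_ k) by exact: L2_box.
have Lg : L2 g by exact: L2_box.
have hnear x : \forall k \near \oo, f_ k x = g x.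
  near=> k; rewrite /f_ /g /h indicE mem_set ?mulr1//= /S /=.
  by near: k; exact: nbhs_infty_ger.
have dle k x : cabs (f_ k x - g x) <= 2 * cabs (g x).
  rewrite (le_trans (cabsB _ _))// mulr2n mulrDl mul1r lerD2r !cabs_box.
  by rewrite ler_wpM2r ?box_ge0.
apply: (plancherel_closure fi_ Lf_) => //.
- by move=> k; case: (plancherel_bdd_box N (mh k) (hk k)).
- move=> k l; have hb x : cabs (h k x - h l x) <= k%:R + l%:R.
    by rewrite (le_trans (cabsB _ _))// lerD.
  have [_ e] := plancherel_bdd_box N (cmeasB (mh k) (mh l)) hb.
  transitivity (nn (F1 (fun x => f_ k x - f_ l x))).
    by congr nn; apply/funext => p; rewrite F1B.
  rewrite (_ : (fun x => f_ k x - f_ l x) = (fun x => (h k x - h l x) * (box N x)%:C))//.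
  by apply/funext => x; rewrite /f_ -mulrBl.
- by move=> k; case: (plancherel_bdd_box N (mh k) (hk k)).
- have [||||_] := @int_dctP R (fun k x => cabs (f_ k x - g x)) (fun=> 0) (fun x => 2 * cabs (g x)).
  + by move=> k; apply: rint_meas; exact: (cintB (fi_ k) gi).2.
  + by apply: rintZ; exact: gi.2.
  + move=> x; apply: cvg_near_cst; apply: filterS (hnear x) => k ->.
    by rewrite subrr cabs0.
  + by move=> k x; rewrite ger0_norm ?cabs_ge0.
  by rewrite /Rintegral integral0.
- apply: cvg_nn0; have [||||_] := @int_dctP R (fun k x => cabs (f_ k x - g x) ^+ 2) (fun=> 0) (fun x => 2 ^+ 2 * cabs (g x) ^+ 2).
  + by move=> k; apply: rint_meas; exact: (L2_sq (L2B (Lf_ k) Lg)).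
  + by apply: rintZ; exact: L2_sq.
  + move=> x; apply: cvg_near_cst; apply: filterS (hnear x) => k ->.
    by rewrite subrr cabs0 expr0n.
  + by move=> k x; rewrite ger0_norm ?sqr_ge0// -exprMn lerXn2r// nnegrE ?mulr_ge0 ?cabs_ge0.
  by rewrite /Rintegral integral0.
Unshelve. all: by end_near. Qed.

End plancherel_box.

(** * The transform on L^2: existence, isometry, inversion, agreement with the transform on L^1 *)

Section fourier.
Context {R : realType}.
Local Notation mu := (@lebesgue_measure R).
Implicit Types (f g h k : R -> R[i]).

Definition trunc f (n : nat) (x : R) : R[i] := f x * (box n x)%:C.

Lemma L2_trunc n f : L2 f -> L2 (trunc f n).
Proof. exact: L2_box. Qed.

Lemma cint_trunc n f : L2 f -> cint (trunc f n).
Proof. exact: cint_L2_box. Qed.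

Lemma cabs_trunc f n x : cabs (trunc f n x) <= cabs (f x).
Proof. by rewrite cabs_box ler_piMr ?cabs_ge0//; case: (box01 n x) => ->. Qed.

Lemma trunc_near f x : \forall n \near \oo, trunc f n x = f x.
Proof.
near=> n; have xn : `|x| <= n%:R by near: n; exact: nbhs_infty_ger.
by rewrite /trunc /box indicE mem_set ?mulr1//= in_itv /= -ler_norml.
Unshelve. all: by end_near. Qed.

Lemma trunc_cvg f : L2 f -> nn (fun x => trunc f n x - f x) @[n --> \oo] --> 0.
Proof.
move=> Lf; apply: cvg_nn0.
have [||||_] := @int_dctP R (fun n x => cabs (trunc f n x - f x) ^+ 2) (fun=> 0)
    (fun x => 2 ^+ 2 * cabs (f x) ^+ 2).
- by move=> n; apply: rint_meas; exact: (L2_sq (L2B (L2_trunc n Lf) Lf)).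
- by apply: rintZ; exact: L2_sq.
- move=> x; apply: cvg_near_cst; apply: filterS (trunc_near f x) => n ->.
  by rewrite subrr cabs0 expr0n.
- move=> n x; rewrite ger0_norm ?sqr_ge0// -exprMn lerXn2r// ?nnegrE ?mulr_ge0 ?cabs_ge0//.
  by rewrite (le_trans (cabsB _ _))// mulr2n mulrDl mul1r lerD2r cabs_trunc.
by rewrite /Rintegral integral0.
Qed.

Lemma fourier_truncE f n : fourier_trunc f n = F1 (trunc f n).
Proof.
apply/funext => p; rewrite /fourier_trunc /F1 /c0; congr (_ * _).
rewrite /cintegral; apply: complex_eqP; rewrite ?Re_J ?Im_J /= /Rintegral integral_mkcond;
  congr fine; apply: eq_integral => x _; rewrite patchE /trunc /box indicE.
  by case: (x \in _); rewrite ?mulr1// !mulr0 raddf0.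
by case: (x \in _); rewrite ?mulr1// !mulr0 raddf0.
Qed.

Lemma is_fourierP f g : is_fourier f g <-> [/\ L2 f, L2 g &
  nn (fun p => F1 (trunc f n) p - g p) @[n --> \oo] --> 0].
Proof.
have e (Lf : L2 f) (Lg : L2 g) : (fun n => norm2 (fun p => fourier_trunc f n p - g p)) =
    (fun n => (nn (fun p => F1 (trunc f n) p - g p))%:E).
  apply/funext => n; rewrite fourier_truncE norm2E//; apply: L2B => //.
  by case: (plancherel_box n Lf).
split => [[Lf Lg c]|[Lf Lg c]]; split => //.
  have -> : (fun p : nat => nn (fun x => F1 (trunc f p) x - g x)) =
      fine \o (fun n => norm2 (fun p => fourier_trunc f n p - g p)) by rewrite e.
  by case: ((fine_cvgP _ _).1 c).
apply: (cvg_trans (G := (fun n => norm2 (fun p => fourier_trunc f n p - g p)) @ \oo)) => //.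
by rewrite e//; apply/fine_cvgP; split => //; exact: nearW.
Qed.

Lemma nn_cvg_unique (u : nat -> R -> R[i]) g h : (forall n, L2 (u n)) -> L2 g -> L2 h ->
  nn (fun p => u n p - g p) @[n --> \oo] --> 0 ->
  nn (fun p => u n p - h p) @[n --> \oo] --> 0 -> aeR (fun p => g p = h p).
Proof.
move=> Lu Lg Lh c1 c2; apply: (aeR_S (nn_eq0P (L2B Lg Lh) _)) => [|x /subr0_eq//].
apply/eqP; rewrite eq_le nn_ge0 andbT.
have : (nn (fun p => u n p - g p) + nn (fun p => u n p - h p)) @[n --> \oo] --> (0 : R).
  by rewrite -[0]addr0; exact: cvgD.
move=> c; apply: (cvgr_to_ge c) => //.
apply: nearW => n; apply: le_trans (nn_triangle Lg (Lu n) Lh) _.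
by rewrite (nn_distC g).
Qed.

Lemma nn_cvg (u : nat -> R -> R[i]) g : (forall n, L2 (u n)) -> L2 g ->
  nn (fun p => u n p - g p) @[n --> \oo] --> 0 -> nn (u n) @[n --> \oo] --> nn g.
Proof.
move=> Lu Lg c; apply/subr_cvg0; apply/norm_cvg0P.
apply: (cvg0_squeeze _ c) => n; rewrite normr_ge0 /=; exact: nn_lerB.
Qed.

Lemma J_cvg (u v : nat -> R -> R[i]) g h : (forall n, L2 (u n)) -> L2 g ->
  (forall n, L2 (v n)) -> L2 h ->
  nn (fun p => u n p - g p) @[n --> \oo] --> 0 ->
  nn (fun p => v n p - h p) @[n --> \oo] --> 0 ->
  cabs (J (fun p => u n p * v n p) - J (fun p => g p * h p)) @[n --> \oo] --> 0.
Proof.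
move=> Lu Lg Lv Lh c1 c2.
have : (nn (fun p => u n p - g p) * nn (v n) + nn g * nn (fun p => v n p - h p))
    @[n --> \oo] --> (0 * nn h + nn g * 0 : R).
  apply: cvgD; first by apply: cvgM => //; exact: nn_cvg.
  by apply: cvgM => //; exact: cvg_cst.
rewrite mul0r mulr0 addr0 => c; apply: (cvg0_squeeze _ c) => n; rewrite cabs_ge0 /=.
rewrite -JB; [|exact: L2_mul..].
have i1 := L2_mul (L2B (Lu n) Lg) (Lv n).
have i2 := L2_mul Lg (L2B (Lv n) Lh).
rewrite (@eq_J _ _ (fun p => (u n p - g p) * v n p + g p * (v n p - h p))); last by move=> p; ring.
rewrite JD// (le_trans (cabsD _ _))// lerD// (le_trans (cabs_J _))//.
  by under eq_int do rewrite cabsM; exact: int_mul_le (L2B (Lu n) Lg) (Lv n).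
by under eq_int do rewrite cabsM; exact: int_mul_le Lg (L2B (Lv n) Lh).
Qed.

Lemma fourier_ex f : L2 f -> exists g, is_fourier f g.
Proof.
move=> Lf.
have LF n : L2 (F1 (trunc f n)) by case: (plancherel_box n Lf).
have [e e0|l [Ll cl]] := L2_complete LF; last by exists l; apply/is_fourierP; split.
have /cvgrPdist_le/(_ (e / 2) (divr_gt0 e0 (ltr0n _ 2))) [N _ HN] := trunc_cvg Lf.
exists N => m n Nm Nn.
(* A difference of two truncations is unchanged by truncation at the larger radius, which gives it
   the shape that [plancherel_box] expects. *)
have E1 : (fun x => trunc f m x - trunc f n x) =
    trunc (fun x => trunc f m x - trunc f n x) (maxn m n).
  apply/funext => y; rewrite /trunc.
  suff H (k : nat) : (k <= maxn m n)%N -> f y * (box k y)%:C = f y * (box k y)%:C * (box (maxn m n) y)%:C.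
    by rewrite mulrBl -!H ?leq_maxl ?leq_maxr.
  move=> km; case: (box01 k y) => ky; first by rewrite ky mulr0 mul0r.
  have := box_int ky; rewrite /box => /andP[k1 k2].
  rewrite [X in _ = _ * X%:C]indicE mem_set ?mulr1//= in_itv /= (le_trans _ k1) ?(le_trans k2) ?ler_nat//.
  by rewrite lerN2 ler_nat.
have -> : (fun x => F1 (trunc f m) x - F1 (trunc f n) x) =
    F1 (trunc (fun x => trunc f m x - trunc f n x) (maxn m n)).
  by apply/funext => x; rewrite -F1B; [rewrite -E1|exact: cint_trunc..].
have [_ ->] := plancherel_box (maxn m n) (L2B (L2_trunc m Lf) (L2_trunc n Lf)).
have h (k : nat) : (N <= k)%N -> nn (fun x => trunc f k x - f x) <= e / 2.
  by move=> /HN; rewrite sub0r normrN ger0_norm ?nn_ge0.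
have t : nn (fun x => trunc f m x - trunc f n x) <= e.
  rewrite (splitr e); apply: le_trans (nn_triangle (L2_trunc m Lf) Lf (L2_trunc n Lf)) _.
  by apply: lerD; [exact: h|rewrite nn_distC; exact: h].
by rewrite -/(trunc (fun x => trunc f m x - trunc f n x) (maxn m n)) -E1.
Qed.

Lemma fourier_L2l f g : is_fourier f g -> L2 f. Proof. by case. Qed.
Lemma fourier_L2r f g : is_fourier f g -> L2 g. Proof. by case. Qed.

Lemma L2_F1 n f : L2 f -> L2 (F1 (trunc f n)).
Proof. by move=> Lf; case: (plancherel_box n Lf). Qed.

Lemma fourier_nn f g : is_fourier f g -> nn g = nn f.
Proof.
move=> /is_fourierP[Lf Lg c].
apply: (@cvg_unique _ (@norm_hausdorff _ R) _ _ _ _ (nn_cvg (fun n => L2_F1 n Lf) Lg c)).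
rewrite (_ : (fun n => nn (F1 (trunc f n))) = (fun n => nn (trunc f n))).
  exact: nn_cvg (fun n => L2_trunc n Lf) Lf (trunc_cvg Lf).
by apply/funext => n; case: (plancherel_box n Lf).
Qed.

Lemma fourier_lin (a : R[i]) f g f' g' : is_fourier f g -> is_fourier f' g' ->
  is_fourier (fun x => f x + a * f' x) (fun x => g x + a * g' x).
Proof.
move=> /is_fourierP[Lf Lg c] /is_fourierP[Lf' Lg' c']; apply/is_fourierP; split.
- by apply: L2D => //; exact: L2Z.
- by apply: L2D => //; exact: L2Z.
have : (nn (fun p => F1 (trunc f n) p - g p) + cabs a * nn (fun p => F1 (trunc f' n) p - g' p))
    @[n --> \oo] --> (0 + cabs a * 0 : R).
  by apply: cvgD => //; apply: cvgM => //; exact: cvg_cst.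
rewrite mulr0 addr0 => C; apply: (cvg0_squeeze _ C) => n; rewrite nn_ge0 /=.
rewrite -nnZ; last by apply: L2B => //; exact: L2_F1.
rewrite (_ : (fun p => _) = (fun p => (F1 (trunc f n) p - g p) + a * (F1 (trunc f' n) p - g' p))).
  apply: nnD; first by apply: L2B => //; exact: L2_F1.
  by apply: L2Z; apply: L2B => //; exact: L2_F1.
apply/funext => p.
have -> : F1 (trunc (fun x => f x + a * f' x) n) p = F1 (trunc f n) p + a * F1 (trunc f' n) p.
  have i1 := cint_cexpiN p (cint_trunc n Lf).
  have i2 := cint_cexpiN p (cint_trunc n Lf').
  rewrite /F1 mulrCA -mulrDr -(JZ a i2) -(JD i1 (cintZ a i2)).
  by congr (_ * _); apply: eq_J => x; rewrite /trunc; move: (cexpi _) => e; ring.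
by move: (F1 _ _) (F1 _ _) => u v; ring.
Qed.

Lemma fourier_ae f g f' g' : is_fourier f g -> cmeas f' -> cmeas g' ->
  aeR (fun x => f x = f' x) -> aeR (fun x => g x = g' x) -> is_fourier f' g'.
Proof.
move=> /is_fourierP[Lf Lg c] mf mg ff gg; have Lg' := L2_ae Lg mg gg.
have Lf' := L2_ae Lf mf ff; apply/is_fourierP; split => //.
rewrite (_ : (fun n => _) = (fun n => nn (fun p => F1 (trunc f n) p - g p)))//.
apply/funext => n; have -> : F1 (trunc f' n) = F1 (trunc f n).
  apply: F1_ae; [exact: (cint_trunc n Lf').1|exact: (cint_trunc n Lf).1|].
  by apply: (aeR_S ff) => x xe; rewrite /trunc xe.
apply: nn_ae.
- by apply: L2_meas; apply: L2B => //; exact: L2_F1.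
- by apply: L2_meas; apply: L2B => //; exact: L2_F1.
- by apply: (aeR_S gg) => x ->.
Qed.

Lemma fourier_unique f g g' : is_fourier f g -> is_fourier f g' -> aeR (fun p => g p = g' p).
Proof.
move=> /is_fourierP[Lf Lg c] /is_fourierP[_ Lg' c'].
exact: (nn_cvg_unique (fun n => L2_F1 n Lf) Lg Lg' c c').
Qed.

Lemma fourier_sym f g h k : is_fourier f g -> is_fourier h k ->
  J (fun p => g p * h p) = J (fun x => f x * k x).
Proof.
move=> /is_fourierP[Lf Lg c] /is_fourierP[Lh Lk c'].
have c1 := J_cvg (fun n => L2_F1 n Lf) Lg (fun n => L2_trunc n Lh) Lh c (trunc_cvg Lh).
have c2 := J_cvg (fun n => L2_trunc n Lf) Lf (fun n => L2_F1 n Lh) Lk (trunc_cvg Lf) c'.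
apply/subr0_eq/cabs_eq0/eqP; rewrite eq_le cabs_ge0 andbT.
have C : (cabs (J (fun p => F1 (trunc f n) p * trunc h n p) - J (fun p => g p * h p)) +
    cabs (J (fun p => trunc f n p * F1 (trunc h n) p) - J (fun p => f p * k p)))
    @[n --> \oo] --> (0 : R) by rewrite -[0]addr0; exact: cvgD.
apply: (cvgr_to_ge C) => //; apply: nearW => n /=.
rewrite -(F1_mult (cint_trunc n Lf) (cint_trunc n Lh)).
move: (J (fun p => F1 _ p * _)) (J (fun p => g p * h p)) (J (fun x => f x * k x)) => a b d.
by rewrite (_ : b - d = (a - d) - (a - b)) ?(le_trans (cabsB _ _)) 1?addrC//; ring.
Qed.

(** Polarisation: the isometry is applied to f + a h with a = 1 and a = -i, which gives the real and
    the imaginary part. *)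
Lemma fourier_inner f g h k : is_fourier f g -> is_fourier h k -> inner f h = inner g k.
Proof.
move=> fg hk; have [[Lf Lg] [Lh Lk]] :=
  ((fourier_L2l fg, fourier_L2r fg), (fourier_L2l hk, fourier_L2r hk)).
have e a : 2 * Re (a * inner f h) = 2 * Re (a * inner g k).
  have := fourier_nn (fourier_lin a fg hk).
  move=> /(congr1 (fun x => x ^+ 2)); rewrite (nn_sqrD Lg (L2Z a Lk)) (nn_sqrD Lf (L2Z a Lh)).
  rewrite !nnZ// (fourier_nn fg) (fourier_nn hk) => /addIr/addrI.
  by rewrite !innerZr.
apply: complex_eqP.
  by have := e 1; rewrite !mul1r => /(mulfI _) ->.
have := e (-'i)%C; rewrite !cReM /= !(oppr0, mul0r, sub0r, mulN1r, opprK).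
by move=> /(mulfI _) ->.
Qed.

(** The inversion theorem. Let [k] be the transform of conj g. The symmetric pairing [fourier_sym]
    gives <conj f, k> = |g|^2, while [k] and [f] both have the norm of [g]; expanding, |k - conj
    f|^2 = 0. *)
Lemma fourier_conj f g : is_fourier f g ->
  is_fourier (fun x => (g x)^*) (fun x => (f x)^*).
Proof.
move=> fg; have [Lf Lg] := (fourier_L2l fg, fourier_L2r fg).
have [k hk] := fourier_ex (L2J Lg); have Lk := fourier_L2r hk.
apply: (fourier_ae hk) => //; [|exact: cmeasJ (L2_meas Lf)|exact: aeR_W|].
  exact: cmeasJ (L2_meas Lg).
have e : inner (fun x => (f x)^*) k = (nn g ^+ 2)%:C.
  have := fourier_sym fg hk.
  rewrite [X in X = _](@eq_J _ _ (fun x => (g x)^* * g x)) => [E|x]; last by rewrite mulrC.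
  have -> : inner (fun x => (f x)^*) k = J (fun x => f x * k x).
    by rewrite innerE; apply: eq_J => x; rewrite cJK.
  rewrite -E.
  by rewrite -innerff.
apply: (aeR_S (nn_eq0P (L2B Lk (L2J Lf)) _)) => [|x /subr0_eq//].
apply/eqP; rewrite -sqrf_eq0 nn_sqrB//; last exact: L2J.
rewrite innerC//; last exact: L2J.
rewrite e cJR /= (fourier_nn hk) !nnJ (fourier_nn fg); apply/eqP; ring.
Qed.

Lemma fourier_onto g : L2 g -> exists f, is_fourier f g.
Proof.
move=> Lg; have [k hk] := fourier_ex (L2J Lg).
exists (fun x => (k x)^*); have := fourier_conj hk.
by rewrite (_ : (fun x => ((g x)^*)^*) = g)//; apply/funext => x; rewrite cJK.
Qed.

Lemma fourierP f : L2 f -> is_fourier f (fourier f).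
Proof. by move=> Lf; have [g fg] := fourier_ex Lf; exact: (@xgetI _ (cst 0) [set g | is_fourier f g] g). Qed.

Lemma inv_fourierP g : L2 g -> is_fourier (inv_fourier g) g.
Proof. by move=> Lg; have [f fg] := fourier_onto Lg; exact: (@xgetI _ (cst 0) [set f | is_fourier f g] f). Qed.

Lemma inv_unique f f' g : is_fourier f g -> is_fourier f' g -> aeR (fun p => f p = f' p).
Proof.
move=> /fourier_conj h /fourier_conj h'; apply: (aeR_S (fourier_unique h h')) => x e.
by rewrite -(cJK (f x)) e cJK.
Qed.

(** The truncated transforms converge to [g] in L^2 and to [F1 f] uniformly. Uniform convergence
    controls the norm only on bounded intervals, so the two limits are compared box by box. *)
Lemma fourier_L1 f g : is_fourier f g -> cint f -> aeR (fun p => g p = F1 f p).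
Proof.
move=> /is_fourierP[Lf Lg c] fi; have [mf ff] := fi.
have mF := cmeas_F1 mf.
have d1 : \int[mu]_x cabs (trunc f n x - f x) @[n --> \oo] --> 0.
  have [||||_] := @int_dctP R (fun n x => cabs (trunc f n x - f x)) (fun=> 0)
      (fun x => 2 * cabs (f x)).
  - by move=> n; apply: rint_meas; exact: (cintB (cint_trunc n Lf) fi).2.
  - exact: rintZ.
  - move=> x; apply: cvg_near_cst; apply: filterS (trunc_near f x) => n ->.
    by rewrite subrr cabs0.
  - move=> n x; rewrite ger0_norm ?cabs_ge0// (le_trans (cabsB _ _))//.
    by rewrite mulr2n mulrDl mul1r lerD2r cabs_trunc.
  by rewrite /Rintegral integral0.
have bF n p : cabs (F1 (trunc f n) p - F1 f p) <= c0 * \int[mu]_x cabs (trunc f n x - f x).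
  have i := cint_trunc n Lf; by rewrite -F1B//; apply: F1_bdd; exact: cintB.
have Lb N : L2 (fun x : R => (box N x)%:C).
  apply: (@L2_bdd_cint _ _ 1); first exact: cintR (rint_box N).
  by move=> x; rewrite cabsR; case: (box01 N x) => ->; rewrite ?normr0 ?normr1.
have bFf p : cabs (F1 f p) <= c0 * \int[mu]_x cabs (f x) by exact: F1_bdd.
have LFb N : L2 (trunc (F1 f) N) by exact: L2_bddM mF bFf (Lb N).
have box0 N : aeR (fun p => trunc g N p = trunc (F1 f) N p).
  apply: (@nn_cvg_unique (fun n => trunc (F1 (trunc f n)) N) _ _ _ _ (LFb N)).
  - by move=> n; apply: L2_trunc; exact: L2_F1.
  - exact: L2_trunc.
  - apply: (cvg0_squeeze _ c) => n; rewrite nn_ge0 /=; apply: nn_le => [| |x].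
    + by apply: L2B; apply: L2_trunc => //; exact: L2_F1.
    + by apply: L2B => //; exact: L2_F1.
    + by rewrite /trunc -mulrBl; exact: (cabs_trunc (fun x => F1 (trunc f n) x - g x)).
  - have d2 : (c0 * \int[mu]_x cabs (trunc f n x - f x)) * nn (fun x : R => (box N x)%:C : R[i])
        @[n --> \oo] --> ((c0 * 0) * nn (fun x : R => (box N x)%:C : R[i]) : R).
      by apply: cvgM; [apply: cvgM => //; exact: cvg_cst|exact: cvg_cst].
    rewrite mulr0 mul0r in d2; apply: (cvg0_squeeze _ d2) => n; rewrite nn_ge0 /=.
    rewrite (_ : (fun p => _) = (fun p => (F1 (trunc f n) p - F1 f p) * (box N p)%:C)).
      apply: (nn_bddM _ (bF n) (Lb N)); apply: cmeasB => //; exact: L2_meas (L2_F1 n Lf).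
    by apply/funext => p; rewrite /trunc -mulrBl.
apply: (aeR_S (aeR_all box0)) => p h.
have [N _ HN] : \forall n \near \oo, trunc g n p = g p /\ trunc (F1 f) n p = F1 f p.
  by near=> n; split; near: n; exact: trunc_near.
by have [<- <-] := HN N (leqnn N); exact: h.
Unshelve. all: by end_near. Qed.

(** The inverse transform of an integrable function, with a value at every point: the continuous
    representative for which evaluation at 0 makes sense. *)
Definition E1 (f : R -> R[i]) (x : R) : R[i] := (F1 (fun p => (f p)^*) x)^*.

Lemma inv_fourier_L1 u f : is_fourier u f -> cint f -> aeR (fun x => u x = E1 f x).
Proof.
move=> /fourier_conj h fi; apply: (aeR_S (fourier_L1 h (cintJ fi))) => x e.
by rewrite /E1 -e cJK.
Qed.

End fourier.

(** * Multipliers perturbed by a convolution, in momentum space *)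

Section convolution.
Context {R : realType}.
Local Notation mu := (@lebesgue_measure R).
Local Notation mR := (measurableTypeR R).
Implicit Types (m f g : R -> R[i]) (C : R).

(* The transform of a real integrable potential is such a function; convolution
   with it is the momentum representation of multiplication by the potential. *)
Definition hmult m C : Prop :=
  [/\ cmeas m, forall k, cabs (m k) <= C & forall k, m (- k) = (m k)^*].

Definition cconv m f (p : R) : R[i] := ((2 * pi)^-1)%:C * J (fun q => m (p - q) * f q).

Lemma cabs_2pi : cabs ((2 * pi)^-1)%:C = (2 * pi)^-1 :> R.
Proof. by rewrite cabsR ger0_norm// invr_ge0 mulr_ge0// pi_ge0. Qed.

Lemma cmeas_diff m : cmeas m -> cmeas (fun z : mR * mR => m (z.1 - z.2)).
Proof.
move=> mm; apply: (cmeas_comp mm) => //; apply: measurable_funB.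
  exact: measurable_fst.
exact: measurable_snd.
Qed.

Lemma cmeas_shift m (p : R) : cmeas m -> cmeas (fun q : R => m (p - q)).
Proof. by move=> mm; exact: (@cmeas_section _ (fun z => m (z.1 - z.2)) p (cmeas_diff mm)). Qed.

Lemma cmeas_conv m f : cmeas m -> cmeas f -> cmeas (cconv m f).
Proof.
move=> mm mf; apply: cmeasM; first exact: cmeas_cst.
exact: (cmeas_J_kernel (cmeas_diff mm) mf).
Qed.

Lemma cint_conv m C f p : hmult m C -> cint f -> cint (fun q => m (p - q) * f q).
Proof.
by move=> [mm mC _] fi; apply: (cint_bddM fi (cmeas_shift p mm)) => x; exact: mC.
Qed.

Lemma conv_bdd m C f p : hmult m C -> cint f ->
  cabs (cconv m f p) <= (2 * pi)^-1 * C * \int[mu]_x cabs (f x).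
Proof.
move=> hm fi; have [mm mC _] := hm; have [_ fi'] := fi.
rewrite /cconv cabsM cabs_2pi -mulrA ler_wpM2l ?invr_ge0 ?mulr_ge0 ?pi_ge0//.
apply: le_trans (cabs_J (cint_conv p hm fi)) _; rewrite -intZ//.
apply: int_le; [exact: (cint_conv p hm fi).2|exact: rintZ|] => x.
by rewrite cabsM ler_wpM2r ?cabs_ge0.
Qed.

Lemma convD m C f g p : hmult m C -> cint f -> cint g ->
  cconv m (fun x => f x + g x) p = cconv m f p + cconv m g p.
Proof.
move=> hm fi gi; rewrite /cconv -mulrDr -JD; [|exact: (cint_conv p hm)..].
by congr (_ * _); apply: eq_J => x; rewrite mulrDr.
Qed.

Lemma convZ m C (c : R[i]) f p : hmult m C -> cint f -> cconv m (fun x => c * f x) p = c * cconv m f p.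
Proof.
move=> hm fi; rewrite /cconv mulrCA -(JZ c (cint_conv p hm fi)).
by congr (_ * _); apply: eq_J => x; rewrite mulrCA.
Qed.

Lemma convB m C f g p : hmult m C -> cint f -> cint g ->
  cconv m (fun x => f x - g x) p = cconv m f p - cconv m g p.
Proof.
move=> hm fi gi; rewrite /cconv -mulrBr -JB; [|exact: (cint_conv p hm)..].
by congr (_ * _); apply: eq_J => x; rewrite mulrBr.
Qed.

Lemma conv_subl m C m' C' f p : hmult m C -> hmult m' C' -> cint f ->
  cconv (fun k => m k - m' k) f p = cconv m f p - cconv m' f p.
Proof.
move=> hm hm' fi; rewrite /cconv -mulrBr -JB; [|exact: (cint_conv p hm)|exact: (cint_conv p hm')].
by congr (_ * _); apply: eq_J => x; rewrite mulrBl.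
Qed.

Lemma hmultB m C m' C' : hmult m C -> hmult m' C' -> hmult (fun k => m k - m' k) (C + C').
Proof.
move=> [mm mC mJ] [mm' mC' mJ']; split; first exact: cmeasB.
  by move=> k; rewrite (le_trans (cabsB _ _))// lerD.
by move=> k; rewrite mJ mJ' cJB.
Qed.

Lemma conv_ae m f g : cmeas m -> cmeas f -> cmeas g -> aeR (fun x => f x = g x) ->
  cconv m f = cconv m g.
Proof.
move=> mm mf mg fg; apply/funext => p; rewrite /cconv; congr (_ * _); apply: J_ae.
- exact: (cmeasM (cmeas_shift p mm) mf).
- exact: (cmeasM (cmeas_shift p mm) mg).
by apply: (aeR_S fg) => x ->.
Qed.

(** After the exchange of integrals this is the hermitian symmetry m(p - q) = conj m(q - p), which
    reflects that the potential is real. *)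
Lemma conv_sym m C f g : hmult m C -> cint f -> cint g ->
  J (fun p => (f p)^* * cconv m g p) = J (fun p => (cconv m f p)^* * g p).
Proof.
move=> hm fi gi; have [mm mC mJ] := hm.
transitivity (((2 * pi)^-1)%:C * J (fun p => (f p)^* * J (fun q => m (p - q) * g q))).
  rewrite -JZ; first by apply: eq_J => p; rewrite /cconv mulrCA.
  under eq_fun do rewrite mulrC.
  apply: (cint_bddM (C := C * \int[mu]_x cabs (g x)) (cintJ fi)).
    exact: (cmeas_J_kernel (cmeas_diff mm) gi.1).
  move=> p; apply: le_trans (cabs_J (cint_conv p hm gi)) _; rewrite -(intZ _ gi.2).
  apply: int_le; [exact: (cint_conv p hm gi).2|exact: (rintZ _ gi.2)|] => x.
  by rewrite cabsM ler_wpM2r ?cabs_ge0.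
have -> := @J_fubini_bdd R (fun x => (f x)^*) g (fun z => m (z.1 - z.2)) C (cintJ fi) gi (cmeas_diff mm) (fun z => mC _).
rewrite -JZ; last first.
  under eq_fun do rewrite mulrC.
  have mk : cmeas (fun z : mR * mR => m (z.2 - z.1)).
    apply: (cmeas_comp mm) => //; apply: measurable_funB.
      exact: measurable_snd.
    exact: measurable_fst.
  have ii p : cint (fun x => m (x - p) * (f x)^*).
    apply: (cint_bddM (cintJ fi)); last by move=> x; exact: mC.
    exact: (cmeas_section p mk).
  apply: (cint_bddM (C := C * \int[mu]_x cabs (f x)) gi).
    exact: (cmeas_J_kernel mk (cmeasJ fi.1)).
  move=> p; apply: le_trans (cabs_J (ii p)) _; rewrite -(intZ _ fi.2).
  apply: int_le; [exact: (ii p).2|exact: (rintZ _ fi.2)|] => x.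
  by rewrite cabsM cabsJ ler_wpM2r ?cabs_ge0.
apply: eq_J => p; rewrite /cconv cJM cJR -JJ; last exact: (cint_conv p hm).
rewrite -[RHS]mulrA [X in _ = _ * X]mulrC; congr (_ * (_ * _)).
by apply: eq_J => x; rewrite cJM -mJ opprB.
Qed.

End convolution.

(** * The weighted convolution as a Hilbert-Schmidt operator *)

Section weight.
Context {R : realType}.
Local Notation mu := (@lebesgue_measure R).
Local Notation mR := (measurableTypeR R).
Variables (a : R -> R) (l : R).
Hypotheses (ma : measurable_fun setT a) (a0 : forall p, 0 <= a p) (l0 : 0 < l).
Hypothesis ai : rint (fun p => (a p + l)^-1).
Implicit Types (m f g x y : R -> R[i]) (C : R).

Definition wt (p : R) : R := Num.sqrt ((a p + l)^-1).

Lemma al_gt0 p : 0 < a p + l. Proof. by rewrite ltr_wpDl. Qed.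

Lemma wt_gt0 p : 0 < wt p.
Proof. by rewrite sqrtr_gt0 invr_gt0 al_gt0. Qed.

Lemma wt_sqr p : wt p ^+ 2 = (a p + l)^-1.
Proof. by rewrite sqr_sqrtr// invr_ge0 ltW// al_gt0. Qed.

Lemma rmeas_alV : measurable_fun setT (fun p => (a p + l)^-1).
Proof. exact: rint_meas ai. Qed.

Lemma rmeas_wt : measurable_fun setT wt.
Proof.
apply: (measurableT_comp _ rmeas_alV); apply: continuous_measurable_fun.
exact: sqrt_continuous.
Qed.

Lemma cabs_wt p : cabs (wt p)%:C = wt p.
Proof. by rewrite cabsR ger0_norm// ltW// wt_gt0. Qed.

Lemma wt_le p : wt p <= Num.sqrt l^-1.
Proof. by rewrite ler_sqrt ?invr_ge0 ?(ltW l0)// lef_pV2 ?posrE ?al_gt0// lerDr. Qed.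

Lemma L2_wt : L2 (fun p => (wt p)%:C).
Proof.
apply/L2P; split; first exact: cmeasR rmeas_wt.
by under eq_fun do rewrite cabs_wt wt_sqr.
Qed.

Definition wint : R := \int[mu]_p (a p + l)^-1.

Lemma nn_wt : nn (fun p => (wt p)%:C) ^+ 2 = wint.
Proof. by rewrite nn2 /sq; apply: eq_int => p; rewrite cabs_wt wt_sqr. Qed.

Lemma wint_ge0 : 0 <= wint. Proof. by rewrite -nn_wt sqr_ge0. Qed.

Definition wmul x (p : R) : R[i] := (wt p)%:C * x p.

Lemma L2_wmul x : L2 x -> L2 (wmul x).
Proof.
move=> Lx; apply: (L2_bddM (C := Num.sqrt l^-1)) => //; first exact: cmeasR rmeas_wt.
by move=> p; rewrite cabs_wt wt_le.
Qed.

Lemma cint_wmul x : L2 x -> cint (wmul x).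
Proof. by move=> Lx; exact: L2_mul L2_wt Lx. Qed.

Lemma nn_wmul x : L2 x -> nn (wmul x) <= Num.sqrt l^-1 * nn x.
Proof.
move=> Lx; apply: nn_bddM => //; first exact: cmeasR rmeas_wt.
by move=> p; rewrite cabs_wt wt_le.
Qed.

Lemma wmul_sym x y : inner x (wmul y) = inner (wmul x) y.
Proof. by apply: eq_J => p; rewrite /wmul cJM cJR mulrCA mulrA. Qed.

Definition bop m x : R -> R[i] := wmul (cconv m (wmul x)).

Lemma L2_bop m C x : hmult m C -> L2 x -> L2 (bop m x).
Proof.
move=> hm Lx; have [mm _ _] := hm.
rewrite /bop /wmul; under eq_fun do rewrite mulrC.
apply: (L2_bddM _ _ L2_wt); first exact: (cmeas_conv mm (cint_wmul Lx).1).
by move=> p; exact: (conv_bdd p hm (cint_wmul Lx)).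
Qed.

Lemma bop_sym m C x y : hmult m C -> L2 x -> L2 y -> inner x (bop m y) = inner (bop m x) y.
Proof.
move=> hm Lx Ly; rewrite /bop wmul_sym innerE (conv_sym hm (cint_wmul Lx) (cint_wmul Ly)).
rewrite -[RHS](wmul_sym (cconv m (wmul x))); exact: eq_J.
Qed.

Lemma bopB m C x y p : hmult m C -> L2 x -> L2 y ->
  bop m (fun q => x q - y q) p = bop m x p - bop m y p.
Proof.
move=> hm Lx Ly; rewrite /bop {1}/wmul.
rewrite (_ : wmul (fun q => x q - y q) = (fun q => wmul x q - wmul y q)).
  by rewrite (convB p hm (cint_wmul Lx) (cint_wmul Ly)) mulrBr.
by apply/funext => q; rewrite /wmul mulrBr.
Qed.

(* Square of the Hilbert-Schmidt norm of [bop m], up to the factor (2 pi)^-2. *)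
Definition hsq m : R :=
  \int[mu]_p ((a p + l)^-1 * \int[mu]_q ((a q + l)^-1 * cabs (m (p - q)) ^+ 2)).

Lemma alV_ge0 p : 0 <= (a p + l)^-1. Proof. by rewrite invr_ge0 ltW// al_gt0. Qed.

Lemma rmeas_hsq m : cmeas m ->
  measurable_fun setT (fun z : mR * mR => (a z.2 + l)^-1 * cabs (m (z.1 - z.2)) ^+ 2).
Proof.
move=> mm; apply: measurable_funM.
  by apply: (measurableT_comp rmeas_alV); exact: measurable_snd.
by apply: measurable_funX; exact: (cmeas_cabs (cmeas_diff mm)).
Qed.

Lemma rint_hsq1 m C p : cmeas m -> (forall k, cabs (m k) <= C) ->
  rint (fun q => (a q + l)^-1 * cabs (m (p - q)) ^+ 2).
Proof.
move=> mm mC; apply: (rint_le _ (rintZ (C ^+ 2) ai)) => [|q].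
  apply: measurable_funM; first exact: rmeas_alV.
  by apply: measurable_funX; exact: (cmeas_cabs (cmeas_shift p mm)).
have h : 0 <= (a q + l)^-1 * cabs (m (p - q)) ^+ 2 by rewrite mulr_ge0 ?alV_ge0 ?sqr_ge0.
rewrite (ger0_norm h) mulrC ler_wpM2r ?alV_ge0//.
by rewrite lerXn2r// nnegrE ?cabs_ge0// (le_trans (cabs_ge0 _) (mC 0)).
Qed.

Lemma hsq1_le m C p : cmeas m -> (forall k, cabs (m k) <= C) ->
  \int[mu]_q ((a q + l)^-1 * cabs (m (p - q)) ^+ 2) <= C ^+ 2 * wint.
Proof.
move=> mm mC; rewrite -intZ//; apply: int_le; [exact: rint_hsq1 mm mC|exact: rintZ|] => q.
rewrite mulrC ler_wpM2r ?alV_ge0// lerXn2r// nnegrE ?cabs_ge0//.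
by rewrite (le_trans (cabs_ge0 _) (mC 0)).
Qed.

Lemma hsq1_ge0 m p : 0 <= \int[mu]_q ((a q + l)^-1 * cabs (m (p - q)) ^+ 2).
Proof. by apply: int_ge0 => q; rewrite mulr_ge0 ?alV_ge0 ?sqr_ge0. Qed.

Lemma rint_hsq m C : cmeas m -> (forall k, cabs (m k) <= C) ->
  rint (fun p => (a p + l)^-1 * \int[mu]_q ((a q + l)^-1 * cabs (m (p - q)) ^+ 2)).
Proof.
move=> mm mC; apply: (rint_le _ (rintZ (C ^+ 2 * wint) ai)) => [|p].
  apply: measurable_funM; first exact: rmeas_alV.
  exact: (rmeas_int_param (rmeas_hsq mm)).
rewrite ger0_norm ?mulr_ge0 ?alV_ge0 ?hsq1_ge0// mulrC ler_wpM2r ?alV_ge0//.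
exact: hsq1_le mm mC.
Qed.

Lemma hsq_ge0 m : 0 <= hsq m.
Proof. by apply: int_ge0 => q; rewrite mulr_ge0 ?alV_ge0 ?hsq1_ge0. Qed.

Lemma hsq_le m C : cmeas m -> (forall k, cabs (m k) <= C) -> hsq m <= (C * wint) ^+ 2.
Proof.
move=> mm mC; rewrite exprMn (expr2 wint) mulrA {2}/wint -intZ//.
apply: int_le; [exact: rint_hsq mm mC|exact: rintZ|] => p.
rewrite mulrC ler_wpM2r ?alV_ge0//; exact: hsq1_le mm mC.
Qed.

(** For each p, Cauchy-Schwarz in q between [x] and the weighted kernel [y] produces the inner
    integral of [hsq]; the integral over p then gives the outer one. *)
Lemma bop_hsq m C x : hmult m C -> L2 x ->
  nn (bop m x) <= (2 * pi)^-1 * Num.sqrt (hsq m) * nn x.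
Proof.
move=> hm Lx; have [mm mC _] := hm; have Lb := L2_bop hm Lx.
have pi0 : 0 <= (2 * pi)^-1 :> R by rewrite invr_ge0 mulr_ge0// pi_ge0.
have r0 : 0 <= (2 * pi)^-1 * Num.sqrt (hsq m) * nn x.
  by rewrite mulr_ge0 ?nn_ge0// mulr_ge0 ?sqrtr_ge0.
rewrite -(@ler_pXn2r _ 2 _ _ _ (nn_ge0 _) r0)//.
rewrite !exprMn (sqr_sqrtr (hsq_ge0 m)) nn2.
rewrite [leRHS]mulrAC -intZ; last exact: rint_hsq mm mC.
apply: int_le; [exact: L2_sq Lb|exact: rintZ (rint_hsq mm mC)|] => p.
rewrite /bop {1}/wmul cabsM cabs_wt exprMn wt_sqr [leRHS]mulrCA ler_wpM2l ?alV_ge0//.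
rewrite /cconv cabsM cabs_2pi (exprMn _ ((2 * pi)^-1)) -[leRHS]mulrA ler_wpM2l ?sqr_ge0//.
pose y q := (m (p - q))^* * (wt q)%:C.
have Ly : L2 y.
  apply: (L2_bddM _ _ L2_wt); first exact: cmeasJ (cmeas_shift p mm).
  by move=> q; rewrite cabsJ; exact: mC.
have -> : J (fun q => m (p - q) * wmul x q) = inner y x.
  by apply: eq_J => q; rewrite /y cJM cJK cJR mulrA.
have -> : \int[mu]_q ((a q + l)^-1 * cabs (m (p - q)) ^+ 2) = nn y ^+ 2.
  by rewrite nn2; apply: eq_int => q; rewrite /y cabsM cabs_wt cabsJ exprMn wt_sqr mulrC.
rewrite mulrC -exprMn lerXn2r ?nnegrE ?mulr_ge0 ?nn_ge0 ?cabs_ge0//.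
exact: cauchy_schwarz.
Qed.

Lemma bop_norm m C x : hmult m C -> L2 x -> nn (bop m x) <= (2 * pi)^-1 * (C * wint) * nn x.
Proof.
move=> hm Lx; have [mm mC _] := hm.
have C0 : 0 <= C := le_trans (cabs_ge0 _) (mC 0).
apply: le_trans (bop_hsq hm Lx) _; rewrite ler_wpM2r ?nn_ge0//.
rewrite ler_wpM2l ?invr_ge0 ?mulr_ge0 ?pi_ge0// -[leRHS]ger0_norm ?mulr_ge0 ?wint_ge0//.
by rewrite -sqrtr_sqr ler_sqrt ?sqr_ge0//; exact: hsq_le.
Qed.

(** Dominated convergence twice, in the inner and then in the outer variable, with multiples of the
    integrable weight as majorants. Pointwise convergence is enough; the suprema of the multipliers
    need not tend to 0. *)
Lemma hsq_cvg (m_ : nat -> R -> R[i]) C : (forall n, cmeas (m_ n)) ->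
  (forall n k, cabs (m_ n k) <= C) -> (forall k, cabs (m_ n k) @[n --> \oo] --> 0) ->
  hsq (m_ n) @[n --> \oo] --> 0.
Proof.
move=> mm mC c.
have C0 : 0 <= C := le_trans (cabs_ge0 _) (mC 0%N 0).
have inn p : \int[mu]_q ((a q + l)^-1 * cabs (m_ n (p - q)) ^+ 2) @[n --> \oo] --> 0.
  have [||||_] := @int_dctP R (fun n q => (a q + l)^-1 * cabs (m_ n (p - q)) ^+ 2) (fun=> 0)
      (fun q => C ^+ 2 * (a q + l)^-1).
  - by move=> n; exact: rint_meas (rint_hsq1 p (mm n) (mC n)).
  - exact: rintZ.
  - move=> q; rewrite -(mulr0 ((a q + l)^-1)); apply: cvgM; first exact: cvg_cst.
    by rewrite -[0](mulr0 0); apply: cvgM; exact: c.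
  - move=> n q; have h : 0 <= (a q + l)^-1 * cabs (m_ n (p - q)) ^+ 2 by rewrite mulr_ge0 ?alV_ge0 ?sqr_ge0.
    rewrite (ger0_norm h) mulrC ler_wpM2r ?alV_ge0//.
    by rewrite lerXn2r// nnegrE ?cabs_ge0.
  by rewrite /Rintegral integral0.
have [||||_] := @int_dctP R (fun n p => (a p + l)^-1 *
    \int[mu]_q ((a q + l)^-1 * cabs (m_ n (p - q)) ^+ 2)) (fun=> 0)
    (fun p => C ^+ 2 * wint * (a p + l)^-1).
- by move=> n; exact: rint_meas (rint_hsq (mm n) (mC n)).
- exact: rintZ.
- by move=> p; rewrite -(mulr0 ((a p + l)^-1)); apply: cvgM => //; exact: cvg_cst.
- move=> n p; rewrite ger0_norm ?mulr_ge0 ?alV_ge0 ?hsq1_ge0// mulrC ler_wpM2r ?alV_ge0//.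
  exact: hsq1_le.
by rewrite /Rintegral integral0.
Qed.

End weight.

(** * Resolvents in momentum space and their dependence on the multiplier *)

Section momentum_operator.
Context {R : realType}.
Variables (a : R -> R).
Hypotheses (ma : measurable_fun setT a) (a0 : forall p, 0 <= a p).
Hypothesis ai : forall l, 0 < l -> rint (fun p => (a p + l)^-1).
Implicit Types (m f g x y : R -> R[i]) (C l : R) (z : R[i]).

(** Dominated convergence as l runs through the positive integers, the integrand at l = 1 being the
    majorant. *)
Lemma wint_small (e : R) : 0 < e -> exists2 l, 0 < l & wint a l <= e.
Proof.
move=> e0; have l0 n : (0 : R) < n.+1%:R by [].
have [||||_] := @int_dctP R (fun n p => (a p + n.+1%:R)^-1) (fun=> 0) (fun p => (a p + 1)^-1).
- by move=> n; exact: rint_meas (ai (l0 n)).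
- exact: ai.
- move=> p; apply: (@cvg0_squeeze _ _ (fun n => n.+1%:R^-1)); last exact: cvg_harmonic.
  move=> n; rewrite alV_ge0//= lef_pV2 ?posrE ?al_gt0//.
  by rewrite lerDr.
- move=> n p; rewrite ger0_norm ?alV_ge0// lef_pV2 ?posrE ?al_gt0//.
  by rewrite lerD2l ler1n.
rewrite /Rintegral integral0 /= => /cvgrPdist_le/(_ _ e0)[N _ /(_ N (leqnn N))].
rewrite sub0r normrN => h; exists N.+1%:R => //.
exact: le_trans (ler_norm _) h.
Qed.

(** Square integrability is asked of the sum a f + K f, not of a f, since for a point interaction
    the two terms are not separately in L^2. Integrability of [f] gives the convolution with the
    bounded [m] a value at every p. *)
Definition mop m : operator R := fun f g =>
  [/\ L2 f, L2 g, cint f & aeR (fun p => g p = (a p)%:C * f p + cconv m f p)].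

Lemma mop_ae m f g f' g' : cmeas m -> mop m f g -> cmeas f' -> cmeas g' ->
  aeR (fun p => f p = f' p) -> aeR (fun p => g p = g' p) -> mop m f' g'.
Proof.
move=> mm [Lf Lg fi e] mf mg ff gg; split.
- exact: L2_ae Lf mf ff.
- exact: L2_ae Lg mg gg.
- exact: cint_ae fi mf ff.
rewrite -(conv_ae mm fi.1 mf ff); apply: (aeR_S2 (aeR_I ff gg) e).
by move=> p [<- <-].
Qed.

Lemma mop_lin m C (c : R[i]) f g f' g' : hmult m C -> mop m f g -> mop m f' g' ->
  mop m (fun p => f p + c * f' p) (fun p => g p + c * g' p).
Proof.
move=> hm [Lf Lg fi e] [Lf' Lg' fi' e']; split.
- by apply: L2D => //; exact: L2Z.
- by apply: L2D => //; exact: L2Z.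
- by apply: cintD => //; exact: cintZ.
apply: (aeR_S2 e e') => p -> ->.
rewrite (convD p hm fi (cintZ c fi')) (convZ c p hm fi').
by move: (cconv _ _ _) (cconv _ _ _) => u v; ring.
Qed.

(** The terms containing [a] cancel pointwise, before integration; what remains is the symmetry of
    the convolution. *)
Lemma mop_sym m C f g f' g' : hmult m C -> mop m f g -> mop m f' g' ->
  inner f g' = inner g f'.
Proof.
move=> hm [Lf Lg fi e] [Lf' Lg' fi' e']; have [mm _ _] := hm.
apply/subr0_eq; rewrite !innerE -JB; [|exact: L2_ip..].
have i1 : cint (fun p => (f p)^* * cconv m f' p).
  under eq_fun do rewrite mulrC.
  apply: (cint_bddM (cintJ fi) (cmeas_conv mm fi'.1)) => p; exact: (conv_bdd p hm fi').
have i2 : cint (fun p => (cconv m f p)^* * f' p).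
  apply: (cint_bddM fi' (cmeasJ (cmeas_conv mm fi.1))) => p.
  by rewrite cabsJ; exact: (conv_bdd p hm fi).
rewrite (@J_ae _ _ (fun p => (f p)^* * cconv m f' p - (cconv m f p)^* * f' p)).
- by rewrite JB// (conv_sym hm fi fi') subrr.
- by apply: cmeasB; [exact: (L2_ip Lf Lg').1|exact: (L2_ip Lg Lf').1].
- by apply: cmeasB; [exact: i1.1|exact: i2.1].
apply: (aeR_S2 e e') => p -> ->; rewrite cJD cJM cJR.
by move: (cconv _ _ _) (cconv _ _ _) => u v; ring.
Qed.

Section resolvent.
Variables (m : R -> R[i]) (C l : R) (z : R[i]).
Hypotheses (hm : hmult m C) (l0 : 0 < l) (sl : (2 * pi)^-1 * (C * wint a l) <= 2^-1).
Hypothesis z0 : Im z != 0.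

Local Notation wmul := (wmul a l).
Local Notation bop := (bop a l).

(** The operator a + K - z between two factors w: since w^2 (a + l) = 1, w (a + K - z) w = 1 + w K w
    - (l + z) w^2. *)
Definition res_op x (p : R) : R[i] :=
  x p + bop m x p - (l%:C + z) * wmul (wmul x) p.

(* With [k] of real part 1 chosen so that [k (l + z)] is purely imaginary, the
   last term of [res_op] does not contribute to [Re (k <x, res_op x>)]. *)
Definition res_k : R[i] := (1 +i* ((l + Re z) / Im z))%C.

Lemma res_k_neq0 : res_k != 0.
Proof. by apply/eqP => /(congr1 (@Re R)) /= /eqP; rewrite oner_eq0. Qed.

Lemma L2_res_op x : L2 x -> L2 (res_op x).
Proof.
move=> Lx; apply: L2B; last by apply: L2Z; do 2 apply: (L2_wmul a0 l0 (ai l0)).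
by apply: L2D => //; exact: (L2_bop a0 l0 (ai l0) hm).
Qed.

Lemma res_opB x y : L2 x -> L2 y ->
  res_op (fun p => x p - y p) = (fun p => res_op x p - res_op y p).
Proof.
move=> Lx Ly; apply/funext => p; rewrite /res_op (bopB a0 l0 (ai l0) p hm Lx Ly) /wmul.
by move: (bop m x p) (bop m y p) => u v; ring.
Qed.

(** The number <x, bop x> is real by symmetry, so it is multiplied by Re k = 1 only and costs at
    most half of |x|^2 by the choice of [l]. The term in [wmul x] drops out because k (l + z) is
    purely imaginary. *)
Lemma res_op_coercive x : L2 x -> 2^-1 * nn x ^+ 2 <= Re (res_k * inner x (res_op x)).
Proof.
move=> Lx; have Lb := L2_bop a0 l0 (ai l0) hm Lx.
have Lw := L2_wmul a0 l0 (ai l0) Lx; have Lww := L2_wmul a0 l0 (ai l0) Lw.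
have -> : inner x (res_op x) =
    inner x x + inner x (bop m x) - (l%:C + z) * inner (wmul x) (wmul x).
  rewrite innerBr//; [|exact: L2D|exact: L2Z].
  by rewrite innerDr// innerZr// wmul_sym.
have br : Im (inner x (bop m x)) = 0.
  have := bop_sym a0 l0 (ai l0) hm Lx Lx; rewrite (innerC Lx Lb) => /(congr1 (@Im R)).
  by rewrite cImJ => h; lra.
have bn : `|Re (inner x (bop m x))| <= 2^-1 * nn x ^+ 2.
  rewrite (le_trans (Re_le_cabs _))// (le_trans (cauchy_schwarz Lx Lb))// mulrC expr2 mulrA.
  rewrite ler_wpM2r ?nn_ge0//; apply: le_trans (bop_norm a0 l0 (ai l0) hm Lx) _.
  by rewrite ler_wpM2r ?nn_ge0.
rewrite !innerff//; move: (nn_ge0 (wmul x)) br bn.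
move: (inner _ _) (nn (wmul x)) (nn x) => b w n w0 br.
rewrite ler_norml => /andP[bn1 _].
rewrite !(cReM, cImM, cReD, cImD, cReN, cImN) /= br.
rewrite !(mul0r, mulr0, subr0, addr0, add0r, mul1r, sub0r, oppr0, mulrN, opprK).
have -> : (l + Re z) / Im z * (Im z * w ^+ 2) = (l + Re z) * w ^+ 2 by field.
lra.
Qed.

Lemma res_op_below x : L2 x -> nn x <= 2 * cabs res_k * nn (res_op x).
Proof.
move=> Lx; have [->|x0] := eqVneq (nn x) 0.
  by rewrite !mulr_ge0 ?cabs_ge0 ?nn_ge0.
have xp : 0 < nn x by rewrite lt_neqAle eq_sym x0 nn_ge0.
rewrite -(ler_pM2r xp) -expr2.
have := le_trans (res_op_coercive Lx) (le_trans (ler_norm _) (Re_le_cabs _)).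
rewrite cabsM => h; have := ler_wpM2l (cabs_ge0 res_k) (cauchy_schwarz Lx (L2_res_op Lx)).
move=> h'; have := le_trans h h'; move: (cabs _) (nn (res_op x)) (nn x) => d e n h2.
by rewrite expr2 in h2 *; lra.
Qed.

Lemma res_op_surj y : L2 y -> exists2 x, L2 x & aeR (fun p => res_op x p = y p).
Proof.
apply: (@lax_milgram _ _ (1 + 2^-1 + cabs (l%:C + z) * (Num.sqrt l^-1 * Num.sqrt l^-1)) 2^-1 res_k) => //.
- exact: res_k_neq0.
- exact: L2_res_op.
- by move=> f g Lf Lg; rewrite res_opB//; exact: aeR_W.
- move=> x Lx; have Lb := L2_bop a0 l0 (ai l0) hm Lx.
  have Lw := L2_wmul a0 l0 (ai l0) Lx; have Lww := L2_wmul a0 l0 (ai l0) Lw.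
  apply: le_trans (nnB (L2D Lx Lb) (L2Z _ Lww)) _.
  rewrite mulrDl; apply: lerD.
    apply: le_trans (nnD Lx Lb) _; rewrite mulrDl mul1r lerD2l.
    apply: le_trans (bop_norm a0 l0 (ai l0) hm Lx) _.
    by rewrite ler_wpM2r ?nn_ge0.
  rewrite nnZ// -!mulrA ler_wpM2l ?cabs_ge0//.
  apply: le_trans (nn_wmul a0 l0 (ai l0) Lw) _; rewrite ler_wpM2l ?sqrtr_ge0//.
  exact: (nn_wmul a0 l0 (ai l0)).
- exact: res_op_coercive.
Qed.

Lemma wmul_neq0 p : (wt a l p)%:C != 0 :> R[i].
Proof. by rewrite -(rmorph0 (real_complex R)) (inj_eq (@complexI R)) gt_eqF ?wt_gt0. Qed.

Lemma mop_res x f : L2 x -> L2 f -> aeR (fun p => res_op x p = wmul f p) ->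
  mop m (wmul x) (fun p => f p + z * wmul x p).
Proof.
move=> Lx Lf e; have Lw := L2_wmul a0 l0 (ai l0) Lx; split => //.
- by apply: L2D => //; exact: L2Z.
- exact: (cint_wmul a0 l0 (ai l0)).
apply: (aeR_S e) => p; rewrite /res_op {1}/bop /wmul -/(wmul x) => h.
have w0 := wmul_neq0 p.
have ww : (wt a l p)%:C * (wt a l p)%:C * ((a p)%:C + l%:C) = 1 :> R[i].
  rewrite -!rmorphM -rmorphD -rmorphM /= -expr2 wt_sqr// mulVf//.
  by rewrite gt_eqF// al_gt0.
apply: (mulfI w0); rewrite mulrDr -h.
move: (cconv m _ p) ww => c ww.
move: (a p)%:C (wt a l p)%:C (l%:C) ww w0 => A W L ww w0.
have E : x p = W * W * (A + L) * x p by rewrite ww mul1r.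
rewrite [X in X + W * c]E; ring.
Qed.

Lemma mop_res_ex f : L2 f -> exists x, [/\ L2 x, aeR (fun p => res_op x p = wmul f p) &
  mop m (wmul x) (fun p => f p + z * wmul x p)].
Proof.
move=> Lf; have [x Lx e] := res_op_surj (L2_wmul a0 l0 (ai l0) Lf).
by exists x; split => //; exact: mop_res.
Qed.

End resolvent.

Lemma mop_real m C f g : hmult m C -> mop m f g -> Im (inner f g) = 0.
Proof.
move=> hm h; have [Lf Lg _ _] := h.
by have := mop_sym hm h h; rewrite (innerC Lf Lg) => /(congr1 (@Im R)); rewrite cImJ => E; lra.
Qed.

(** The difference d of two solutions satisfies (a + K) d = z d. Symmetry makes <d, z d> real, which
    forces d = 0 for nonreal z. *)
Lemma mop_inj m C z f g g' : hmult m C -> Im z != 0 ->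
  mop m f (fun p => g p + z * f p) -> mop m g' (fun p => g p + z * g' p) ->
  aeR (fun p => f p = g' p).
Proof.
move=> hm z0 h h'; have h2 := mop_lin (-1) hm h h'.
have [Ld Le _ _] := h2.
have [Lf Lg _ _] := h; have [Lf' Lg' _ _] := h'.
have E : (fun p => g p + z * f p + -1 * (g p + z * g' p)) = (fun p => z * (f p + -1 * g' p)).
  by apply/funext => p; ring.
have := mop_real hm h2; rewrite E innerZr// innerff//.
rewrite cImM /= mulr0 add0r => /eqP; rewrite mulf_eq0 (negbTE z0) /= sqrf_eq0 => /eqP n0.
apply: (aeR_S (nn_eq0P Ld n0)) => p; rewrite mulN1r; exact: subr0_eq.
Qed.

Lemma good_l (C : R) : 0 <= C -> exists2 l, 0 < l & (2 * pi)^-1 * (C * wint a l) <= 2^-1.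
Proof.
move=> C0; have pi0 := pi_gt0 R.
(* The required bound amounts to C wint <= pi; dividing by [C + 1] rather than by [C] covers C =
   0. *)
have e0 : 0 < pi / (C + 1) by rewrite divr_gt0// ltr_wpDl.
have [l l0 h] := wint_small e0; exists l => //.
have : C * wint a l <= pi.
  apply: (@le_trans _ _ ((C + 1) * wint a l)).
    by rewrite ler_wpM2r ?lerDl// wint_ge0.
  by rewrite -ler_pdivlMl ?ltr_wpDl// mulrC.
move: (C * _) => w wp; rewrite invfM -mulrA ler_piMr// mulrC ler_pdivrMr ?mul1r//.
Qed.

Lemma mop_surj m C z f : hmult m C -> Im z != 0 -> L2 f ->
  exists g, mop m g (fun p => f p + z * g p).
Proof.
move=> hm z0 Lf; have C0 : 0 <= C by have [_ h _] := hm; exact: le_trans (cabs_ge0 _) (h 0).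
have [l l0 sl] := good_l C0.
by have [x [_ _ h]] := mop_res_ex hm l0 sl z0 Lf; exists (wmul a l x).
Qed.

Lemma wmul_dense l f (d : R) : 0 < l -> L2 f -> 0 < d ->
  exists2 g, L2 g & nn (fun p => f p - wmul a l g p) <= d.
Proof.
move=> l0 Lf d0; pose v p := Num.sqrt (a p + l).
have mv : measurable_fun setT v.
  apply: measurableT_comp; last by apply: measurable_funD => //; exact: measurable_cst.
  by apply: continuous_measurable_fun; exact: sqrt_continuous.
(* On [S n] the inverse weight [v] is at most n, so a function cut off to [S n] remains in L^2 after
   division by the weight. *)
pose S n := [set p | v p <= n%:R].
have mS n : measurable (S n).
  have := mv measurableT _ (measurable_itv `]-oo, n%:R]); rewrite setTI.
  by congr measurable; apply/seteqP; split => x /=; rewrite in_itv.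
pose g n p := (f p * (v p)%:C) * (\1_(S n) p)%:C.
have wv p : wt a l p * v p = 1.
  by rewrite /wt /v -sqrtrM ?alV_ge0// mulVf ?sqrtr1// gt_eqF// al_gt0.
have Lg n : L2 (g n).
  apply: (L2_le (C := n%:R) _ Lf).
    by apply: cmeas_indic => //; apply: cmeasM; [exact: L2_meas|exact: cmeasR].
  move=> p; rewrite /g indicE; case: (boolP (p \in S n)) => [/set_mem h|_].
    rewrite mulr1 cabsM mulrC ler_wpM2r ?cabs_ge0// cabsR ger0_norm ?sqrtr_ge0//.
  by rewrite mulr0 cabs0 mulr_ge0 ?cabs_ge0.
have wg n p : wmul a l (g n) p = f p * (\1_(S n) p)%:C.
  rewrite /wmul /g mulrA mulrCA -rmorphM /= wv mulr1//.
have c : nn (fun p => f p - wmul a l (g n) p) @[n --> \oo] --> 0.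
  apply: cvg_nn0.
  have [||||_] := @int_dctP R (fun n p => cabs (f p - wmul a l (g n) p) ^+ 2) (fun=> 0)
      (fun p => cabs (f p) ^+ 2).
  - by move=> n; apply: rint_meas; apply: L2_sq; apply: L2B => //; exact: (L2_wmul a0 l0 (ai l0)).
  - exact: L2_sq.
  - move=> p; apply: cvg_near_cst; near=> n.
    rewrite wg indicE mem_set ?mulr1 ?subrr ?cabs0 ?expr0n//= /S /=.
    by near: n; exact: nbhs_infty_ger.
  - move=> n p; rewrite ger0_norm ?sqr_ge0// wg indicE; case: (_ \in _) => /=.
      by rewrite mulr1 subrr cabs0 expr0n sqr_ge0.
    by rewrite mulr0 subr0.
  by rewrite /Rintegral integral0.
have /cvgrPdist_le/(_ d d0) [N _ /(_ N (leqnn N))] := c.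
by rewrite sub0r normrN ger0_norm ?nn_ge0// => h; exists (g N).
Unshelve. all: by end_near. Qed.

(** The domain contains w x whenever N x = w g with g in L^2, where N is [res_op]. The range of w
    being dense, choose w k close to [f], then w g close to N k; as N is bounded below, x is close
    to k and w x to [f]. *)
Lemma mop_dense m C f (d : R) : hmult m C -> L2 f -> 0 < d ->
  exists g h, mop m g h /\ nn (fun p => f p - g p) <= d.
Proof.
move=> hm Lf d0; have C0 : 0 <= C by have [_ h _] := hm; exact: le_trans (cabs_ge0 _) (h 0).
have [l l0 sl] := good_l C0; have i0 : Im ('i : R[i])%C != 0 by rewrite /= oner_neq0.
have d2 : 0 < d / 2 by rewrite divr_gt0.
have [k Lk fk] := wmul_dense l0 Lf d2.
(* The bound on w times the bound on the inverse of [res_op] at the nonreal point i; adding 1 keeps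
   [M] positive. *)
pose M := Num.sqrt l^-1 * (2 * cabs (res_k l 'i%C)) + 1.
have M0 : 0 < M by rewrite ltr_wpDl// !mulr_ge0 ?sqrtr_ge0 ?cabs_ge0.
have e0 : 0 < d / 2 / M by rewrite divr_gt0.
have Ly := L2_res_op 'i%C hm l0 Lk.
have [g Lg kg] := wmul_dense l0 Ly e0.
have [x [Lx ex h]] := mop_res_ex hm l0 sl i0 Lg.
exists (wmul a l x), (fun p => g p + 'i%C * wmul a l x p); split => //.
have Lwk := L2_wmul a0 l0 (ai l0) Lk; have Lwx := L2_wmul a0 l0 (ai l0) Lx.
apply: le_trans (nn_triangle Lf Lwk Lwx) _; rewrite [leRHS]splitr; apply: lerD => //.
rewrite (_ : (fun p => _) = wmul a l (fun p => k p - x p)); last first.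
  by apply/funext => p; rewrite /wmul mulrBr.
apply: le_trans (nn_wmul a0 l0 (ai l0) (L2B Lk Lx)) _.
have := res_op_below hm l0 sl i0 (L2B Lk Lx).
rewrite (res_opB 'i%C hm l0 Lk Lx) => hb.
have Lrx := L2_res_op 'i%C hm l0 Lx.
have Lwg := L2_wmul a0 l0 (ai l0) Lg.
have E : nn (fun p => res_op m l 'i%C k p - res_op m l 'i%C x p) =
    nn (fun p => res_op m l 'i%C k p - wmul a l g p).
  apply: nn_ae; [exact: L2_meas (L2B Ly Lrx)|exact: L2_meas (L2B Ly Lwg)|].
  by apply: (aeR_S ex) => p ->.
rewrite E in hb; apply: le_trans (ler_wpM2l (sqrtr_ge0 _) hb) _.
rewrite mulrA; apply: le_trans (ler_wpM2l _ kg) _; first by rewrite !mulr_ge0 ?sqrtr_ge0 ?cabs_ge0.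
rewrite mulrCA ler_piMr ?(ltW d2)// ler_pdivrMr// mul1r /M lerDl//.
Qed.

(** The second resolvent identity between weights. If N x = w f and N' x' = w f, then N (x - x') = -
    w (K - K') w x'. The constant collects two bounds on w, two on inverses of [res_op], and the
    Hilbert-Schmidt norm of the difference. *)
Lemma res_diff m m' C (z : R[i]) l : hmult m C -> hmult m' C -> 0 < l ->
  (2 * pi)^-1 * (C * wint a l) <= 2^-1 -> Im z != 0 -> forall f g g', L2 f ->
  mop m g (fun p => f p + z * g p) -> mop m' g' (fun p => f p + z * g' p) ->
  nn (fun p => g p - g' p) <= l^-1 * (2 * cabs (res_k l z)) ^+ 2 * (2 * pi)^-1 *
    Num.sqrt (hsq a l (fun k => m k - m' k)) * nn f.
Proof.
move=> hm hm' l0 sl z0 f g g' Lf h h'.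
have [x [Lx ex hx]] := mop_res_ex hm l0 sl z0 Lf.
have [x' [Lx' ex' hx']] := mop_res_ex hm' l0 sl z0 Lf.
have gx := mop_inj hm z0 h hx; have gx' := mop_inj hm' z0 h' hx'.
have [Lg _ _ _] := h; have [Lg' _ _ _] := h'.
have Lwx := L2_wmul a0 l0 (ai l0) Lx; have Lwx' := L2_wmul a0 l0 (ai l0) Lx'.
have Lwf := L2_wmul a0 l0 (ai l0) Lf.
have Ld := L2B Lx Lx'.
have -> : nn (fun p => g p - g' p) = nn (wmul a l (fun p => x p - x' p)).
  apply: nn_ae; [exact: L2_meas (L2B Lg Lg')|exact: L2_meas (L2_wmul a0 l0 (ai l0) Ld)|].
  by apply: (aeR_S2 gx gx') => p -> ->; rewrite /wmul mulrBr.
have hmm := hmultB hm hm'.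
have Lb := L2_bop a0 l0 (ai l0) hmm Lx'.
have E : nn (res_op m l z (fun p => x p - x' p)) = nn (bop a l (fun k => m k - m' k) x').
  rewrite -[RHS]nnN (res_opB z hm l0 Lx Lx'); apply: nn_ae.
  - by apply: L2_meas; apply: L2B; exact: (L2_res_op z hm l0).
  - by apply: L2_meas; exact: L2N.
  apply: (aeR_S2 ex ex') => p -> ; rewrite /res_op /bop => <-.
  have E2 g0 : wmul a l g0 p = (wt a l p)%:C * g0 p by [].
  rewrite !E2 (conv_subl p hm hm' (cint_wmul a0 l0 (ai l0) Lx')).
  by move: (cconv _ _ _) (cconv _ _ _) => u v; ring.
have B1 := nn_wmul a0 l0 (ai l0) Ld.
have B2 := res_op_below hm l0 sl z0 Ld; rewrite E in B2.
have B3 := bop_hsq a0 l0 (ai l0) hmm Lx'.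
have B4 := res_op_below hm' l0 sl z0 Lx'.
have e4 : nn (res_op m' l z x') = nn (wmul a l f).
  by apply: nn_ae => //; [exact: L2_meas (L2_res_op z hm' l0 Lx')|exact: L2_meas].
rewrite e4 in B4; have B5 := nn_wmul a0 l0 (ai l0) Lf.
have k0 := cabs_ge0 (res_k l z); have s0 := sqrtr_ge0 l^-1.
have h0 := sqrtr_ge0 (hsq a l (fun k => m k - m' k)).
have pi0 : 0 <= (2 * pi)^-1 :> R by rewrite invr_ge0 mulr_ge0// pi_ge0.
have ll : Num.sqrt l^-1 * Num.sqrt l^-1 = l^-1 by rewrite -expr2 sqr_sqrtr// invr_ge0 ltW.
apply: le_trans B1 _; apply: le_trans (ler_wpM2l s0 B2) _.
apply: le_trans (ler_wpM2l s0 (ler_wpM2l _ B3)) _; first by rewrite mulr_ge0.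
have B6 := le_trans B4 (ler_wpM2l (mulr_ge0 (ler0n _ 2) k0) B5).
apply: le_trans (ler_wpM2l s0 (ler_wpM2l _ (ler_wpM2l _ B6))) _; rewrite ?mulr_ge0//.
rewrite -[in leRHS]ll; move: (Num.sqrt _) (Num.sqrt _) (cabs _) (nn f) (2 * pi)^-1 => A B D n P.
by rewrite le_eqVlt; apply/orP; left; apply/eqP; ring.
Qed.

End momentum_operator.

Lemma nn_cst0 (R : realType) : nn (fun=> 0 : R[i]) = 0.
Proof. by apply: nn_ae0; [exact: cmeas_cst|exact: aeR_W]. Qed.

(** * Self-adjointness and norm-resolvent convergence *)

Section position_operator.
Context {R : realType}.
Variables (a : R -> R).
Hypotheses (ma : measurable_fun setT a) (a0 : forall p, 0 <= a p).
Hypothesis ai : forall l, 0 < l -> rint (fun p => (a p + l)^-1).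
Implicit Types (m f g u v : R -> R[i]) (C l : R) (z : R[i]).

(** Any pair of transforms may serve as witness, instead of the chosen [fourier u] and [fourier v];
    this makes independence of the representatives immediate. *)
Definition pos_op m : operator R := fun u v =>
  exists f g, [/\ is_fourier u f, is_fourier v g & mop a m f g].

Section fixed_multiplier.
Variables (m : R -> R[i]) (C : R).
Hypothesis hm : hmult m C.

Lemma pos_op_L2 u v : pos_op m u v -> L2 u /\ L2 v.
Proof. by move=> [f [g [uf vg _]]]; split; [exact: fourier_L2l uf|exact: fourier_L2l vg]. Qed.

Lemma pos_op_fourier u v f g : pos_op m u v -> is_fourier u f -> is_fourier v g ->
  mop a m f g.
Proof.
move=> [f' [g' [uf vg h]]] uf' vg'; have [mm _ _] := hm.
apply: (mop_ae mm h).
- exact: L2_meas (fourier_L2r uf').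
- exact: L2_meas (fourier_L2r vg').
- exact: fourier_unique uf uf'.
- exact: fourier_unique vg vg'.
Qed.

Lemma pos_op_ae u v u' v' : pos_op m u v -> cmeas u' -> cmeas v' ->
  aeR (fun x => u x = u' x) -> aeR (fun x => v x = v' x) -> pos_op m u' v'.
Proof.
move=> [f [g [uf vg h]]] mu' mv' uu vv; exists f, g; split; last exact: h.
  exact: (fourier_ae uf mu' (L2_meas (fourier_L2r uf)) uu (aeR_W _)).
exact: (fourier_ae vg mv' (L2_meas (fourier_L2r vg)) vv (aeR_W _)).
Qed.

Lemma pos_op_lin (c : R[i]) u v u' v' : pos_op m u v -> pos_op m u' v' ->
  pos_op m (fun x => u x + c * u' x) (fun x => v x + c * v' x).
Proof.
move=> [f [g [uf vg h]]] [f' [g' [uf' vg' h']]].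
exists (fun x => f x + c * f' x), (fun x => g x + c * g' x).
by split; [exact: fourier_lin|exact: fourier_lin|exact: (mop_lin c hm h h')].
Qed.

Lemma pos_op_sym u v u' v' : pos_op m u v -> pos_op m u' v' -> inner u v' = inner v u'.
Proof.
move=> [f [g [uf vg h]]] [f' [g' [uf' vg' h']]].
by rewrite (fourier_inner uf vg') (fourier_inner vg uf') (mop_sym hm h h').
Qed.

Lemma pos_op_surj z f : Im z != 0 -> L2 f -> exists u, pos_op m u (fun x => f x + z * u x).
Proof.
move=> z0 Lf; have Ff := fourierP Lf.
have [g h] := mop_surj a0 ai hm z0 (fourier_L2r Ff).
have [Lg _ _ _] := h; have Fg := inv_fourierP Lg.
exists (inv_fourier g), g, (fun p => fourier f p + z * g p); split => //.
exact: fourier_lin.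
Qed.

(** As <u, v> is real, the imaginary part of <u, v - z u> is - Im z |u|^2; Cauchy-Schwarz gives the
    bound. *)
Lemma pos_op_lower z u v : pos_op m u v ->
  `|Im z| * nn u <= nn (fun x => v x - z * u x).
Proof.
move=> h; have [Lu Lv] := pos_op_L2 h.
have im0 : Im (inner u v) = 0.
  have := pos_op_sym h h; rewrite (innerC Lu Lv) => /(congr1 (@complex.Im R)).
  by rewrite cImJ => E; lra.
have [->|u0] := eqVneq (nn u) 0; first by rewrite mulr0 nn_ge0.
have up : 0 < nn u by rewrite lt_neqAle eq_sym u0 nn_ge0.
rewrite -(ler_pM2l up); apply: le_trans (cauchy_schwarz Lu (L2B Lv (L2Z z Lu))).
rewrite innerBr//; last exact: L2Z.
rewrite innerZr// innerff//; apply: le_trans (Im_le_cabs _).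
rewrite cImB im0 cImM /= mulr0 !add0r normrN normrM (ger0_norm (sqr_ge0 _)).
by rewrite mulrCA expr2.
Qed.

Lemma pos_op_dense f (d : R) : L2 f -> 0 < d ->
  exists u v, pos_op m u v /\ nn (fun x => f x - u x) <= d.
Proof.
move=> Lf d0; have Ff := fourierP Lf.
have [g [h [gh fg]]] := mop_dense ma a0 ai hm (fourier_L2r Ff) d0.
have [Lg Lh _ _] := gh; have Fg := inv_fourierP Lg; have Fh := inv_fourierP Lh.
exists (inv_fourier g), (inv_fourier h); split; first by exists g, h.
have /fourier_nn := fourier_lin (-1) Ff Fg.
under eq_fun do rewrite mulN1r; under [in RHS]eq_fun do rewrite mulN1r.
by move=> <-.
Qed.

(** The range criterion: a densely defined symmetric operator A is self-adjoint as soon as A - i and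
    A + i are surjective. *)
Lemma pos_op_self_adjoint : self_adjoint (pos_op m).
Proof.
split=> [f Lf d d0|u v].
  have d2 : 0 < d / 2 by rewrite divr_gt0.
  have [u [v [h uv]]] := pos_op_dense Lf d2; have [Lu Lv] := pos_op_L2 h.
  exists u, v; split => //; rewrite norm2E ?lte_fin; last exact: L2B.
  by rewrite (le_lt_trans uv)// ltr_pdivrMr// ltr_pMr// ltr1n.
split=> [h|[Lu Lv adj]].
  by have [Lu Lv] := pos_op_L2 h; split => // f g h'; exact: pos_op_sym.
have i0 : Im ('i : R[i])%C != 0 by rewrite /= oner_neq0.
have ni0 : Im (- 'i%C : R[i]) != 0 by rewrite /= oppr_eq0 oner_neq0.
have Ld := L2B Lv (L2Z 'i%C Lu).
(* [w] lies in the domain and solves (A - i) w = v - i u, so u - w is orthogonal to the range of A +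
   i. That range contains u - w itself, as the image of the [f] chosen next; hence u = w. *)
have [w hw] := pos_op_surj i0 Ld; have [Lw Lvw] := pos_op_L2 hw.
have Luw := L2B Lu Lw.
have [f hf] := pos_op_surj ni0 Luw; have [Lf Lg] := pos_op_L2 hf.
have e1 := adj _ _ hf; have e2 := pos_op_sym hw hf.
have n0 : nn (fun x => u x - w x) = 0.
  apply/eqP; rewrite -sqrf_eq0; apply/eqP/(@complexI R); rewrite -innerff//.
  have L1 := L2Z (- 'i%C) Lf.
  rewrite (_ : inner _ _ = inner (fun x => u x - w x) (fun x => u x - w x + - 'i%C * f x) -
    inner (fun x => u x - w x) (fun x => - 'i%C * f x)); last by rewrite (innerDr Luw Luw L1) addrK.
  rewrite [X in X - _]innerBl// e1 e2 -innerBl//.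
  rewrite (_ : (fun x => v x - _) = (fun x => 'i%C * (u x - w x))); last first.
    by apply/funext => x; ring.
  by rewrite innerZl// innerZr// (_ : ('i%C)^* = - 'i%C) ?subrr//; apply: complex_eqP; rewrite ?cReJ ?cImJ /= ?oppr0.
have uw : aeR (fun x => w x = u x).
  by apply: (aeR_S (nn_eq0P Luw n0)) => x /subr0_eq ->.
apply: (pos_op_ae hw (L2_meas Lu) (L2_meas Lv) uw).
by apply: (aeR_S uw) => x ->; rewrite subrK.
Qed.

Definition pos_res z f : R -> R[i] :=
  xget (fun=> 0) [set u | pos_op m u (fun x => f x + z * u x)].

Lemma pos_resP z f : Im z != 0 -> L2 f ->
  pos_op m (pos_res z f) (fun x => f x + z * pos_res z f x).
Proof.
move=> z0 Lf; have [u hu] := pos_op_surj z0 Lf.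
exact: (@xgetI _ (fun=> 0) [set u | pos_op m u (fun x => f x + z * u x)] u).
Qed.

Lemma nn_pos_res z f : Im z != 0 -> L2 f -> nn (pos_res z f) <= `|Im z|^-1 * nn f.
Proof.
move=> z0 Lf; have := pos_op_lower z (pos_resP z0 Lf).
under [in leRHS]eq_fun do rewrite addrK.
by move=> h; rewrite ler_pdivlMl ?normr_gt0.
Qed.

Lemma pos_res_is_resolvent z : Im z != 0 -> is_resolvent (pos_op m) z (pos_res z).
Proof.
move=> z0; split.
- by move=> f Lf; have h := pos_resP z0 Lf; split => //; case: (pos_op_L2 h).
- move=> u v h; have [Lu Lv] := pos_op_L2 h.
  have Lf := L2B Lv (L2Z z Lu); have h' := pos_resP z0 Lf.
  apply/aeR_eqP; have h2 := pos_op_lin (-1) h' h.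
  have [Ld _] := pos_op_L2 h2; have := pos_op_lower z h2.
  set T := pos_res _ _.
  rewrite (_ : (fun x => v x - z * u x + z * T x + -1 * v x - z * (T x + -1 * u x)) = (fun=> 0)); last first.
    by apply/funext => x; ring.
  rewrite nn_cst0 => h3.
  have n0 : nn (fun x => pos_res z (fun x => v x - z * u x) x + -1 * u x) = 0.
    apply/eqP; rewrite eq_le nn_ge0 andbT -(ler_pM2l (x := `|Im z|)) ?normr_gt0//.
    by rewrite mulr0.
  apply: (aeR_S (nn_eq0P Ld n0)) => x; rewrite mulN1r; exact: subr0_eq.
- apply: (@le_lt_trans _ _ (`|Im z|^-1)%:E); last exact: ltry.
  apply: ge_ereal_sup => _ [f [Lf f1] <-]; have h := pos_resP z0 Lf.
  rewrite norm2E ?lee_fin; last by case: (pos_op_L2 h).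
  apply: le_trans (nn_pos_res z0 Lf) _; rewrite ler_piMr ?invr_ge0//.
  by move: f1; rewrite norm2E// lee_fin.
Qed.

End fixed_multiplier.

Lemma pos_res_diff m m' C (z : R[i]) l f : hmult m C -> hmult m' C -> 0 < l ->
  (2 * pi)^-1 * (C * wint a l) <= 2^-1 -> Im z != 0 -> L2 f ->
  nn (fun x => pos_res m z f x - pos_res m' z f x) <=
  l^-1 * (2 * cabs (res_k l z)) ^+ 2 * (2 * pi)^-1 *
    Num.sqrt (hsq a l (fun k => m k - m' k)) * nn f.
Proof.
move=> hm hm' l0 sl z0 Lf; have Ff := fourierP Lf.
have H m1 : hmult m1 C -> exists2 g, is_fourier (pos_res m1 z f) g &
    mop a m1 g (fun p => fourier f p + z * g p).
  move=> h1; have h := pos_resP h1 z0 Lf; have [Lu _] := pos_op_L2 h.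
  have Fu := fourierP Lu; exists (fourier (pos_res m1 z f)) => //.
  exact: (pos_op_fourier h1 h Fu (fourier_lin z Ff Fu)).
have [g Fg hg] := H _ hm; have [g' Fg' hg'] := H _ hm'.
have /fourier_nn := fourier_lin (-1) Fg Fg'.
under eq_fun do rewrite mulN1r; under [in RHS]eq_fun do rewrite mulN1r.
move=> <-; rewrite -(fourier_nn Ff).
exact: (res_diff a0 ai hm hm' l0 sl z0 (fourier_L2r Ff) hg hg').
Qed.

(** Some bound for each [e] gives self-adjointness and the resolvents. The common bound [C] below
    [r] allows one [l] to serve for all these operators and dominates the Hilbert-Schmidt
    integrals. *)
Lemma pos_op_cvg (m_ : R -> R -> R[i]) m C (r : R) : 0 < r -> hmult m C ->
  (forall e, 0 < e -> exists C', hmult (m_ e) C') ->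
  (forall e, 0 < e -> e < r -> hmult (m_ e) C) ->
  (forall k, cabs (m_ e k - m k) @[e --> 0^'+] --> 0) ->
  norm_resolvent_cvg (fun e => pos_op (m_ e)) 0^'+ (pos_op m).
Proof.
move=> r0 hm hm1 hm2 c.
have C0 : 0 <= C by have [_ h _] := hm; exact: le_trans (cabs_ge0 _) (h 0).
have ne0 : \forall e \near (0 : R)^'+, 0 < e by exact: nbhs_right_gt.
have ner : \forall e \near (0 : R)^'+, e < r by exact: nbhs_right_lt.
split.
- by apply: filterS ne0 => e /hm1[C']; exact: pos_op_self_adjoint.
- exact: pos_op_self_adjoint hm.
move=> z z0; exists (fun e => pos_res (m_ e) z), (pos_res m z); split.
- by apply: filterS ne0 => e /hm1[C' h]; exact: pos_res_is_resolvent h _ z0.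
- exact: pos_res_is_resolvent hm _ z0.
have [l l0 sl] := good_l a0 ai C0.
pose K := l^-1 * (2 * cabs (res_k l z)) ^+ 2 * (2 * pi)^-1.
have K0 : 0 <= K.
  by rewrite !mulr_ge0 ?exprn_ge0 ?invr_ge0 ?mulr_ge0 ?pi_ge0 ?cabs_ge0 ?(ltW l0).
(* Dominated convergence is a statement on sequences, hence the passage to a sequence [u]; after a
   shift by [N] all its terms lie below [r]. *)
have hc : hsq a l (fun k => m_ e k - m k) @[e --> 0^'+] --> 0.
  apply/cvg_at_rightP => u [u0 uc].
  have [N _ HN] : \forall n \near \oo, u n < r.
    have /cvgrPdist_lt/(_ r r0) := uc; apply: filterS => n.
    by rewrite sub0r normrN; exact: le_lt_trans (ler_norm _).
  rewrite -(cvg_shiftn N); apply: (@hsq_cvg _ _ _ a0 l0 (ai l0) (fun n k => m_ (u (n + N)%N) k - m k) (C + C)).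
  - move=> n; have [mm _ _] := hm2 _ (u0 (n + N)%N) (HN _ (leq_addl _ _)).
    by have [mm' _ _] := hm; exact: cmeasB.
  - move=> n k; have [_ b _] := hm2 _ (u0 (n + N)%N) (HN _ (leq_addl _ _)).
    by have [_ b' _] := hm; rewrite (le_trans (cabsB _ _))// lerD.
  - move=> k; have := c k => /cvg_at_rightP; apply; split; first by move=> n; exact: u0.
    by rewrite cvg_shiftn.
have hs : Num.sqrt (hsq a l (fun k => m_ e k - m k)) @[e --> 0^'+] --> Num.sqrt (0 : R).
  by apply: continuous_cvg; [exact: sqrt_continuous|exact: hc].
have hc2 : K * Num.sqrt (hsq a l (fun k => m_ e k - m k)) @[e --> 0^'+] --> (K * Num.sqrt 0 : R).
  by apply: cvgM => //; exact: cvg_cst.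
rewrite sqrtr0 mulr0 in hc2.
have sq : \forall e \near 0^'+, (0%E <= opnorm (fun f x => pos_res (m_ e) z f x - pos_res m z f x)%R <=
    (K * Num.sqrt (hsq a l (fun k => m_ e k - m k)))%:E)%E.
  near=> e; have e0 : 0 < e by near: e.
  have er : e < r by near: e.
  have he := hm2 e e0 er; apply/andP; split.
    have L0 := @L20 R; have [Lu _] := pos_op_L2 (pos_resP he z0 L0).
    have [Lu' _] := pos_op_L2 (pos_resP hm z0 L0).
    apply: le_trans (ereal_sup_ubound _); last first.
      exists (fun=> 0) => //; split => //; rewrite norm2E// lee_fin.
      by rewrite nn_cst0.
    by rewrite norm2E ?lee_fin ?nn_ge0//; exact: L2B.
  apply: ge_ereal_sup => _ [f [Lf f1] <-].
  have [Lu _] := pos_op_L2 (pos_resP he z0 Lf).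
  have [Lu' _] := pos_op_L2 (pos_resP hm z0 Lf).
  rewrite norm2E ?lee_fin; last exact: L2B.
  apply: le_trans (pos_res_diff he hm l0 sl z0 Lf) _.
  apply: ler_piMr; first exact: mulr_ge0 K0 (sqrtr_ge0 _).
  by move: f1; rewrite norm2E// lee_fin.
have zc : (fun=> 0%E : \bar R) e @[e --> (0 : R)^'+] --> (0%E : \bar R) by exact: cvg_cst.
have hE : (K * Num.sqrt (hsq a l (fun k => m_ e k - m k)))%:E @[e --> 0^'+] --> (0%E : \bar R).
  by apply/fine_cvgP; split; [exact: nearW|exact: hc2].
exact: (squeeze_cvge sq zc hE).
Unshelve. all: by end_near. Qed.

End position_operator.

(** * The form sum *)

Section symbol.
Context {R : realType}.
Implicit Types (s l p x : R).

Definition sym s p : R := `|p| `^ s.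

Lemma sym_ge0 s p : 0 <= sym s p. Proof. exact: powR_ge0. Qed.

Lemma rmeas_sym s : measurable_fun setT (sym s).
Proof. exact: (measurableT_comp (measurable_powR s) (@normr_measurable R setT)). Qed.

Lemma dpowR (f : R -> R) x (f' r : R) : is_derive x (1 : R) f f' -> 0 < f x ->
  is_derive x (1 : R) (fun y => f y `^ r) (f' * (r * f x `^ (r - 1))).
Proof. by move=> df f0; apply: (@dComp R (fun y => y `^ r)) => //; exact: is_derive1_powR. Qed.

Lemma cvgy_ln1Dsqr : ln (1 + x ^+ 2) @[x --> +oo] --> (+oo : set_system R).
Proof.
apply/cvgryPge => A; near=> x.
have xA : expR A <= x by near: x; exact: nbhs_pinfty_ge.
rewrite -[A in A <= _]expRK ler_ln ?posrE ?expR_gt0 ?ltr_wpDr ?sqr_ge0//.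
apply: (le_trans xA); have := sqr_ge0 (x - 2^-1); rewrite sqrrB !expr2 => h; lra.
Unshelve. all: by end_near. Qed.

(** Outside [-1, 1] the comparison is with |p| (1 + p^2)^(-r), r = (s + 1) / 2, which decays like
    |p|^-s but has a primitive that is a power of 1 + p^2, smooth on the whole line. On [-1, 1] the
    bound 1 / l is enough. *)
Lemma rint_sym s l : 1 < s -> 0 < l -> rint (fun p => (sym s p + l)^-1).
Proof.
move=> s1 l0; pose r := (s + 1) / 2; pose N (x : R) := (1 + x ^+ 2) `^ r.
have D0 (x : R) : 0 < 1 + x ^+ 2 by rewrite ltr_wpDr ?sqr_ge0.
have N0 x : 0 < N x by rewrite powR_gt0.
have dD (x : R) : is_derive x (1 : R) (fun x => 1 + x ^+ 2) (2 * x).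
  apply: (dEq (dD (dC 1 x) (dM (dId x) (dId x)))); ring.
pose G (x : R) := - (s - 1)^-1 * (1 + x ^+ 2) `^ (1 - r).
have dG (x : R) : is_derive x (1 : R) G (x / N x).
  apply: (dEq (dZ _ (dpowR (1 - r) (dD x) (D0 x)))).
  rewrite (_ : 1 - r - 1 = - r) ?powRN -?/(N x); last by ring.
  have s0 : s - 1 != 0 by rewrite subr_eq0 gt_eqF.
  move: (N x) (N0 x) => n n0; rewrite /r; field.
  by rewrite s0 gt_eqF.
have cN : continuous N.
  by apply: (@cont_is_derive _ _ (fun x => 2 * x * (r * (1 + x ^+ 2) `^ (r - 1)))) => x; exact: dpowR.
have cf : continuous (fun x => x / N x).
  move=> x; apply: cvgM; first exact: cvg_id.
  by apply: cvgV; [rewrite gt_eqF|exact: cN].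
have cG : G x @[x --> +oo] --> 0.
  rewrite -(mulr0 (- (s - 1)^-1)); apply: cvgM; first exact: cvg_cst.
  have r1 : 0 < r - 1 by rewrite /r; lra.
  have := cvg_comp _ _ cvgy_ln1Dsqr (cvgy_expRN r1); apply: cvg_trans.
  apply: near_eq_cvg; apply: nearW => x; rewrite /= /powR gt_eqF//.
  by congr expR; ring.
have hp x : 0 <= x -> 0 <= x / N x by move=> x0; rewrite divr_ge0// ltW.
have hi := rint_half cf dG hp cG.
have mh : measurable_fun setT (fun p => `|p| / N p).
  apply: measurable_funM; first exact: normr_measurable.
  apply: continuous_measurable_fun => x.
  by apply: cvgV; [rewrite gt_eqF|exact: cN].
have ev p : `|- p| / N (- p) = `|p| / N p by rewrite normrN /N sqrrN.
have [|hr _] := even_split mh ev.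
  apply: eq_integrable hi => // x _; congr EFin; rewrite indicE mem_setE in_itv /= andbT.
  by case: (leP 0 x) => x0; rewrite ?mulr0// ger0_norm.
apply: (rint_le _ (rintD (rintZ l^-1 (rint_box 1)) (rintZ (2 `^ r) hr))) => [|p].
  rewrite (_ : (fun p => _) = (fun p => (sym s p + l) `^ (-1))); last first.
    by apply/funext => p; rewrite powR_inv1// ltW// ltr_wpDl// sym_ge0.
  apply: (measurableT_comp (measurable_powR (-1))).
  by apply: measurable_funD; [exact: rmeas_sym|exact: measurable_cst].
have a0 : 0 < sym s p + l by rewrite ltr_wpDl// sym_ge0.
rewrite ger0_norm ?invr_ge0 ?(ltW a0)//.
have [p1|p1] := leP `|p| 1.
  rewrite /box indicE mem_setE in_itv /= -ler_norml p1 mulr1 ler_wpDr ?mulr_ge0 ?powR_ge0 ?invr_ge0 ?(ltW (N0 _))//.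
  by rewrite lef_pV2 ?posrE// lerDr sym_ge0.
have p0 : 0 < `|p| by rewrite (lt_trans _ p1).
apply: ler_wpDl; first by rewrite mulr_ge0 ?invr_ge0 ?box_ge0// ltW.
have sp : 0 < sym s p by rewrite powR_gt0.
apply: (@le_trans _ _ (sym s p)^-1); first by rewrite lef_pV2 ?posrE// lerDl ltW.
(* For |p| > 1 one has 1 + p^2 <= 2 p^2, and (p^2)^r = |p| |p|^s by the choice of [r]. *)
have NN : N p <= 2 `^ r * (`|p| * sym s p).
  have -> : 2 `^ r * (`|p| * sym s p) = (2 * `|p| ^+ 2) `^ r.
    rewrite powRM ?sqr_ge0//; congr (_ * _); rewrite -powR_mulrn// -powRrM.
    rewrite (_ : 2%:R * r = 1 + s); last by rewrite /r; field.
    by rewrite powRD ?powRr1// (gt_eqF p0) implybT.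
  apply: ge0_ler_powR; rewrite ?nnegrE ?(ltW (D0 _)) ?mulr_ge0 ?sqr_ge0//.
    by rewrite /r; lra.
  by rewrite real_normK ?num_real// mulr2n mulrDl mul1r lerD2r -real_normK ?num_real// expr_ge1// ltW.
rewrite mulrA ler_pdivlMr// mulrC ler_pdivrMr//.
by apply: le_trans NN _; rewrite mulrA.
Qed.

End symbol.

(** * Sobolev spaces in terms of the homogeneous symbol *)

Section sobolev.
Context {R : realType}.
Implicit Types (s l p r : R) (u v f g : R -> R[i]) (V : R -> R).

Lemma sym_half s p : 0 < s -> sym (s / 2) p * sym (s / 2) p = sym s p.
Proof.
move=> s0; rewrite /sym -powRD; first by congr powR; field.
by rewrite -splitr (gt_eqF s0).
Qed.

Lemma japanese_ge r p : 0 <= r -> sym r p <= (1 + p ^+ 2) `^ (r / 2).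
Proof.
move=> r0; rewrite /sym -[X in _ `^ X](_ : 2%:R * (r / 2) = r); last by field.
rewrite powRrM powR_mulrn// real_normK ?num_real//.
apply: ge0_ler_powR; rewrite ?nnegrE ?divr_ge0 ?addr_ge0 ?sqr_ge0//.
by rewrite lerDr.
Qed.

(** With [japanese_ge], this makes the weight of [sobolev] interchangeable with |p|^r on functions
    that are already in L^2. *)
Lemma japanese_le r p : 0 <= r -> (1 + p ^+ 2) `^ (r / 2) <= 2 `^ (r / 2) * (1 + sym r p).
Proof.
move=> r0; have r2 : 0 <= r / 2 by rewrite divr_ge0.
have [p1|p1] := leP `|p| 1.
  apply: (@le_trans _ _ (2 `^ (r / 2))); last by rewrite ler_peMr ?powR_ge0// lerDl sym_ge0.
  apply: ge0_ler_powR; rewrite ?nnegrE ?addr_ge0 ?sqr_ge0//.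
  by rewrite mulr2n lerD2l -real_normK ?num_real// expr_le1.
have -> : 2 `^ (r / 2) * (1 + sym r p) = 2 `^ (r / 2) + (2 * p ^+ 2) `^ (r / 2).
  rewrite mulrDr mulr1 powRM ?sqr_ge0//; congr (_ + _ * _).
  have -> : p ^+ 2 = `|p| `^ 2%:R by rewrite powR_mulrn// real_normK// num_real.
  by rewrite -powRrM /sym; congr powR; field.
have p2 := sqr_ge0 p; apply: ler_wpDl; first exact: powR_ge0.
apply: ge0_ler_powR; rewrite ?nnegrE ?(addr_ge0 ler01 p2) ?(mulr_ge0 (ler0n _ 2) p2)//.
by rewrite mulr2n mulrDl mul1r lerD2r -real_normK ?num_real// expr_ge1// ltW.
Qed.

Lemma rmeas_japanese r : measurable_fun setT (fun p : R => (1 + p ^+ 2) `^ r).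
Proof.
apply: (measurableT_comp (measurable_powR r)); apply: measurable_funD; first exact: measurable_cst.
exact: measurable_funX.
Qed.

Lemma cmeas_symM r f : cmeas f -> cmeas (fun p => (sym r p)%:C * f p).
Proof. by move=> mf; apply: cmeasM => //; apply: cmeasR; exact: rmeas_sym. Qed.

Lemma cabs_nnR (x : R) : 0 <= x -> cabs x%:C = x.
Proof. by move=> x0; rewrite cabsR ger0_norm. Qed.

Lemma sobolevP r u f : 0 <= r -> is_fourier u f ->
  sobolev r u <-> L2 (fun p => (sym r p)%:C * f p).
Proof.
move=> r0 uf; have [Lu Lf] := (fourier_L2l uf, fourier_L2r uf).
have Fu := fourierP Lu; have Lfu := fourier_L2r Fu; have e := fourier_unique Fu uf.
split=> [[_ h]|h].
  have h1 : L2 (fun p => (sym r p)%:C * fourier u p).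
    apply: (L2_le (C := 1) _ h); first by apply: cmeas_symM; exact: L2_meas.
    move=> p; rewrite mul1r !cabsM !cabs_nnR ?powR_ge0 ?sym_ge0//.
    by rewrite ler_wpM2r ?cabs_ge0// japanese_ge.
  apply: (L2_ae h1); first by apply: cmeas_symM; exact: L2_meas.
  by apply: (aeR_S e) => p ->.
split => //; pose g p := f p + (sym r p)%:C * f p.
have mj f' : cmeas f' -> cmeas (fun p : R => ((1 + p ^+ 2) `^ (r / 2))%:C * f' p).
  by move=> mf; apply: cmeasM => //; apply: cmeasR; exact: rmeas_japanese.
have h1 : L2 (fun p : R => ((1 + p ^+ 2) `^ (r / 2))%:C * f p).
  apply: (L2_le (C := 2 `^ (r / 2)) _ (L2D Lf h)); first exact: mj (L2_meas Lf).
  move=> p; rewrite -[X in _ <= _ * cabs (X + _)]mul1r -mulrDl !cabsM.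
  rewrite -[X in cabs (X + _)](rmorph1 (real_complex R)) -rmorphD /= !cabs_nnR ?addr_ge0 ?powR_ge0 ?sym_ge0//.
  by rewrite mulrA ler_wpM2r ?cabs_ge0// japanese_le.
apply: (L2_ae h1); first exact: mj (L2_meas Lfu).
by apply: (aeR_S e) => p ->.
Qed.

(* Cauchy-Schwarz with the square integrable weight [(1 + |p|^s)^(-1/2)]. *)
Lemma cint_sobolev s f : 1 < s -> L2 f -> L2 (fun p => (sym (s / 2) p)%:C * f p) -> cint f.
Proof.
move=> s1 Lf Lsf; have s0 : 0 < s by apply: lt_trans s1.
pose w p := wt (sym s) 1 p.
have Lw : L2 (fun p => (w p)%:C) := L2_wt (sym_ge0 s) ltr01 (rint_sym s1 ltr01).
apply: (@cint_le _ _ (fun p => cabs (((w p)%:C) * (f p + (sym (s / 2) p)%:C * f p)))).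
- exact: L2_meas.
- exact: (L2_mul Lw (L2D Lf Lsf)).2.
move=> p; rewrite -[X in cabs (_ * (X + _))]mul1r -mulrDl mulrA cabsM ler_peMl ?cabs_ge0//.
rewrite -[X in cabs (_ * (X + _))](rmorph1 (real_complex R)) -rmorphD -rmorphM /= cabs_nnR; last first.
  by rewrite mulr_ge0 ?sqrtr_ge0// addr_ge0// sym_ge0.
rewrite -[leLHS]sqrtr1 -[X in _ * X]ger0_norm ?addr_ge0 ?sym_ge0// -sqrtr_sqr /w /wt -sqrtrM; last first.
  by rewrite invr_ge0 addr_ge0// sym_ge0.
rewrite ler_sqrt; last by rewrite mulr_ge0 ?sqr_ge0// invr_ge0 addr_ge0// sym_ge0.
rewrite mulrC ler_pdivlMr; last by rewrite ltr_wpDl// sym_ge0.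
rewrite mul1r sqrrD expr1n -(sym_half p s0) -expr2 addrC lerD2r lerDl mul1r.
by rewrite mulrn_wge0// sym_ge0.
Qed.

End sobolev.

Section form_sum.
Context {R : realType}.
Local Notation mu := (@lebesgue_measure R).
Local Notation mR := (measurableTypeR R).
Implicit Types (s l p r : R) (u v w f g h : R -> R[i]) (V : R -> R).

(** Without the factor [c0], so that the value at 0 is the integral of [V]. *)
Definition vhat V (k : R) : R[i] := J (fun y => cexpi (- (k * y)) * (V y)%:C).

Lemma hmult_vhat V : rint V -> hmult (vhat V) (\int[mu]_x `|V x|).
Proof.
move=> Vi; have ci := cintR Vi; split.
- exact: (cmeas_J_kernel cmeas_kexp ci.1).
- move=> k; apply: le_trans (cabs_J (cint_cexpiN k ci)) _.
  by under eq_int do rewrite cabsM cabs_cexpi mul1r cabsR.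
move=> k; rewrite /vhat -JJ; last exact: cint_cexpiN.
by apply: eq_J => y; rewrite cJM cexpiJ cJR mulNr.
Qed.

Lemma E1E f x : cint f -> E1 f x = c0%:C * J (fun p => cexpi (x * p) * f p).
Proof.
move=> fi; rewrite /E1 /F1 cJM cJR -JJ; last by apply: cint_cexpiN; exact: cintJ.
by congr (_ * _); apply: eq_J => p; rewrite cJM cexpiJ opprK cJK.
Qed.

Lemma cmeas_E1 f : cmeas f -> cmeas (E1 f).
Proof. by move=> mf; apply: cmeasJ; apply: cmeas_F1; exact: cmeasJ. Qed.

Lemma E1_bdd f x : cint f -> cabs (E1 f x) <= c0 * \int[mu]_p cabs (f p).
Proof.
move=> fi; rewrite cabsJ; apply: le_trans (F1_bdd x (cintJ fi)) _.
by under eq_int do rewrite cabsJ.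
Qed.

Lemma cint_potential V f : rint V -> cint f -> cint (fun x => E1 f x * (V x)%:C).
Proof.
move=> Vi fi; apply: (cint_bddM (cintR Vi) (cmeas_E1 fi.1)) => x; exact: E1_bdd.
Qed.

(** After one exchange of integrals the phases combine into exp(-i (p - q) x), and the two factors
    [c0] make up the 1 / (2 pi) of [cconv]. *)
Lemma F1_potential V f p : rint V -> cint f ->
  F1 (fun x => E1 f x * (V x)%:C) p = cconv (vhat V) f p.
Proof.
move=> Vi fi; have ci := cintR Vi; have cip := cint_cexpiN p ci.
have mk : cmeas (fun z : mR * mR => cexpi (z.1 * z.2)).
  apply: cmeas_cexpi; apply: measurable_funM; first exact: measurable_fst.
  exact: measurable_snd.
have k1 (z : mR * mR) : cabs (cexpi (z.1 * z.2)) <= 1 :> R by rewrite cabs_cexpi.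
have := @J_fubini_bdd R _ _ (fun z => cexpi (z.1 * z.2)) 1 cip fi mk k1.
rewrite /= => E.
transitivity (c0%:C * (c0%:C * J (fun x => cexpi (- (p * x)) * (V x)%:C * J (fun y => cexpi (x * y) * f y)))).
  rewrite /F1; congr (_ * _); rewrite -(JZ c0%:C).
    by apply: eq_J => x; rewrite (E1E x fi); move: (J _) (cexpi _) => j e; ring.
  have := cint_cexpiN p (cint_potential Vi fi).
  have c0' : c0%:C != 0 :> R[i] by rewrite -(rmorph0 (real_complex R)) (inj_eq (@complexI R)) gt_eqF ?c0_gt0.
  move=> /(cintZ (c0%:C)^-1); congr cint; apply/funext => x; rewrite (E1E x fi).
  move: (J _) (cexpi _) => j e; field; exact: c0'.
rewrite E mulrA -rmorphM /= -expr2 sqr_c0 /cconv; congr (_ * _); apply: eq_J => q.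
rewrite [RHS]mulrC; congr (_ * _); apply: eq_J => x.
by rewrite mulrA -cexpiD; congr (cexpi _ * _); ring.
Qed.

(** An integrable transform makes [u] bounded, being almost everywhere [E1 f]; thus V |u|^2 is
    integrable for [V] merely in L^1, and the form domain reduces to H^(s/2). The pairing is the
    multiplication formula followed by [F1_potential]. *)
Lemma J_potential V u v f g : rint V -> is_fourier u f -> is_fourier v g -> cint f -> cint g ->
  rint (fun x => V x * cabs (u x) ^+ 2) /\
  J (fun x => (V x)%:C * ((v x)^* * u x)) = J (fun p => (g p)^* * cconv (vhat V) f p).
Proof.
move=> Vi uf vg fi gi; have eu := inv_fourier_L1 uf fi; have ev := inv_fourier_L1 vg gi.
have [Lu Lv] := (fourier_L2l uf, fourier_L2l vg).
have mV := rint_meas Vi; have mEf := cmeas_E1 fi.1; have mEg := cmeas_E1 gi.1.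
split.
  have h : rint (fun x => V x * cabs (E1 f x) ^+ 2).
    pose M := (c0 * \int[mu]_p cabs (f p)) ^+ 2.
    apply: (rint_le _ (rintZ M (rint_norm Vi))) => [|x].
      by apply: measurable_funM => //; apply: measurable_funX; exact: cmeas_cabs.
    rewrite normrM mulrC ler_wpM2r// ger0_norm ?sqr_ge0// lerXn2r ?nnegrE ?cabs_ge0//.
      by apply: le_trans (E1_bdd x fi); exact: cabs_ge0.
    exact: E1_bdd.
  apply: (rint_ae h); last by apply: (aeR_S eu) => x ->.
  by apply: measurable_funM => //; apply: measurable_funX; apply: cmeas_cabs; exact: L2_meas.
rewrite (@J_ae _ _ (fun x => F1 (fun p => (g p)^*) x * (E1 f x * (V x)%:C))).
- rewrite (F1_mult (cintJ gi) (cint_potential Vi fi)); apply: eq_J => p.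
  by rewrite F1_potential.
- apply: cmeasM; first exact: cmeasR.
  by apply: cmeasM; [apply: cmeasJ|]; exact: L2_meas.
- apply: cmeasM; first by apply: cmeas_F1; exact: cmeasJ gi.1.
  by apply: cmeasM => //; exact: cmeasR.
apply: (aeR_S2 eu ev) => x -> ->.
have -> : (E1 g x)^* = F1 (fun p => (g p)^*) x by rewrite /E1 cJK.
by move: (F1 _ x) (E1 f x) => a b; ring.
Qed.

Lemma cint_fourier s u f : 1 < s -> is_fourier u f -> sobolev (s / 2) u -> cint f.
Proof.
move=> s1 uf us; apply: (cint_sobolev s1 (fourier_L2r uf)).
by apply/(sobolevP _ uf) => //; rewrite divr_ge0// ltW// (lt_trans _ s1).
Qed.

Lemma form_domainP s V u f : 1 < s -> rint V -> is_fourier u f ->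
  form_domain s V u <-> L2 (fun p => (sym (s / 2) p)%:C * f p).
Proof.
move=> s1 Vi uf; have s2 : 0 <= s / 2 by rewrite divr_ge0// ltW// (lt_trans _ s1).
split=> [[us _]|h]; first exact/(sobolevP s2 uf).
have us : sobolev (s / 2) u by exact/(sobolevP s2 uf).
split => //; have fi := cint_fourier s1 uf us.
exact: (J_potential Vi uf uf fi fi).1.
Qed.

Lemma formE s V u v f g : 1 < s -> rint V -> is_fourier u f -> is_fourier v g ->
  form_domain s V u -> form_domain s V v ->
  Defs.form s V v u = J (fun p => (g p)^* * ((sym s p)%:C * f p)) +
                 J (fun p => (g p)^* * cconv (vhat V) f p).
Proof.
move=> s1 Vi uf vg du dv; have s0 : 0 < s by rewrite (lt_trans _ s1).
have fi := cint_fourier s1 uf du.1; have gi := cint_fourier s1 vg dv.1.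
rewrite /Defs.form -/(J _) (J_potential Vi uf vg fi gi).2; congr (_ + _).
have [Lu Lv] := (fourier_L2l uf, fourier_L2l vg).
have [Fu Fv] := (fourierP Lu, fourierP Lv).
have H w h : is_fourier w h -> form_domain s V w ->
    L2 (fun p => (sym (s / 2) p)%:C * h p) by move=> wh; exact: (form_domainP s1 Vi wh).1.
rewrite (@inner_ae _ _ (fun p => (sym (s / 2) p)%:C * g p) _ (fun p => (sym (s / 2) p)%:C * f p)).
- rewrite innerE; apply: eq_J => p; rewrite cJM cJR -(sym_half p s0) rmorphM /=; ring.
- exact: H dv.
- exact: H dv.
- exact: H du.
- exact: H du.
- by apply: (aeR_S (fourier_unique Fv vg)) => p ->.
- by apply: (aeR_S (fourier_unique Fu uf)) => p ->.
Qed.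

(** From the form to the operator, the residual of the equation is tested against its own
    truncations. Conversely |p|^s |f|^2 = conj f (h - K f) almost everywhere, and the right side is
    integrable, so [u] lies in the form domain. *)
Lemma form_sumE s V : 1 < s -> rint V -> form_sum s V = pos_op (sym s) (vhat V).
Proof.
move=> s1 Vi; have s0 : 0 < s by rewrite (lt_trans _ s1).
have hm := hmult_vhat Vi; have [mm mC _] := hm.
apply/funext => u; apply/funext => w; apply/propext; split.
  move=> [du Lw hu]; have Lu : L2 u by case: du => -[].
  have uf := fourierP Lu; have wh := fourierP Lw.
  set f := fourier u in uf; set h := fourier w in wh.
  have [Lf Lh] := (fourier_L2r uf, fourier_L2r wh).
  have fi := cint_fourier s1 uf du.1.
  have Lbf := (form_domainP s1 Vi uf).1 du.
  exists f, h; split => //; split => //.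
  have mcv := cmeas_conv mm fi.1.
  pose d p := (sym s p)%:C * f p + cconv (vhat V) f p - h p.
  have mb : cmeas (fun p => (sym s p)%:C * f p) by apply: cmeas_symM; exact: L2_meas.
  have md : cmeas d by apply: cmeasB; [apply: cmeasD|exact: L2_meas].
  pose S n := [set p | cabs (d p) <= n%:R].
  have mS n : measurable (S n).
    have := cmeas_cabs md measurableT (measurable_itv `]-oo, n%:R]); rewrite setTI.
    by congr measurable; apply/seteqP; split => x /=; rewrite in_itv.
  (* The residual cut off in value and in frequency: bounded and of bounded support, it is the
     transform of an element of the form domain. As conj (g n) d = |g n|^2, testing with it shows
     that [g n] vanishes almost everywhere. *)
  pose g n p := d p * (\1_(S n) p)%:C * (box n p)%:C.
  have gb n p : cabs (d p * (\1_(S n) p)%:C) <= n%:R.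
    rewrite indicE; case: (boolP (p \in S n)) => [/set_mem|_]; first by rewrite mulr1.
    by rewrite mulr0 cabs0.
  have mg n : cmeas (fun p => d p * (\1_(S n) p)%:C) by exact: cmeas_indic.
  have gi n : cint (g n) by exact: cint_box (gb n).
  have gbn n p : cabs (g n p) <= n%:R.
    rewrite /g (@cabs_box _ (fun p => d p * (\1_(S n) p)%:C)) (le_trans _ (gb n p))//.
    by rewrite ler_piMr ?cabs_ge0//; case: (box01 n p) => ->.
  have Lg n : L2 (g n) := L2_bdd_cint (gi n) (gbn n).
  have Lbg n : L2 (fun p => (sym (s / 2) p)%:C * g n p).
    apply: (L2_le (C := n%:R `^ (s / 2)) _ (Lg n)); first by apply: cmeas_symM; exact: L2_meas.
    move=> p; case: (box01 n p) => bp.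
      by rewrite /g bp !mulr0 cabs0 mulr_ge0 ?powR_ge0 ?cabs_ge0.
    rewrite cabsM ler_wpM2r ?cabs_ge0// cabs_nnR ?sym_ge0//.
    apply: ge0_ler_powR; rewrite ?nnegrE ?divr_ge0 ?(ltW s0)//.
    by rewrite ler_norml; exact: box_int.
  have z n : aeR (fun p => g n p = 0).
    have vg := inv_fourierP (Lg n); set v := inv_fourier (g n) in vg.
    have dv : form_domain s V v by exact/(form_domainP s1 Vi vg).
    have := hu v dv; rewrite (formE s1 Vi uf vg du dv) (fourier_inner vg wh) innerE => E.
    have i1 : cint (fun p => (g n p)^* * ((sym s p)%:C * f p)).
      have := L2_ip (Lbg n) Lbf; congr cint; apply/funext => p.
      by rewrite cJM cJR -(sym_half p s0) rmorphM /=; ring.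
    have i2 : cint (fun p => (g n p)^* * cconv (vhat V) f p).
      under eq_fun do rewrite mulrC.
      apply: (cint_bddM (cintJ (gi n)) mcv) => p; exact: (conv_bdd p hm fi).
    have i3 := L2_ip (Lg n) Lh.
    have : J (fun p => ((cabs (g n p) ^+ 2)%:C : R[i])) = 0.
      transitivity (J (fun p => (g n p)^* * ((sym s p)%:C * f p) + (g n p)^* * cconv (vhat V) f p - (g n p)^* * h p)).
        apply: eq_J => p; rewrite -mulrDr -mulrBr -/(d p) -mulJc /g.
        rewrite indicE; case: (box01 n p) => ->; case: (_ \in _); by rewrite ?(mulr1, mulr0)// rmorph0 !mul0r.
      by rewrite (JB (cintD i1 i2) i3) (JD i1 i2) E subrr.
    rewrite J_real; last exact: L2_sq.
    move=> /complexI E0; have := int_eq0_ae (L2_sq (Lg n)) (fun p => sqr_ge0 _) E0.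
    by move=> H; apply: (aeR_S H) => p; exact: cabs_exp2_eq0.
  apply: (aeR_S (aeR_all z)) => p zp.
  have : d p = 0.
    have [N _ HN] : \forall n \near \oo, g n p = d p.
      near=> n; rewrite /g /box !indicE !mem_set ?mulr1//=.
        rewrite in_itv /= -ler_norml; near: n; exact: nbhs_infty_ger.
      by near: n; exact: nbhs_infty_ger.
    by rewrite -(HN N (leqnn N)).
  by rewrite /d => /subr0_eq.
move=> [f [h [uf wh [Lf Lh fi e]]]]; have [Lu Lw] := (fourier_L2l uf, fourier_L2l wh).
have mcv := cmeas_conv mm fi.1.
have Kb p := conv_bdd p hm fi.
have icv g : cint g -> cint (fun p => (g p)^* * cconv (vhat V) f p).
  move=> gi; under eq_fun do rewrite mulrC.
  by apply: (cint_bddM (cintJ gi) mcv) => p; exact: (conv_bdd p hm fi).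
have Lbf : L2 (fun p => (sym (s / 2) p)%:C * f p).
  apply/L2P; split; first by apply: cmeas_symM; exact: L2_meas.
  have i : cint (fun p => (f p)^* * h p - (f p)^* * cconv (vhat V) f p).
    by apply: cintB; [exact: L2_ip|exact: icv].
  apply: (rint_ae i.2).
    by apply: measurable_funX; apply: cmeas_cabs; apply: cmeas_symM; exact: L2_meas.
  apply: (aeR_S e) => p ->; rewrite -mulrBr addrK mulrCA mulJc -rmorphM /= (cabs_nnR (mulr_ge0 (sym_ge0 _ _) (sqr_ge0 _))).
  by rewrite cabsM exprMn cabs_nnR ?sym_ge0// -(sym_half p s0) expr2.
have du : form_domain s V u by exact/(form_domainP s1 Vi uf).
split => // v dv; have Lv : L2 v by case: dv => -[].
have vg := fourierP Lv; have gi := cint_fourier s1 vg dv.1.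
have Lbg := (form_domainP s1 Vi vg).1 dv.
rewrite (formE s1 Vi uf vg du dv) (fourier_inner vg wh) innerE -JD; last 2 first.
- have := L2_ip Lbg Lbf; congr cint; apply/funext => p.
  by rewrite cJM cJR -(sym_half p s0) rmorphM /=; ring.
- exact: icv.
have Lg := fourier_L2r vg.
apply: J_ae.
- apply: cmeasD; last by have := icv _ gi; case.
  by apply: cmeasM; [apply: cmeasJ|apply: cmeas_symM]; exact: L2_meas.
- by apply: cmeasM; [apply: cmeasJ|]; exact: L2_meas.
by apply: (aeR_S e) => p ->; rewrite mulrDr.
Unshelve. all: by end_near. Qed.

End form_sum.

(** * The point interaction *)

Section continuity.
Context {R : realType}.
Local Notation mu := (@lebesgue_measure R).
Implicit Types (x t : R) (f g : R -> R[i]) (P : R -> Prop).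

Lemma cexpi_cvg (u : nat -> R) t : u n @[n --> \oo] --> t ->
  cabs (cexpi (u n) - cexpi t) @[n --> \oo] --> 0.
Proof.
move=> ut; have hc : cos (u n) @[n --> \oo] --> cos t by apply: continuous_cvg => //; exact: continuous_cos.
have hs : sin (u n) @[n --> \oo] --> sin t by apply: continuous_cvg => //; exact: continuous_sin.
have h : (`|cos (u n) - cos t| + `|sin (u n) - sin t|) @[n --> \oo] --> (0 : R).
  rewrite -[0]addr0; apply: cvgD; apply/norm_cvg0P; exact/subr_cvg0.
apply: (cvg0_squeeze _ h) => n; rewrite cabs_ge0 /=.
by apply: le_trans (cabs_le _) _; rewrite cReB cImB.
Qed.

Lemma J_cexpi_cvg f (u : nat -> R) t : cint f -> u n @[n --> \oo] --> t ->
  cabs (J (fun p => cexpi (u n * p) * f p) - J (fun p => cexpi (t * p) * f p))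
    @[n --> \oo] --> 0.
Proof.
move=> fi ut; apply: (@J_dct _ _ _ (fun p => cabs (f p))).
- by move=> n; exact: (cint_cexpi (u n) fi).1.
- exact: (cint_cexpi t fi).1.
- exact: fi.2.
- apply: aeR_W => p; have h : u n * p @[n --> \oo] --> t * p by apply: cvgM => //; exact: cvg_cst.
  have h2 : cabs (cexpi (u n * p) - cexpi (t * p)) * cabs (f p) @[n --> \oo] --> 0 * cabs (f p).
    by apply: cvgM; [exact: cexpi_cvg|exact: cvg_cst].
  rewrite mul0r in h2; apply: (cvg0_squeeze _ h2) => n.
  by rewrite cabs_ge0 /= -mulrBl cabsM.
- by move=> n p; rewrite cabsM cabs_cexpi mul1r.
- by apply: aeR_W => p; rewrite cabsM cabs_cexpi mul1r.
Qed.

Lemma E1_cvg f (u : nat -> R) t : cint f -> u n @[n --> \oo] --> t ->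
  cabs (E1 f (u n) - E1 f t) @[n --> \oo] --> 0.
Proof.
move=> fi ut; have h := J_cexpi_cvg fi ut.
have h2 : c0 * cabs (J (fun p => cexpi (u n * p) * f p) - J (fun p => cexpi (t * p) * f p))
   @[n --> \oo] --> c0 * 0 by apply: cvgM => //; exact: cvg_cst.
rewrite mulr0 in h2; apply: (cvg0_squeeze _ h2) => n; rewrite cabs_ge0 /=.
by rewrite (E1E _ fi) (E1E t fi) -mulrBr cabsM cabs_c0.
Qed.

Lemma E1_cont f : cint f ->
  continuous (fun x => Re (E1 f x)) /\ continuous (fun x => Im (E1 f x)).
Proof.
move=> fi; split=> x; apply/(@cvg_nbhsP _ R^o) => u ux; apply/subr_cvg0/norm_cvg0P;
  apply: (cvg0_squeeze _ (E1_cvg fi ux)) => n; rewrite normr_ge0 andTb.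
  by rewrite -cReB; exact: Re_le_cabs.
by rewrite -cImB; exact: Im_le_cabs.
Qed.

(** The exceptional null set cannot contain the interval ]0, d[, which has positive length. *)
Lemma aeR_near0 P : aeR P -> forall d : R, 0 < d -> exists2 x, `|x| < d & P x.
Proof.
move=> [B [mB B0 PB]] d d0; apply: contrapT => h.
have sub : `]0, d[%classic `<=` B.
  move=> x /=; rewrite in_itv /= => /andP[x0 xd]; apply: PB => /= Px; apply: h.
  by exists x => //; rewrite ger0_norm// ltW.
have : (mu `]0%R, d[%classic <= mu B)%E.
  by apply: le_measure => //; rewrite inE; [exact: measurable_itv|exact: mB].
rewrite [X in (_ <= X)%E -> _]B0.
by rewrite lebesgue_measure_itv /= lte_fin d0 sube0 lee_fin leNgt d0.
Qed.

(** Used to compute the value [F 0] of whichever continuous representative occurs in [k_op] by means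
    of [E1]. *)
Lemma cont_ae_eq0 f g :
  continuous (fun x => Re (f x)) -> continuous (fun x => Im (f x)) ->
  continuous (fun x => Re (g x)) -> continuous (fun x => Im (g x)) ->
  aeR (fun x => f x = g x) -> f 0 = g 0.
Proof.
move=> fr fi gr gi fg.
have /choice[u hu] : forall n : nat, exists x, `|x| < n.+1%:R^-1 /\ f x = g x.
  by move=> n; have [x ? ?] := aeR_near0 fg (d := n.+1%:R^-1) ltac:(by rewrite invr_gt0); exists x.
have u0 : u n @[n --> \oo] --> (0 : R).
  apply/norm_cvg0P; apply: (@cvg0_squeeze _ _ (fun n => n.+1%:R^-1)); last exact: cvg_harmonic.
  by move=> n; rewrite normr_ge0 ltW//; case: (hu n).
have H (a b : R -> R) : continuous a -> continuous b -> (forall n, a (u n) = b (u n)) -> a 0 = b 0.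
  move=> ca cb ab; have h1 : a (u n) @[n --> \oo] --> a 0 by apply: continuous_cvg => //; exact: ca.
  have h2 : b (u n) @[n --> \oo] --> b 0 by apply: continuous_cvg => //; exact: cb.
  rewrite (_ : (fun n => b (u n)) = (fun n => a (u n))) in h2; last by apply/funext => n; rewrite ab.
  exact: (@cvg_unique _ (@norm_hausdorff _ R) _ _ _ _ h1 h2).
apply: complex_eqP.
  by apply: H fr gr _ => n; case: (hu n) => _ ->.
by apply: H fi gi _ => n; case: (hu n) => _ ->.
Qed.

End continuity.

(** * The operators k_alpha as constant multipliers in momentum space *)

Section point_interaction.
Context {R : realType}.
Implicit Types (u v w f g h : R -> R[i]).
Variables (s l : R).
Hypotheses (s1 : 1 < s) (l0 : 0 < l).

Let s0 : 0 < s. Proof. exact: lt_trans s1. Qed.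
Let ai := rint_sym s1 l0.

Lemma frac_lapP u w f h : is_fourier u f -> is_fourier w h ->
  frac_lap s u w <-> aeR (fun p => h p = (sym s p)%:C * f p).
Proof.
move=> uf wh; have [Lu Lw] := (fourier_L2l uf, fourier_L2l wh).
have [Fu Fw] := (fourierP Lu, fourierP Lw).
have [eu ew] := (fourier_unique Fu uf, fourier_unique Fw wh).
split=> [[_ _ /aeR_eqP e]|e].
  by apply: (aeR_S2 (aeR_I eu ew) e) => p [-> ->].
split => //.
  apply/(sobolevP (ltW s0) uf); apply: (L2_ae (fourier_L2r wh) _ e).
  by apply: cmeas_symM; exact: L2_meas (fourier_L2r uf).
by apply/aeR_eqP; apply: (aeR_S2 (aeR_I eu ew) e) => p [-> ->].
Qed.

Lemma cint_sobolev1 f : L2 f -> L2 (fun p => (sym s p)%:C * f p) -> cint f.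
Proof.
move=> Lf Lsf; apply: (cint_sobolev s1 Lf).
apply: (L2_le (C := 1) _ (L2D Lf Lsf)); first by apply: cmeas_symM; exact: L2_meas.
move=> p; rewrite mul1r -[X in _ <= cabs (X + _)]mul1r -mulrDl !cabsM ler_wpM2r ?cabs_ge0//.
rewrite -[X in cabs (X + _)](rmorph1 (real_complex R)) -rmorphD /= !cabs_nnR ?addr_ge0 ?sym_ge0//.
rewrite -(sym_half p s0); have := sqr_ge0 (sym (s / 2) p - 1); rewrite sqrrB expr2 expr1n.
by have := sym_ge0 (s / 2) p; move: (sym _ _) => x x0; lra.
Qed.

Lemma conv_cst (c : R[i]) f p : cint f ->
  cconv (fun=> c) f p = ((2 * pi)^-1)%:C * (c * J f).
Proof. by move=> fi; rewrite /cconv JZ. Qed.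

Lemma k_op_noneE : k_op s l None = pos_op (sym s) (fun=> 0).
Proof.
apply/funext => u; apply/funext => w; apply/propext; rewrite /k_op; split=> [h|].
  have [[Lu _] Lw _] := h; have [uf wh] := (fourierP Lu, fourierP Lw).
  have e := (frac_lapP uf wh).1 h.
  have fi : cint (fourier u).
    apply: cint_sobolev1; first exact: fourier_L2r uf.
    by apply/(sobolevP (ltW s0) uf); case: h.
  exists (fourier u), (fourier w); split => //; split => //.
  - exact: fourier_L2r uf.
  - exact: fourier_L2r wh.
  by apply: (aeR_S e) => p ->; rewrite (conv_cst _ _ fi) mul0r mulr0 addr0.
move=> [f [g [uf wg [Lf Lg fi e]]]]; apply/(frac_lapP uf wg).
by apply: (aeR_S e) => p ->; rewrite (conv_cst _ _ fi) mul0r mulr0 addr0.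
Qed.

(** The transform of the Green function: multiplication by |p|^s + l turns it into the constant
    [c0], the transform of the delta function. *)
Definition omega (p : R) : R[i] := (c0 * (sym s p + l)^-1)%:C.

Lemma cint_omega : cint omega.
Proof. by apply: cintR; exact: rintZ. Qed.

(** By the inversion formula this is the value at 0 of the Green function, which [Theta_int]
    identifies with [Theta s l]. *)
Lemma J_omega : c0%:C * J omega = ((2 * pi)^-1 * wint (sym s) l)%:C.
Proof.
rewrite J_real; last exact: rintZ.
by rewrite intZ// -rmorphM /= mulrA -expr2 sqr_c0.
Qed.

Lemma L2_omega : L2 omega.
Proof.
apply: (L2_bdd_cint (M := c0 * l^-1) cint_omega) => p.
have a0 : 0 < sym s p + l by rewrite ltr_wpDl ?sym_ge0.
rewrite cabs_nnR ?mulr_ge0 ?invr_ge0 ?(ltW a0) ?(ltW c0_gt0)//.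
by rewrite ler_wpM2l ?(ltW c0_gt0)// lef_pV2 ?posrE// lerDr sym_ge0.
Qed.

Lemma green_fourier : is_fourier (green s l) omega.
Proof. exact: inv_fourierP L2_omega. Qed.

Lemma omegaE p : ((sym s p)%:C + l%:C) * omega p = c0%:C.
Proof.
rewrite -rmorphD -rmorphM /= mulrCA mulfV ?mulr1// gt_eqF//.
by rewrite ltr_wpDl ?sym_ge0.
Qed.

(** Write c = F(0) / (al - Theta). As the Green function equals Theta at 0, g(0) = F(0) + c Theta =
    c al, so c = g(0) / al. In momentum space h is |p|^s g - c c0, and since g(0) is [c0] times the
    integral of the transform of g, the constant - c c0 is convolution with -1 / al. *)
Lemma k_op_someE al : (2 * pi)^-1 * wint (sym s) l = Theta s l -> al != 0 -> al != Theta s l ->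
  k_op s l (Some al) = pos_op (sym s) (fun=> (- al^-1)%:C).
Proof.
move=> HT al0 alT; rewrite -HT in alT *.
have alC : al%:C != 0 :> R[i] by rewrite -(rmorph0 (real_complex R)) (inj_eq (@complexI R)).
have dC : (al - Theta s l)%:C != 0 :> R[i].
  by rewrite -HT -(rmorph0 (real_complex R)) (inj_eq (@complexI R)) subr_eq0.
have HJ : c0%:C * J omega = (Theta s l)%:C by rewrite J_omega HT.
have pc : ((2 * pi)^-1)%:C = c0%:C * c0%:C :> R[i] by rewrite -sqr_c0 -rmorphM /= expr2.
have E10 f : cint f -> E1 f 0 = c0%:C * J f.
  by move=> fi; rewrite (E1E _ fi); congr (_ * _); apply: eq_J => p; rewrite mul0r cexpi0 mul1r.
have coef (j : R[i]) : c0%:C * c0%:C * ((- al^-1)%:C * j) = - (c0%:C * j / al%:C * c0%:C) :> R[i].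
  rewrite (_ : (- al^-1)%:C = - (al%:C)^-1); last by rewrite rmorphN fmorphV.
  by move: (c0%:C) (al%:C) alC => x y y0; field.
apply/funext => g; apply/funext => h; apply/propext; split.
  move=> [Lg Lh [F [w [Fr Fi Fw /aeR_eqP eg /aeR_eqP eh]]]].
  have [[LF _] Lw _] := Fw.
  have [FF Fw'] := (fourierP LF, fourierP Lw); set f := fourier F in FF.
  have ew := (frac_lapP FF Fw').1 Fw.
  have fi : cint f.
    apply: cint_sobolev1; first exact: fourier_L2r FF.
    by apply/(sobolevP (ltW s0) FF); case: Fw.
  have [Er Ei] := E1_cont fi.
  have F0 : F 0 = c0%:C * J f by rewrite -E10//; exact: cont_ae_eq0 (inv_fourier_L1 FF fi).
  set c := F 0 / (al - Theta s l)%:C in eg.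
  have gf : is_fourier g (fun p => f p + c * omega p).
    apply: (fourier_ae (fourier_lin c FF green_fourier) (L2_meas Lg)) => //.
    - exact: L2_meas (L2D (fourier_L2r FF) (L2Z c L2_omega)).
    - by apply: (aeR_S eg) => x ->.
    - exact: aeR_W.
  have Hh := fourierP Lh; set k := fourier h in Hh.
  exists (fun p => f p + c * omega p), k; split => //.
  (* The relation h + l g = w + l F, transformed from each of its two sides. *)
  have ek := fourier_unique (fourier_ae (fourier_lin l%:C Hh gf)
     (L2_meas (fourier_L2l (fourier_lin l%:C Fw' FF))) (L2_meas (fourier_L2r (fourier_lin l%:C Hh gf))) eh (aeR_W (fun x => erefl)))
     (fourier_lin l%:C Fw' FF).
  have ci : cint (fun p => f p + c * omega p) by apply: cintD => //; apply: cintZ; exact: cint_omega.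
  split => //; [exact: fourier_L2r gf|exact: fourier_L2r Hh|].
  apply: (aeR_S2 ek ew) => p e1 e2; rewrite e2 in e1.
  have -> : k p = (sym s p)%:C * f p - l%:C * (c * omega p).
    rewrite -[LHS](addrK (l%:C * (f p + c * omega p))) e1.
    by move: (f p) (omega p) (sym s p)%:C l%:C => x1 x2 x3 x4; ring.
  rewrite (conv_cst _ _ ci) JD//; last by apply: cintZ; exact: cint_omega.
  rewrite (JZ _ cint_omega) pc coef (mulrDr c0%:C) -F0 [c0%:C * (c * _)]mulrCA HJ.
  have -> : F 0 = c * (al - Theta s l)%:C by rewrite /c mulfVK.
  rewrite rmorphB /= -mulrDr subrK mulfK//.
  rewrite -(omegaE p).
  by move: (f p) (omega p) (sym s p)%:C l%:C => x1 x2 x3 x4; ring.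
move=> [f [k [gf hk [Lf Lk fi e]]]].
have [Lg Lh] := (fourier_L2l gf, fourier_L2l hk).
(* The charge is recovered as g(0) / al. Subtracting [c * omega] removes the constant from |p|^s f,
   so that [f1] is the transform of an element of H^s, the regular part. *)
pose c := c0%:C * J f / al%:C; pose f1 p := f p - c * omega p.
have ci1 : cint f1 by apply: cintB => //; apply: cintZ; exact: cint_omega.
have Lf1 : L2 f1 by apply: L2B => //; apply: L2Z; exact: L2_omega.
have k1 p : k p = (sym s p)%:C * f p - c * c0%:C -> k p + l%:C * f p = (sym s p)%:C * f1 p + l%:C * f1 p.
  by move=> ->; rewrite /f1 -(omegaE p); ring.
have e1 : aeR (fun p => k p + l%:C * f p = (sym s p)%:C * f1 p + l%:C * f1 p).
  apply: (aeR_S e) => p ep; apply: k1; rewrite ep (conv_cst _ _ fi) pc coef; by [].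
have Lsf : L2 (fun p => (sym s p)%:C * f1 p).
  apply: (L2_ae (L2B (L2D Lk (L2Z l%:C Lf)) (L2Z l%:C Lf1))).
    by apply: cmeas_symM; exact: L2_meas.
  by apply: (aeR_S e1) => p ->; rewrite addrK.
have If := inv_fourierP Lf1; have Iw := inv_fourierP Lsf.
have F1e := inv_fourier_L1 If ci1.
have mE := cmeas_E1 ci1.1.
have EF : is_fourier (E1 f1) f1.
  by apply: (fourier_ae If mE (L2_meas Lf1) F1e); exact: aeR_W.
split => //; exists (E1 f1), (inv_fourier (fun p => (sym s p)%:C * f1 p)).
have [Er Ei] := E1_cont ci1.
have ec : E1 f1 0 / (al - Theta s l)%:C = c.
  rewrite E10// /f1 JB//; last by apply: cintZ; exact: cint_omega.
  rewrite (JZ _ cint_omega) mulrBr mulrCA HJ.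
  have -> : c0%:C * J f = c * al%:C by rewrite /c mulfVK.
  by rewrite -mulrBr -rmorphB /= mulfK.
split => //.
- by apply/(frac_lapP EF Iw); exact: aeR_W.
- apply/aeR_eqP; rewrite ec; apply: (inv_unique gf).
  have := fourier_lin c EF green_fourier.
  by rewrite (_ : (fun x => f1 x + c * omega x) = f)//; apply/funext => p; rewrite /f1 subrK.
- apply/aeR_eqP; have := fourier_lin l%:C Iw EF; apply: inv_unique.
  have H := fourier_lin l%:C hk gf.
  apply: (fourier_ae H (L2_meas (fourier_L2l H))) => //; last exact: aeR_W.
  by apply: L2_meas; apply: L2D => //; exact: L2Z.
Qed.

End point_interaction.

(** * The value of Theta *)

Section bessel.
Context {R : realType}.
Implicit Types (f : R -> R[i]).

(** Removing the successive projections from [f] lowers its squared norm by |<e n, f>|^2 / c at step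
    n. A decreasing nonnegative sequence converges, so these decrements tend to 0. *)
Lemma bessel_cvg (e : nat -> R -> R[i]) f (c : R) : 0 < c -> L2 f -> (forall n, L2 (e n)) ->
  (forall n m, n != m -> inner (e n) (e m) = 0) -> (forall n, nn (e n) ^+ 2 = c) ->
  cabs (inner (e n) f) @[n --> \oo] --> 0.
Proof.
move=> c0 Lf Le eo en; have cC : c%:C != 0 :> R[i].
  by rewrite -(rmorph0 (real_complex R)) (inj_eq (@complexI R)) gt_eqF.
pose k n := inner (e n) f / c%:C.
pose fix r n := if n is n'.+1 then (fun x => r n' x - k n' * e n' x) else f.
have Lr n : L2 (r n) by elim: n => [//|n IH]; apply: L2B => //; exact: L2Z.
have ip n m : (n <= m)%N -> inner (e m) (r n) = inner (e m) f.
  elim: n => [//|n IH] nm; rewrite /= innerBr//; last exact: L2Z.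
  rewrite IH; last exact: ltnW.
  by rewrite innerZr// eo ?mulr0 ?subr0// gtn_eqF.
have step n : nn (r n.+1) ^+ 2 = nn (r n) ^+ 2 - cabs (inner (e n) f) ^+ 2 / c.
  rewrite /= nn_sqrB//; last exact: L2Z.
  rewrite nnZ// exprMn en innerZr// (innerC (Le n) (Lr n)) ip// /k.
  have -> : inner (e n) f / c%:C * (inner (e n) f)^* = (cabs (inner (e n) f) ^+ 2 / c)%:C.
    by rewrite mulrAC [_ * _^*]mulrC mulJc -fmorphV -rmorphM.
  rewrite -fmorphV /=.
  rewrite cabsM cabsR (ger0_norm (x := c^-1)) ?invr_ge0 ?(ltW c0)// exprMn mulrC.
  by move: (nn _) (cabs _) => x y; field; rewrite gt_eqF.
have dec : {homo (fun n => nn (r n) ^+ 2) : n m / (n <= m)%N >-> m <= n}.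
  apply: homo_leq => [x|x y z h1 h2|n]; [exact: lexx|exact: le_trans h2 h1|].
  by rewrite step gerBl divr_ge0 ?sqr_ge0 ?ltW.
have := nonincreasing_is_cvgn dec.
have lb : has_lbound (range (fun n => nn (r n) ^+ 2)).
  by exists 0 => _ [n _ <-]; exact: sqr_ge0.
move=> /(_ lb) /cvg_ex[q cq].
have cq1 : nn (r n.+1) ^+ 2 @[n --> \oo] --> q by rewrite (cvg_shiftS (fun n => nn (r n) ^+ 2)).
have d0 : c * (nn (r n) ^+ 2 - nn (r n.+1) ^+ 2) @[n --> \oo] --> c * (q - q).
  by apply: cvgM; [exact: cvg_cst|exact: cvgB].
rewrite subrr mulr0 in d0.
have s0 : Num.sqrt (c * (nn (r n) ^+ 2 - nn (r n.+1) ^+ 2)) @[n --> \oo] --> Num.sqrt (0 : R).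
  by apply: continuous_cvg; [exact: sqrt_continuous|exact: d0].
rewrite sqrtr0 in s0; apply: (cvg0_squeeze _ s0) => n; rewrite cabs_ge0 step /=.
rewrite opprB addrC subrK mulrC divfK ?gt_eqF// sqrtr_sqr ger0_norm ?cabs_ge0//.
Qed.

End bessel.

(** * The partial fraction expansion of pi / sin (pi a) *)

Section cosecant.
Context {R : realType}.
Local Notation mu := (@lebesgue_measure R).
Implicit Types (a x : R).
Local Notation A := (\1_(`[0, pi])).

Lemma sin_natpi a n : sin (a + n%:R * pi) = (-1) ^+ n * sin a :> R.
Proof. by rewrite mulr_natl alternatingn//; exact: sinDpi. Qed.

Lemma sin_natpi0 n : sin (n%:R * pi) = 0 :> R.
Proof. by rewrite -[X in sin X]add0r sin_natpi sin0 mulr0. Qed.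

Lemma cont_cosM (b : R) : continuous (fun x : R => cos (b * x)).
Proof.
apply: (@cont_is_derive _ _ (fun x => b * - sin (b * x))) => x.
by apply: dcos; apply: (dEq (dZ b (dId x))); rewrite mulr1.
Qed.

Lemma int_cos (b : R) : b != 0 -> \int[mu]_x (cos (b * x) * A x) = sin (b * pi) / b.
Proof.
move=> b0; have d x : is_derive x (1 : R) (fun x => b^-1 * sin (b * x)) (cos (b * x)).
  by apply: (dEq (dZ _ (dsin (dZ b (dId x))))); rewrite mulr1 mulrA mulVf// mul1r.
by rewrite (int_FTC (pi_ge0 R) (@cont_cosM b) d) mulr0 sin0 mulr0 subr0 mulrC.
Qed.

Lemma rint_cosM (b : R) : rint (fun x : R => cos (b * x) * A x).
Proof. exact: (@rint_cont_indic R (fun x => cos (b * x)) 0 pi (@cont_cosM b)). Qed.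

Lemma rintA : rint (A : R -> R).
Proof.
have := rint_cosM 0; congr rint; apply/funext => x.
by rewrite mul0r cos0 mul1r.
Qed.

Lemma intA : \int[mu]_x (A x : R) = pi.
Proof.
rewrite (@eq_int _ _ (fun x => (fun=> 1) x * A x)); last by move=> x; rewrite mul1r.
have c1 : continuous (fun _ : R => 1 : R) by move=> x; exact: cvg_cst.
by rewrite (int_FTC (pi_ge0 R) c1 (@dId R)) subr0.
Qed.

(** The Dirichlet kernel, the sum of exp(i k x) over |k| <= N. *)
Definition dirichlet N x : R := 1 + 2 * \sum_(k < N) cos (k.+1%:R * x).

Lemma dirichletE N x : dirichlet N x * sin (x / 2) = sin ((N%:R + 2^-1) * x).
Proof.
elim: N => [|N IH].
  by rewrite /dirichlet big_ord0 mulr0 addr0 mul1r add0r mulrC.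
have -> : dirichlet N.+1 x = dirichlet N x + 2 * cos (N.+1%:R * x).
  by rewrite /dirichlet big_ord_recr /= mulrDr addrA.
rewrite mulrDl IH.
have e1 : (N%:R + 2^-1) * x = N.+1%:R * x - x / 2 by rewrite -natr1; field.
have e2 : (N.+1%:R + 2^-1) * x = N.+1%:R * x + x / 2 by field.
by rewrite e1 e2 sinB sinD; ring.
Qed.

Lemma int_cos_cos a (n : nat) : a - n%:R != 0 -> a + n%:R != 0 ->
  \int[mu]_x (cos (a * x) * cos (n%:R * x) * A x) =
  (-1) ^+ n * sin (a * pi) * (a / (a ^+ 2 - n%:R ^+ 2)).
Proof.
move=> n1 n2.
rewrite (@eq_int _ _ (fun x => 2^-1 * (cos ((a + n%:R) * x) * A x) + 2^-1 * (cos ((a - n%:R) * x) * A x))); last first.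
  move=> x; rewrite mulrDl mulrBl cosD cosB; move: (sin _) (sin _) (cos _) (cos _) => y z t u; by field.
rewrite intD; [|exact: rintZ (rint_cosM _)..].
rewrite !intZ; [|exact: rint_cosM..]; rewrite !int_cos//.
have e1 : sin ((a + n%:R) * pi) = (-1) ^+ n * sin (a * pi) by rewrite mulrDl sin_natpi.
have e2 : sin ((a - n%:R) * pi) = (-1) ^+ n * sin (a * pi).
  have := sin_natpi ((a - n%:R) * pi) n; rewrite -mulrDl subrK => ->.
  by rewrite mulrA -expr2 -exprM mulnC exprM sqrrN expr1n expr1n mul1r.
rewrite e1 e2; move: (sin _) ((-1) ^+ n) => y z.
have d : a ^+ 2 - n%:R ^+ 2 != 0 by rewrite subr_sqr mulf_neq0.
by field; rewrite n1 n2 d.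
Qed.

Lemma natB_neq0 a (n : nat) : 0 < a < 1 -> a - n%:R != 0 /\ a + n%:R != 0.
Proof.
move=> /andP[a0 a1]; split; last by rewrite gt_eqF// ltr_wpDr.
case: n => [|n]; first by rewrite subr0 gt_eqF.
by rewrite lt_eqF// subr_lt0 (lt_le_trans a1)// ler1n.
Qed.

(** Up to a factor pi, this is the N-th partial sum at 0 of the Fourier series of cos(a x) on
    [-pi, pi]. *)
Lemma int_cos_dirichlet a N : 0 < a < 1 ->
  \int[mu]_x (cos (a * x) * dirichlet N x * A x) =
  sin (a * pi) * (a^-1 + 2 * a * \sum_(k < N) (-1) ^+ k.+1 / (a ^+ 2 - k.+1%:R ^+ 2)).
Proof.
move=> a01; have a0 : a != 0 by case/andP: a01 => a0 _; rewrite gt_eqF.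
have cc (n : nat) : rint (fun x => cos (a * x) * cos (n%:R * x) * A x).
  apply: rint_cont_indic => x; apply: cvgM; exact: cont_cosM.
elim: N => [|N IH].
  rewrite big_ord0 mulr0 addr0 -int_cos//; apply: eq_int => x.
  by rewrite /dirichlet big_ord0 mulr0 addr0 mulr1.
have rd : rint (fun x => cos (a * x) * dirichlet N x * A x).
  elim: N {IH} => [|N IH].
    by have := rint_cosM a; congr rint; apply/funext => x; rewrite /dirichlet big_ord0 mulr0 addr0 mulr1.
  have := rintD IH (rintZ 2 (cc N.+1)); congr rint; apply/funext => x.
  by rewrite /dirichlet big_ord_recr /=; ring.
rewrite (@eq_int _ _ (fun x => cos (a * x) * dirichlet N x * A x + 2 * (cos (a * x) * cos (N.+1%:R * x) * A x))); last first.
  by move=> x; rewrite /dirichlet big_ord_recr /=; ring.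
have [h1 h2] := natB_neq0 N.+1 a01.
rewrite intD//; last exact: rintZ.
rewrite IH intZ// int_cos_cos// big_ord_recr /=.
by move: (\sum_(i < N) _) ((-1) ^+ N.+1) (_ ^-1) => x y z; ring.
Qed.

Lemma rint_dirichlet N : rint (fun x => dirichlet N x * A x).
Proof.
elim: N => [|N IH].
  by have := rintA; congr rint; apply/funext => x; rewrite /dirichlet big_ord0 mulr0 addr0 mul1r.
have := rintD IH (rintZ 2 (rint_cosM N.+1%:R)); congr rint; apply/funext => x.
by rewrite /dirichlet big_ord_recr /=; ring.
Qed.

Lemma int_dirichlet N : \int[mu]_x (dirichlet N x * A x) = pi.
Proof.
elim: N => [|N IH].
  by rewrite -[RHS]intA; apply: eq_int => x; rewrite /dirichlet big_ord0 mulr0 addr0 mul1r.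
rewrite (@eq_int _ _ (fun x => dirichlet N x * A x + 2 * (cos (N.+1%:R * x) * A x))); last first.
  by move=> x; rewrite /dirichlet big_ord_recr /=; ring.
rewrite intD; [|exact: rint_dirichlet|exact: rintZ (rint_cosM _)].
by rewrite IH intZ ?int_cos ?sin_natpi0 ?mul0r ?mulr0 ?addr0//; exact: rint_cosM.
Qed.

(* [|cos (a x) - 1| = 2 sin (a x / 2) ^ 2], which for [0 < a < 1] is at most
   [2 sin (x / 2)] on [0, pi], so that the quotient below is bounded. *)
Definition cosec_rem a x : R := (cos (a * x) - 1) / sin (x / 2) * A x.

Lemma cosec_rem_bdd a x : 0 < a < 1 -> `|cosec_rem a x| <= 2.
Proof.
move=> /andP[a0 a1]; rewrite /cosec_rem indicE mem_setE in_itv /=.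
case: (boolP (0 <= x <= pi)) => [/andP[x0 xpi]|_]; rewrite ?mulr1 ?mulr0 ?normr0//.
have [->|x0'] := eqVneq x 0; first by rewrite mulr0 cos0 subrr mul0r normr0.
have xp : 0 < x by rewrite lt_neqAle eq_sym x0' x0.
have pi0 := pi_gt0 R.
have s0 : 0 < sin (x / 2) by apply: sin_gt0_pi; apply/andP; split; lra.
have ax : 0 < a * x / 2 < x / 2.
  rewrite !divr_gt0 ?mulr_gt0//= ltr_pM2r ?invr_gt0//.
  by rewrite gtr_pMl.
case/andP: ax => ax0 ax1.
have sa0 : 0 < sin (a * x / 2) by apply: sin_gt0_pi; apply/andP; split; lra.
have sa : sin (a * x / 2) <= sin (x / 2).
  by apply/ltW; rewrite ltr_sin ?in_itv//=; apply/andP; split; lra.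
rewrite normrM normfV (gtr0_norm s0) ler_pdivrMr//.
have -> : cos (a * x) - 1 = - (2 * sin (a * x / 2) ^+ 2).
  have -> : a * x = (a * x / 2) *+ 2 by rewrite -mulr_natr; field.
  rewrite cos_mulr2n cos2sin2; rewrite (_ : _ / 2 = a * x / 2); last by rewrite -mulr_natr; field.
  by move: (sin _) => y; ring.
rewrite normrN (ger0_norm (mulr_ge0 (ler0n _ 2) (sqr_ge0 _))) ler_pM2l//.
rewrite expr2 (le_trans _ sa)// ler_piMr ?(ltW sa0)//; exact: sin_le1.
Qed.

Lemma rmeas_cosec_rem a : measurable_fun setT (cosec_rem a).
Proof.
have ms b : measurable_fun setT (fun x : R => sin (b * x)).
  apply: continuous_measurable_fun; apply: (@cont_is_derive _ _ (fun x => b * cos (b * x))) => x.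
  by apply: dsin; apply: (dEq (dZ b (dId x))); rewrite mulr1.
apply: measurable_funM; last exact: rint_meas rintA.
apply: measurable_funM.
  apply: measurable_funB; last exact: measurable_cst.
  exact: continuous_measurable_fun (@cont_cosM a).
have mi : measurable_fun setT (fun y : R => y^-1).
  (* The power -1 is the inverse only on nonnegative numbers, hence the detour through y^2; at y = 0
     both sides are 0. *)
  rewrite (_ : (fun y : R => y^-1) = (fun y => y * (y ^+ 2) `^ (-1))).
    apply: measurable_funM => //; apply: (measurableT_comp (measurable_powR (-1))).
    exact: measurable_funX.
  apply/funext => y; rewrite powR_inv1 ?sqr_ge0//.
  by have [->|y0] := eqVneq y 0; [rewrite invr0 mul0r|field].
apply: (measurableT_comp mi); rewrite (_ : (fun x => _) = (fun x => sin (2^-1 * x)))//.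
by apply/funext => x; rewrite mulrC.
Qed.

Lemma int_sin_sin (n m : nat) :
  \int[mu]_x (sin ((n%:R + 2^-1) * x) * sin ((m%:R + 2^-1) * x) * A x) =
  if n == m then pi / 2 else 0.
Proof.
pose b := n%:R + 2^-1 : R; pose c := m%:R + 2^-1 : R.
rewrite (@eq_int _ _ (fun x => 2^-1 * (cos ((b - c) * x) * A x) - 2^-1 * (cos ((b + c) * x) * A x))); last first.
  move=> x; have := cosB (b * x) (c * x); have := cosD (b * x) (c * x); rewrite -mulrDl -mulrBl => -> ->.
  by move: (sin _) (sin _) (cos _) (cos _) => y z t u; field.
have bc : b + c = (n + m).+1%:R by rewrite -natr1 natrD /b /c; field.
rewrite intB; [|exact: rintZ (rint_cosM _)..].
rewrite !intZ; [|exact: rint_cosM..].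
rewrite bc (int_cos (b := _.+1%:R))// sin_natpi0 mul0r mulr0 subr0.
have [nm|nm] := eqVneq n m.
  rewrite /b /c nm subrr -[RHS]mulrC; congr (_ * _); rewrite -[RHS]intA; apply: eq_int => x.
  by rewrite mul0r cos0 mul1r.
have bcE : b - c = n%:R - m%:R by rewrite /b /c; ring.
have nmR : n%:R - m%:R != 0 :> R by rewrite subr_eq0 eqr_nat.
rewrite bcE int_cos//.
have -> : sin ((n%:R - m%:R) * pi) = 0 :> R.
  rewrite mulrBl sinB !sin_natpi0; ring.
by rewrite mul0r mulr0.
Qed.

(** These are the coefficients of a bounded function along the orthogonal system sin((N + 1/2) x) on
    [0, pi]; [bessel_cvg] plays the part of the Riemann-Lebesgue lemma. *)
Lemma cosec_rem_cvg a : 0 < a < 1 ->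
  \int[mu]_x (sin ((N%:R + 2^-1) * x) * cosec_rem a x) @[N --> \oo] --> 0.
Proof.
move=> a01; pose e N x := (sin ((N%:R + 2^-1) * x) * A x)%:C : R[i].
have A01 (x : R) : A x = 0 :> R \/ A x = 1 :> R.
  by rewrite indicE; case: (x \in _); [right|left].
have AA (x : R) : A x * A x = A x :> R by case: (A01 x) => ->; rewrite ?mul0r ?mul1r.
have A0 (x : R) : 0 <= A x :> R by case: (A01 x) => ->.
have ms b : continuous (fun x : R => sin (b * x)).
  apply: (@cont_is_derive _ _ (fun x => b * cos (b * x))) => x.
  by apply: dsin; apply: (dEq (dZ b (dId x))); rewrite mulr1.
have re N : rint (fun x => sin ((N%:R + 2^-1) * x) * A x) by exact: rint_cont_indic.
have bdd (h : R -> R) M : measurable_fun setT h -> (forall x, `|h x| <= M * A x) -> L2 (fun x => (h x)%:C).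
  move=> mh hM; apply/L2P; split; first exact: cmeasR.
  apply: (rint_le _ (rintZ (M ^+ 2) rintA)) => [|x].
    by apply: measurable_funX; apply: cmeas_cabs; exact: cmeasR.
  rewrite ger0_norm ?sqr_ge0// cabsR -[X in _ * X]AA -expr2 -exprMn lerXn2r// nnegrE//.
  by rewrite (le_trans _ (hM x)).
have Le N : L2 (e N).
  apply: (@bdd (fun x => sin ((N%:R + 2^-1) * x) * A x) 1); first exact: rint_meas (re N).
  by move=> x; rewrite normrM (ger0_norm (A0 x)) ler_wpM2r// sin_max.
have Lf : L2 (fun x => (cosec_rem a x)%:C).
  apply: (@bdd _ 2); first exact: rmeas_cosec_rem.
  move=> x; case: (A01 x) => Ax; last by rewrite Ax mulr1; exact: cosec_rem_bdd.
  by rewrite /cosec_rem Ax !mulr0 normr0.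
have ss n m : rint (fun x => sin ((n%:R + 2^-1) * x) * sin ((m%:R + 2^-1) * x) * A x).
  by apply: rint_cont_indic => x; apply: cvgM; exact: ms.
have ipE n m : inner (e n) (e m) = (if n == m then pi / 2 else 0)%:C.
  rewrite -int_sin_sin -J_real// innerE; apply: eq_J => x; rewrite /e cJR -rmorphM /=.
  by congr (_%:C); rewrite mulrACA AA.
have := @bessel_cvg R e _ (pi / 2) _ Lf Le _ _.
have p0 : 0 < pi / 2 :> R by rewrite divr_gt0 ?pi_gt0.
move=> /(_ p0) h.
have {}h : cabs (inner (e n) (fun x => (cosec_rem a x)%:C)) @[n --> \oo] --> 0.
  apply: h => [n m nm|n]; first by rewrite ipE (negbTE nm).
  by apply: (@complexI R); rewrite -innerff// ipE eqxx.
apply/norm_cvg0P; apply: (cvg0_squeeze _ h) => N; rewrite normr_ge0 /=.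
have rs : rint (fun x => sin ((N%:R + 2^-1) * x) * cosec_rem a x).
  have := cint_Re (L2_ip (Le N) Lf); congr rint; apply/funext => x.
  rewrite /e cJR -rmorphM /= /cosec_rem -!mulrA; congr (_ * _).
  by rewrite [A x * _]mulrC -!mulrA AA.
rewrite innerE (@eq_J _ _ (fun x => (sin ((N%:R + 2^-1) * x) * cosec_rem a x)%:C)).
  by rewrite J_real// cabsR.
move=> x; rewrite /e cJR -rmorphM /=; congr (_%:C).
by rewrite /cosec_rem -!mulrA; congr (_ * _); rewrite [A x * _]mulrC -!mulrA AA.
Qed.

(** Convergence at 0 of the Fourier series of cos(a x). The Dirichlet kernel has integral pi over
    [0, pi], so subtracting the value 1 at 0 leaves the integral of sin((N + 1/2) x) against
    [cosec_rem], which tends to 0. *)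
Lemma cosec_cvg a : 0 < a < 1 ->
  (a^-1 + 2 * a * \sum_(k < N) (-1) ^+ k.+1 / (a ^+ 2 - k.+1%:R ^+ 2))
    @[N --> \oo] --> pi / sin (a * pi).
Proof.
move=> a01; case/andP: (a01) => a0 a1; have pi0 := pi_gt0 R.
have s0 : 0 < sin (a * pi).
  by apply: sin_gt0_pi; rewrite mulr_gt0//= gtr_pMl.
have E N : sin (a * pi) * (a^-1 + 2 * a * \sum_(k < N) (-1) ^+ k.+1 / (a ^+ 2 - k.+1%:R ^+ 2)) =
   \int[mu]_x (sin ((N%:R + 2^-1) * x) * cosec_rem a x) + pi.
  rewrite -int_cos_dirichlet// -[X in _ + X](int_dirichlet N).
  have rs : rint (fun x => sin ((N%:R + 2^-1) * x) * cosec_rem a x).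
    apply: (rint_le _ (rintZ 2 rintA)) => [|x].
      apply: measurable_funM; last exact: rmeas_cosec_rem.
      apply: continuous_measurable_fun; apply: (@cont_is_derive _ _ (fun x => (N%:R + 2^-1) * cos ((N%:R + 2^-1) * x))) => x.
      by apply: dsin; apply: (dEq (dZ _ (dId x))); rewrite mulr1.
    have hb : `|sin ((N%:R + 2^-1) * x) * cosec_rem a x| <= 2.
      rewrite normrM (le_trans _ (cosec_rem_bdd x a01))// ler_piMl ?normr_ge0//; exact: sin_max.
    move: hb; rewrite /cosec_rem indicE; case: (_ \in _); first by rewrite !mulr1.
    by rewrite !mulr0 normr0.
  rewrite -intD//; last exact: rint_dirichlet.
  apply: eq_int => x; rewrite -dirichletE /cosec_rem indicE mem_setE in_itv /=.
  case: (boolP (0 <= x <= pi)) => [/andP[x0 xpi]|_]; rewrite ?mulr1 ?mulr0 ?addr0//.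
  (* At 0 the quotient in [cosec_rem] is 0 by the convention on division, in agreement with cos 0 -
     1 = 0. *)
  have [->|x0'] := eqVneq x 0; first by rewrite mul0r mulr0 cos0 sin0 subrr !mulr0 mul0r add0r mul1r.
  have sx : 0 < sin (x / 2).
    have xp : 0 < x by rewrite lt_neqAle eq_sym x0' x0.
    by apply: sin_gt0_pi; apply/andP; split; lra.
  by move: (dirichlet N x) (cos _) (sin _) (gt_eqF sx) => d c y y0; field; rewrite y0.
have h : (\int[mu]_x (sin ((N%:R + 2^-1) * x) * cosec_rem a x) + pi) / sin (a * pi)
    @[N --> \oo] --> (0 + pi) / sin (a * pi).
  apply: cvgM; last exact: cvg_cst.
  by apply: cvgD; [exact: cosec_rem_cvg|exact: cvg_cst].
rewrite add0r in h; apply: cvg_trans h; apply: near_eq_cvg; apply: nearW => N.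
by rewrite -E mulrC mulKf// gt_eqF.
Qed.

End cosecant.

(** * The integral of 1 / (|p|^s + l) *)

Section power_integrals.
Context {R : realType}.
Local Notation mu := (@lebesgue_measure R).
Implicit Types (r s l : R).

Lemma powR_cvg_at0 r : 0 < r -> x `^ r @[x --> (0 : R)^'+] --> (0 : R).
Proof.
move=> r0; apply/cvgrPdist_le => e e0; near=> x.
have x0 : 0 < x by near: x; exact: nbhs_right_gt.
have xe : x < e `^ r^-1 by near: x; apply: nbhs_right_lt; exact: powR_gt0.
rewrite sub0r normrN ger0_norm ?powR_ge0//.
have -> : e = (e `^ r^-1) `^ r by rewrite -powRrM mulVf ?gt_eqF// powRr1// ltW.
by apply: ge0_ler_powR; rewrite ?nnegrE ?powR_ge0 ?(ltW r0) ?(ltW x0) ?(ltW xe).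
Unshelve. all: by end_near. Qed.

Lemma is_derive_powR_prim r (c x : R) : r != 0 -> 0 < x ->
  is_derive x (1 : R) (fun x => r^-1 * x `^ r) (x `^ (r - 1)).
Proof.
by move=> r0 x0; apply: (dEq (dZ _ (is_derive1_powR r x0))); rewrite mulrA mulVf ?mul1r.
Qed.

Lemma powR_cont r (x : R) : 0 < x -> {for x, continuous (fun x : R => x `^ r)}.
Proof.
move=> x0; apply: differentiable_continuous; apply/derivable1_diffP.
by case: (is_derive1_powR r x0).
Qed.

Lemma mulEFin_itv (f : R -> R) (A : set R) :
  (\int[mu]_x (f x * \1_A x)%:E = \int[mu]_(x in A) (f x)%:E)%E.
Proof.
rewrite [RHS]integral_mkcond; apply: eq_integral => x _; rewrite patchE indicE.
by case: (x \in A); rewrite ?mulr1 ?mulr0.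
Qed.

Lemma int_pow01 r : 0 <= r ->
  rint (fun x => x `^ r * \1_(`[0, 1]) x) /\
  \int[mu]_x (x `^ r * \1_(`[0, 1]) x) = (r + 1)^-1.
Proof.
move=> r0; have r1 : 0 < r + 1 by rewrite ltr_wpDl.
have E : (\int[mu]_x (x `^ r * \1_(`[0%R, 1%R]) x)%:E = ((r + 1)^-1)%:E)%E.
  rewrite (mulEFin_itv (fun x => x `^ r)) (@continuous_FTC2 _ _ (fun x => (r + 1)^-1 * x `^ (r + 1)))//.
  - by rewrite powR1 mulr1 powR0 ?gt_eqF// mulr0 sube0.
  - apply/continuous_within_itvP => //; split.
    + by move=> x; rewrite in_itv /= => /andP[x0 _]; exact: powR_cont.
    (* The power at 0 equals 1 for r = 0 and 0 for r > 0, so right continuity at 0 needs two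
       arguments. *)
    + have [->|r0'] := eqVneq r 0.
        by rewrite powRr0; under eq_fun do rewrite powRr0; exact: cvg_cst.
      rewrite powR0//; apply: powR_cvg_at0.
      by rewrite lt_neqAle eq_sym r0' r0.
    + by apply: cvg_at_left_filter; apply: powR_cont.
  - split.
    + move=> x; rewrite in_itv /= => /andP[x0 _].
      by case: (is_derive_powR_prim 0 (lt0r_neq0 r1) x0).
    + rewrite powR0 ?gt_eqF// ; apply: cvgM; [exact: cvg_cst|exact: powR_cvg_at0].
    + apply: cvgM; first exact: cvg_cst.
      by apply: cvg_at_left_filter; apply: powR_cont.
  - move=> x; rewrite in_itv /= => /andP[x0 _].
    have [_ d] := is_derive_powR_prim 0 (lt0r_neq0 r1) x0.
    by rewrite derive1E d addrK.
have m : measurable_fun setT (fun x => x `^ r * \1_(`[0, 1]) x).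
  by apply: measurable_funM; [exact: measurable_powR|exact: measurable_indic].
have i : rint (fun x => x `^ r * \1_(`[0, 1]) x).
  apply: rint_ge0P => // [x|]; first by rewrite mulr_ge0 ?powR_ge0.
  by rewrite E ltry.
by split => //; apply: EFin_inj; rewrite -EFin_int.
Qed.

Lemma powR_cvgy r : 0 < r -> x `^ (- r) @[x --> +oo] --> (0 : R).
Proof.
move=> r0; apply/cvgrPdist_le => e e0; near=> x.
have x0 : 0 < x by near: x; apply: nbhs_pinfty_gt; exact: num_real.
have xe : (e^-1) `^ r^-1 <= x by near: x; apply: nbhs_pinfty_ge; exact: num_real.
rewrite sub0r normrN ger0_norm ?powR_ge0// powRN invf_ple ?posrE ?powR_gt0//.
have -> : e^-1 = (e^-1 `^ r^-1) `^ r.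
  by rewrite -powRrM mulVf ?gt_eqF// powRr1// invr_ge0 ltW.
by apply: ge0_ler_powR; rewrite ?nnegrE ?powR_ge0 ?(ltW r0) ?(ltW x0).
Unshelve. all: by end_near. Qed.

Lemma int_pow1y r : 1 < r ->
  rint (fun x => x `^ (- r) * \1_(`[1, +oo[) x) /\
  \int[mu]_x (x `^ (- r) * \1_(`[1, +oo[) x) = (r - 1)^-1.
Proof.
move=> r1; have r0 : 0 < r - 1 by rewrite subr_gt0.
have d (x : R) : 1 < x -> is_derive x (1 : R) (fun x => (- (r - 1))^-1 * x `^ (- (r - 1))) (x `^ (- r)).
  move=> x1; have n0 : - (r - 1) != 0 by rewrite oppr_eq0 gt_eqF.
  by apply: (dEq (is_derive_powR_prim 0 n0 (lt_trans ltr01 x1))); congr powR; ring.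
have E : (\int[mu]_x (x `^ (- r) * \1_(`[1%R, +oo[) x)%:E = ((r - 1)^-1)%:E)%E.
  rewrite (mulEFin_itv (fun x => x `^ (- r)))
    (@ge0_continuous_FTC2y _ _ (fun x => (- (r - 1))^-1 * x `^ (- (r - 1))) 1 ((- (r - 1))^-1 * 0))//.
  - by rewrite powR1 mulr1 mulr0 invrN -EFinB sub0r opprK.
  - by move=> x _; exact: powR_ge0.
  - apply/continuous_within_itvcyP; split.
      by move=> x; rewrite in_itv /= andbT => x1; apply: powR_cont; exact: lt_trans x1.
    by apply: cvg_at_right_filter; apply: powR_cont.
  - by apply: cvgM; [exact: cvg_cst|exact: powR_cvgy].
  - by move=> x x1; case: (d x x1).
  - apply: cvgM; first exact: cvg_cst.
    by apply: cvg_at_right_filter; apply: powR_cont.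
  - move=> x; rewrite in_itv /= andbT => x1.
    by have [_ dx] := d x x1; rewrite derive1E dx.
have m : measurable_fun setT (fun x => x `^ (- r) * \1_(`[1, +oo[) x).
  by apply: measurable_funM; [exact: measurable_powR|exact: measurable_indic].
have i : rint (fun x => x `^ (- r) * \1_(`[1, +oo[) x).
  apply: rint_ge0P => // [x|]; first by rewrite mulr_ge0 ?powR_ge0.
  by rewrite E ltry.
by split => //; apply: EFin_inj; rewrite -EFin_int.
Qed.

Lemma int_sum (g : nat -> R -> R) (c : nat -> R) N : (forall k, rint (g k)) ->
  (forall k, \int[mu]_x g k x = c k) ->
  rint (fun x => \sum_(k < N) g k x) /\ \int[mu]_x \sum_(k < N) g k x = \sum_(k < N) c k.
Proof.
move=> gi gc; elim: N => [|N [i IH]].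
  under eq_fun do rewrite big_ord0; rewrite big_ord0; split; first exact: rint0.
  by rewrite /Rintegral; under eq_integral do rewrite ?big_ord0; rewrite integral0.
rewrite big_ord_recr /= -IH -gc -intD//; split.
  by under eq_fun do rewrite big_ord_recr /=; exact: rintD.
by apply: eq_int => x; rewrite big_ord_recr.
Qed.

Lemma geo_rem (x : R) N : x + 1 != 0 ->
  (x + 1)^-1 - \sum_(k < N) (- x) ^+ k = (- x) ^+ N / (x + 1).
Proof.
move=> x0; elim: N => [|N IH]; first by rewrite big_ord0 subr0 expr0 mul1r.
by rewrite big_ord_recr /= opprD addrA IH exprS; move: (_ ^+ N) => y; field.
Qed.

(* An integrable [f] with geometric expansion [sum_k (-1)^k g k], where the
   remainders are dominated by the first neglected term. *)
Lemma int_alternating (f : R -> R) (g : nat -> R -> R) (c : nat -> R) : rint f ->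
  (forall k, rint (g k)) -> (forall k, \int[mu]_x g k x = c k) ->
  (forall N x, `|f x - \sum_(k < N) (-1) ^+ k * g k x| <= g N x) ->
  c n @[n --> \oo] --> 0 ->
  \sum_(k < N) (-1) ^+ k * c k @[N --> \oo] --> \int[mu]_x f x.
Proof.
move=> fi gi gc fg c0; apply/subr_cvg0/norm_cvg0P; apply: (cvg0_squeeze _ c0) => N.
rewrite normr_ge0 /= distrC.
have [i <-] := @int_sum (fun k x => (-1) ^+ k * g k x) (fun k => (-1) ^+ k * c k) N
  (fun k => rintZ _ (gi k)) (fun k => etrans (intZ _ (gi k)) (congr1 _ (gc k))).
rewrite -intB//; apply: le_trans (int_norm (rintB fi i)) _; rewrite -gc.
by apply: int_le => //; apply: rint_norm; exact: rintB.
Qed.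

(** This is 1 / (1 + s n) + 1 / (1 - s n) = 2 / (1 - s^2 n^2) with alternating signs. The first sum
    has one term more: its term 0 stays alone and gives 1, and its term k + 1 is paired with term k
    of the second. *)
Lemma sum_cosec s N : 1 < s ->
  \sum_(k < N.+1) (-1) ^+ k * (s * k%:R + 1)^-1 + \sum_(k < N) (-1) ^+ k * (s * k.+1%:R - 1)^-1 =
  s^-1 * (s^-1^-1 + 2 * s^-1 * \sum_(k < N) (-1) ^+ k.+1 / (s^-1 ^+ 2 - k.+1%:R ^+ 2)).
Proof.
move=> s1; have s0 : s != 0 by rewrite gt_eqF// (lt_trans ltr01).
elim: N => [|N IH].
  by rewrite big_ord_recr /= !big_ord0 !mulr0 add0r !addr0 add0r invrK mulVf// invr1 mulr1 expr0.
rewrite big_ord_recr /= [X in _ + X]big_ord_recr /= addrACA IH [in RHS]big_ord_recr /=.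
have n1 : (1 : R) <= N.+1%:R by rewrite ler1n.
have sn : 1 < s * N.+1%:R by rewrite (lt_le_trans s1)// ler_peMr// ltW// (lt_trans ltr01).
have e : s^-1 ^+ 2 - N.+1%:R ^+ 2 = - (s * N.+1%:R + 1) * (s * N.+1%:R - 1) * s^-1 ^+ 2 by field.
rewrite e (exprS (-1) N); move: (\sum_(i < N) _) ((-1) ^+ N) N.+1%:R sn => x y n sn.
have h1 : s * n + 1 != 0 by rewrite gt_eqF// ltr_wpDl// ltW// (lt_trans ltr01).
have h2 : s * n - 1 != 0 by rewrite gt_eqF// subr_gt0.
by field; rewrite s0 h1 h2.
Qed.

(** The termwise integrals 1 / (s k + 1) and 1 / (s (k + 1) - 1) form series that converge only
    conditionally; hence the bound of each remainder by the first neglected term, which is valid up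
    to the common endpoint 1. *)
Lemma int_sym_half s : 1 < s ->
  \int[mu]_x ((sym s x + 1)^-1 * \1_(`[0, +oo[) x) = s^-1 * (pi / sin (s^-1 * pi)).
Proof.
move=> s1; have s0 : 0 < s by rewrite (lt_trans ltr01).
have fi := rint_sym s1 ltr01; have i01 : measurable `[(0 : R), 1] by exact: measurable_itv.
have i1y : measurable `[(1 : R), +oo[ by exact: measurable_itv.
have r1 := rint_indic i01 fi; have r2 := rint_indic i1y fi.
have den x : 0 < sym s x + 1 by rewrite ltr_wpDl// sym_ge0.
have h1 : \sum_(k < N) (-1) ^+ k * (s * k%:R + 1)^-1 @[N --> \oo] -->
    \int[mu]_x ((sym s x + 1)^-1 * \1_(`[0, 1]) x).
  have p k := @int_pow01 (s * k%:R) (mulr_ge0 (ltW s0) (ler0n _ k)).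
  apply: (int_alternating r1 (fun k => (p k).1) (fun k => (p k).2)).
    move=> N x; rewrite indicE mem_setE in_itv /=.
    case: (boolP (0 <= x <= 1)) => [/andP[x0 x1]|_]; last first.
      by rewrite !mulr0 big1 ?subrr ?normr0// => k _; rewrite !mulr0.
    have e k : x `^ (s * k%:R) = sym s x ^+ k.
      by rewrite powRrM powR_mulrn ?powR_ge0// /sym ger0_norm.
    rewrite !mulr1 e (_ : \sum_(k < N) _ = \sum_(k < N) (- sym s x) ^+ k); last first.
      by apply: eq_bigr => k _; rewrite e [RHS]exprNn mulr1.
    rewrite geo_rem ?gt_eqF// normrM normrX normrN normfV (gtr0_norm (den x)) (ger0_norm (sym_ge0 _ _)).
    by rewrite ler_piMr ?exprn_ge0 ?sym_ge0// invf_le1// lerDr sym_ge0.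
  apply: (@cvg0_squeeze _ _ (fun n => n.+1%:R^-1)); last exact: cvg_harmonic.
  move=> n; have d0 : 0 < s * n%:R + 1 by rewrite ltr_wpDl// mulr_ge0// ltW.
  rewrite invr_ge0 (ltW d0) /= lef_pV2 ?posrE// -natr1 lerD2r.
  by rewrite ler_peMl// ltW.
have h2 : \sum_(k < N) (-1) ^+ k * (s * k.+1%:R - 1)^-1 @[N --> \oo] -->
    \int[mu]_x ((sym s x + 1)^-1 * \1_(`[1, +oo[) x).
  have sk k : 1 < s * k.+1%:R by rewrite (lt_le_trans s1)// ler_peMr ?ler1n// ltW.
  have p k := int_pow1y (sk k).
  apply: (int_alternating r2 (fun k => (p k).1) (fun k => (p k).2)).
    move=> N x; rewrite indicE mem_setE in_itv /= andbT.
    have [x1|_] := leP 1 x; last first.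
      by rewrite !mulr0 big1 ?subrr ?normr0// => k _; rewrite !mulr0.
    have x0 : 0 < x := lt_le_trans ltr01 x1.
    (* For x >= 1 the expansion is in y = x^-s, from 1 / (x^s + 1) = y / (1 + y); the factor y in
       front shifts the exponents to k + 1. *)
    pose y := x `^ (- s); have y0 : 0 < y by exact: powR_gt0.
    have e k : x `^ (- (s * k.+1%:R)) = y ^+ k.+1 by rewrite -mulNr powRrM powR_mulrn ?powR_ge0.
    have f : (sym s x + 1)^-1 = y * (y + 1)^-1.
      rewrite /sym gtr0_norm// /y powRN; move: (x `^ s) (powR_gt0 s x0) => t t0.
      by field; rewrite !gt_eqF ?addr_gt0.
    rewrite !mulr1 e f (_ : \sum_(k < N) _ = y * \sum_(k < N) (- y) ^+ k); last first.
      rewrite mulr_sumr; apply: eq_bigr => k _; rewrite mulr1 e [in RHS]exprNn exprS.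
      by move: (y ^+ k) ((-1) ^+ k) => u v; ring.
    rewrite -mulrBr geo_rem ?gt_eqF ?addr_gt0//.
    rewrite !normrM normrX normrN normfV !(gtr0_norm y0) (gtr0_norm (addr_gt0 y0 ltr01)).
    rewrite exprS ler_pM2l// ler_piMr ?exprn_ge0 ?(ltW y0)//.
    by rewrite invf_le1 ?addr_gt0// lerDr ltW.
  have h0 : (s - 1)^-1 * n.+1%:R^-1 @[n --> \oo] --> ((s - 1)^-1 * 0 : R).
    by apply: cvgM; [exact: cvg_cst|exact: cvg_harmonic].
  rewrite mulr0 in h0; apply: (cvg0_squeeze _ h0) => n.
  have d0 : 0 < s * n.+1%:R - 1 by rewrite subr_gt0.
  rewrite invr_ge0 (ltW d0) /= -invfM lef_pV2 ?posrE ?mulr_gt0 ?subr_gt0//.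
  by rewrite mulrBl mul1r lerD2l lerN2 ler1n.
have h3 : \sum_(k < N.+1) (-1) ^+ k * (s * k%:R + 1)^-1 @[N --> \oo] -->
    \int[mu]_x ((sym s x + 1)^-1 * \1_(`[0, 1]) x).
  by rewrite (cvg_shiftS (fun N => \sum_(k < N) (-1) ^+ k * (s * k%:R + 1)^-1)).
have h4 : (\sum_(k < N.+1) (-1) ^+ k * (s * k%:R + 1)^-1 +
    \sum_(k < N) (-1) ^+ k * (s * k.+1%:R - 1)^-1) @[N --> \oo] -->
    \int[mu]_x ((sym s x + 1)^-1 * \1_(`[0, 1]) x) + \int[mu]_x ((sym s x + 1)^-1 * \1_(`[1, +oo[) x).
  exact: cvgD.
have a01 : 0 < s^-1 < 1 by rewrite invr_gt0 s0 invf_lt1.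
have h5 : s^-1 * (s^-1^-1 + 2 * s^-1 * \sum_(k < N) (-1) ^+ k.+1 / (s^-1 ^+ 2 - k.+1%:R ^+ 2))
    @[N --> \oo] --> s^-1 * (pi / sin (s^-1 * pi)).
  by apply: cvgM; [exact: cvg_cst|exact: cosec_cvg].
have h6 : (\sum_(k < N.+1) (-1) ^+ k * (s * k%:R + 1)^-1 +
    \sum_(k < N) (-1) ^+ k * (s * k.+1%:R - 1)^-1) @[N --> \oo] --> s^-1 * (pi / sin (s^-1 * pi)).
  by apply: cvg_trans h5; apply: near_eq_cvg; apply: nearW => N; rewrite (sum_cosec N s1).
rewrite -(@cvg_unique _ (@norm_hausdorff _ R) _ _ _ _ h4 h6) -intD//.
apply: int_ae.
- by apply: rint_meas; apply: rint_indic => //; exact: measurable_itv.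
- by apply: rint_meas; exact: rintD.
apply: (aeR_S (ae_neq 1)) => x x1; rewrite -mulrDr !indicE !mem_setE !in_itv /= !andbT.
congr (_ * _); case: (ltgtP x 1) x1 => // x1 _; rewrite ?andbF ?andbT ?add0r ?addr0//.
by rewrite (ltW (lt_trans ltr01 x1)).
Qed.

Lemma Theta_int s l : 1 < s -> 0 < l -> (2 * pi)^-1 * wint (sym s) l = Theta s l.
Proof.
move=> s1 l0; have s0 : 0 < s by rewrite (lt_trans ltr01).
have fi := rint_sym s1 ltr01; have pi0 := pi_gt0 R.
have ss : 0 < sin (s^-1 * pi).
  apply: sin_gt0_pi; rewrite mulr_gt0 ?invr_gt0//= gtr_pMl// invf_lt1//.
have i0 : measurable `[(0 : R), +oo[ by exact: measurable_itv.
have e : \int[mu]_x (sym s x + 1)^-1 = 2 * (s^-1 * (pi / sin (s^-1 * pi))).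
  rewrite -int_sym_half//; apply: (even_split (rint_meas fi) _ (rint_indic i0 fi)).2.
  by move=> x; rewrite /sym normrN.
(* The substitution x -> b x turns |x|^s + 1 into (|x|^s + l) / l. *)
pose b := l `^ (- s^-1); have b0 : 0 < b by exact: powR_gt0.
have := int_affine 0 b0 fi; rewrite e.
rewrite (@eq_int _ _ (fun x => l * (sym s x + l)^-1)); last first.
  move=> x; rewrite addr0 /sym normrM (gtr0_norm b0) powRM ?(ltW b0)//.
  have -> : b `^ s = l^-1 by rewrite /b -powRrM mulNr mulVf ?gt_eqF// powR_inv1 ?ltW.
  have : 0 < `|x| `^ s + l by rewrite ltr_wpDl ?powR_ge0.
  move: (`|x| `^ s) => t t0; field; rewrite !gt_eqF//.
rewrite intZ; last exact: rint_sym.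
rewrite -/(wint (sym s) l) /b powRN invrK => E.
have -> : wint (sym s) l = l^-1 * (l `^ s^-1 * (2 * (s^-1 * (pi / sin (s^-1 * pi))))).
  by rewrite -E mulKf// gt_eqF.
rewrite /Theta powRD; last by rewrite (gt_eqF l0) implybT.
rewrite powRr1 ?(ltW l0)// powRN (mulrC pi s^-1).
move: (l `^ s^-1) (powR_gt0 s^-1 l0) => t t0; move: (sin _) ss => u u0.
move: pi pi0 => p p0; field.
by rewrite !gt_eqF.
Qed.

End power_integrals.

(** * The scaling limit *)

Section scaling.
Context {R : realType}.
Local Notation mu := (@lebesgue_measure R).
Implicit Types (eta V : R -> R) (e k : R).

Lemma rint_scaled eta V e : 0 < e -> rint V -> rint (scaled_potential eta V e).
Proof.
move=> e0 Vi; have ei : 0 < e^-1 by rewrite invr_gt0.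
have := rintZ (eta e / e) (rint_affine 0 ei Vi); congr rint; apply/funext => x.
by rewrite /scaled_potential addr0 [e^-1 * x]mulrC.
Qed.

Lemma vhat_scaled eta V e k : 0 < e -> rint V ->
  vhat (scaled_potential eta V e) k = (eta e)%:C * vhat V (e * k).
Proof.
move=> e0 Vi; have ei : 0 < e^-1 by rewrite invr_gt0.
have ci := cint_cexpiN (e * k) (cintR Vi).
have [ci' E] := J_affine 0 ei ci; rewrite invrK in E.
have -> : vhat V (e * k) = (e^-1)%:C * (e%:C * J (fun y => cexpi (- (e * k * y)) * (V y)%:C)).
  by rewrite mulrA -rmorphM /= mulVf ?gt_eqF// mul1r.
rewrite -E mulrA -rmorphM -(JZ _ ci'); apply: eq_J => x.
rewrite /scaled_potential addr0 !rmorphM /= (mulrC e^-1 x).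
have -> : e * k * (x / e) = k * x by field; rewrite gt_eqF.
by move: (cexpi _) (V _)%:C => a b; ring.
Qed.

Lemma vhat0 V : rint V -> vhat V 0 = (\int[mu]_x V x)%:C.
Proof.
by move=> Vi; rewrite -J_real//; apply: eq_J => x; rewrite mul0r oppr0 cexpi0 mul1r.
Qed.

Lemma vhat_cvg0 V (u : nat -> R) k : rint V -> u n @[n --> \oo] --> (0 : R) ->
  cabs (vhat V (u n * k) - (\int[mu]_x V x)%:C) @[n --> \oo] --> 0.
Proof.
move=> Vi u0; have h : - (u n * k) @[n --> \oo] --> (- (0 * k) : R).
  by apply: cvgN; apply: cvgM => //; exact: cvg_cst.
have c := J_cexpi_cvg (cintR Vi) h; apply: (cvg0_squeeze _ c) => n; rewrite cabs_ge0 -vhat0//=.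
rewrite /vhat le_eqVlt; apply/orP; left; apply/eqP; congr (cabs (_ - _)).
  by apply: eq_J => y; rewrite mulNr.
by apply: eq_J => y; rewrite !mul0r !oppr0 mul0r.
Qed.

(** Right differentiability at 0 implies right continuity: the difference quotient converges, so its
    product with y tends to 0. *)
Lemma smooth_cvg0 eta : smooth_half_line eta -> eta e @[e --> (0 : R)^'+] --> eta 0.
Proof.
move=> [d [d0 dS]]; have h := dS 0%N 0 (lexx 0).
have h1 : (d 0%N y - d 0%N 0) / (y - 0) @[y --> (0 : R)^'+] --> d 1%N 0.
  have sub : (0 : R)^'+ `=>` within [set y | 0 <= y] (0 : R)^'.
    move=> A hA; have {}hA : nbhs (0 : R) [set y | y != 0 -> 0 <= y -> A y] := hA.
    have : nbhs (0 : R) [set y | 0 < y -> A y].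
      by apply: filterS hA => y hy y0; apply: hy; [rewrite gt_eqF|exact: ltW].
    exact.
  exact: cvg_trans (cvg_app _ sub) h.
have h2 : (d 0%N y - d 0%N 0) / (y - 0) * y + d 0%N 0 @[y --> (0 : R)^'+] --> d 1%N 0 * 0 + d 0%N 0.
  apply: cvgD; last exact: cvg_cst.
  by apply: cvgM => //; apply: cvg_at_right_filter; exact: cvg_id.
rewrite mulr0 add0r d0// in h2; apply: cvg_trans h2; apply: near_eq_cvg.
near=> y; have y0 : 0 < y by near: y; exact: nbhs_right_gt.
by rewrite subr0 divfK ?gt_eqF// d0 ?ltW// subrK.
Unshelve. all: by end_near. Qed.

End scaling.

Theorem theorem3p4 (R : realType) (s : R) (V eta : R -> R) (lambda : R) :
  1 < s -> s < 3 / 2 ->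
  (@lebesgue_measure R).-integrable setT (fun x => (V x)%:E) ->
  smooth_half_line eta -> (forall x, 0 <= x -> 0 < eta x) -> eta 1 = 1 ->
  let I := \int[@lebesgue_measure R]_(x in setT) V x in
  let alpha := if I == 0 then None else Some (- (eta 0 * I)^-1) in
  0 < lambda -> alpha <> Some (Theta s lambda) ->
  (forall e : R, 0 < e -> self_adjoint (form_sum s (scaled_potential eta V e)))
  /\ norm_resolvent_cvg (fun e => form_sum s (scaled_potential eta V e))
       0^'+ (k_op s lambda alpha).
Proof.
move=> s1 _ Vi seta eta0 _ I alpha l0 aT.
have s0 : 0 < s by rewrite (lt_trans ltr01).
have ms := rmeas_sym s; have ai l (h : 0 < l) := rint_sym s1 h.
have sa e : 0 < e -> self_adjoint (form_sum s (scaled_potential eta V e)).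
  move=> e0; have Vei := rint_scaled eta e0 Vi; rewrite (form_sumE s1 Vei).
  exact: (pos_op_self_adjoint ms (sym_ge0 s) ai (hmult_vhat Vei)).
split => //; have e00 := eta0 0 (lexx 0).
(* Both cases of [alpha] give a constant multiplier free of [lambda]: 0 when I = 0, and -1 / alpha =
   eta(0) I otherwise. *)
have -> : k_op s lambda alpha = pos_op (sym s) (fun=> (eta 0 * I)%:C).
  move: aT; rewrite /alpha; have [I0|I0] := eqVneq I 0; move=> aT.
    by rewrite (k_op_noneE lambda s1) I0 mulr0.
  have eI : eta 0 * I != 0 by rewrite mulf_neq0// gt_eqF.
  rewrite (k_op_someE s1 l0 (Theta_int s1 l0)) ?invrN ?opprK ?invrK//.
    by rewrite oppr_eq0 invr_eq0.
  by apply/eqP => E; apply: aT; rewrite E.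
have cv := smooth_cvg0 seta.
(* Right continuity bounds |eta| by |eta 0| + 1 below some [r]; multiplied by the L^1 norm of [V],
   this is a bound [C] common to the scaled transforms and to the limit constant. *)
have [r /= r0 hr] : exists2 r, 0 < r & forall e, 0 < e -> e < r -> `|eta e| <= `|eta 0| + 1.
  have /cvgrPdist_le/(_ 1 ltr01) := cv; rewrite near_withinE => -[r /= r0 hr].
  exists r => // e e0 er; have := hr e; rewrite /= sub0r normrN (ger0_norm (ltW e0)).
  move=> /(_ er e0); rewrite distrC => h.
  by rewrite -[eta e](subrK (eta 0)) (le_trans (ler_normD _ _))// addrC lerD2l.
pose M := \int[@lebesgue_measure R]_x `|V x|.
have M0 : 0 <= M by apply: int_ge0 => x.
pose C := (`|eta 0| + 1) * M.
have hV := hmult_vhat Vi; have [mV bV jV] := hV.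
have IM : `|I| <= M by exact: int_norm.
have := @pos_op_cvg R (sym s) ms (sym_ge0 s) ai (fun e => vhat (scaled_potential eta V e))
  (fun=> (eta 0 * I)%:C) C r r0.
have hc : hmult (fun=> (eta 0 * I)%:C) C.
  split; first exact: cmeas_cst.
    move=> k; rewrite cabsR normrM ler_pM// lerDl//.
  by move=> k; rewrite cJR.
move=> /(_ hc) H.
have {H} := H _ _ _.
have h1 e : 0 < e -> exists C', hmult (vhat (scaled_potential eta V e)) C'.
  by move=> e0; eexists; exact: hmult_vhat (rint_scaled eta e0 Vi).
have h2 e : 0 < e -> e < r -> hmult (vhat (scaled_potential eta V e)) C.
  move=> e0 er; have [m1 _ j1] := hmult_vhat (rint_scaled eta e0 Vi); split => // k.
  by rewrite (vhat_scaled eta k e0 Vi) cabsM cabsR; apply: ler_pM; rewrite ?cabs_ge0 ?normr_ge0//; [exact: hr|exact: bV].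
move=> /(_ h1 h2) H.
have {H} [_ kk rr] : norm_resolvent_cvg (fun e => pos_op (sym s) (vhat (scaled_potential eta V e)))
    0^'+ (pos_op (sym s) (fun=> (eta 0 * I)%:C)).
  apply: H => k; apply/cvg_at_rightP => u [u0 uc].
  have e1 : eta (u n) @[n --> \oo] --> eta 0 by have := cv => /cvg_at_rightP; apply.
  have v1 := vhat_cvg0 k Vi uc.
  have c1 : `|eta (u n) - eta 0| * M + `|eta 0| * cabs (vhat V (u n * k) - I%:C)
      @[n --> \oo] --> (0 * M + `|eta 0| * 0 : R).
    apply: cvgD; last by apply: cvgM => //; exact: cvg_cst.
    apply: cvgM; last exact: cvg_cst.
    by apply/norm_cvg0P/subr_cvg0.
  rewrite mul0r mulr0 addr0 in c1; apply: (cvg0_squeeze _ c1) => n; rewrite cabs_ge0 /=.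
  rewrite (vhat_scaled eta k (u0 n) Vi) rmorphM /=.
  (* The error splits into the variation of eta times a bounded transform, and eta(0) times the
     variation of the transform between the frequency [u n * k] and 0. *)
  have -> : (eta (u n))%:C * vhat V (u n * k) - (eta 0)%:C * I%:C =
     (eta (u n) - eta 0)%:C * vhat V (u n * k) + (eta 0)%:C * (vhat V (u n * k) - I%:C).
    by rewrite rmorphB /=; ring.
  apply: le_trans (cabsD _ _) _; rewrite !cabsM !cabsR.
  by apply: lerD => //; apply: ler_wpM2l => //; exact: bV.
split.
- by near=> e; apply: sa; near: e; exact: nbhs_right_gt.
- exact: kk.
move=> z z0; have [T_ [T [hT hT0 cT]]] := rr z z0; exists T_, T; split => //.
(* The two descriptions of the operator are identified for e > 0, which is all that the right-hand
   filter at 0 sees. *)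
near=> e; have e0 : 0 < e by near: e; exact: nbhs_right_gt.
rewrite (form_sumE s1 (rint_scaled eta e0 Vi)); near: e; exact: hT.
Unshelve. all: by end_near. Qed.
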